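(* Let $k$ be an algebraically closed field of characteristic $3$, let $q_0$ be a power of $3$, and let $q=3q_0^2$. Let $\tilde{\mathcal{R}}$ be the smooth model of the curve over $k$ defined (in affine coordinates $x,y,z,t$) by $$y^q-y=x^{q_0}(x^q-x),\qquad z^q-z=x^{2q_0}(x^q-x),\qquad x^q-x=t^{q-3q_0+1}.$$ Let $C_{q-3q_0+1}\subset\mathrm{Aut}(\tilde{\mathcal{R}})$ be the cyclic group $$C_{q-3q_0+1}=\left\{(x,y,z,t)\mapsto(x,y,z,\zeta t)\ \middle|\ \zeta\in k,\ \zeta^{q-3q_0+1}=1\right\},$$ and let $H$ be a subgroup of $C_{q-3q_0+1}$. Then the curves $\tilde{\mathcal{R}}$ and $\tilde{\mathcal{R}}/H$ have plane models of degree $q^3+1$ with two (different) inner Galois points.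
   Context: A plane model of degree $d$ of a smooth projective curve $\mathcal{D}$ is the image $\varphi(\mathcal{D})$, a plane curve of degree $d$, of a morphism $\varphi: \mathcal{D}\to\mathbb{P}^2$ that is birational onto its image. For a plane curve $C \subset \mathbb{P}^2$, a point $P \in \mathbb{P}^2$ is a Galois point for $C$ if the function field extension $k(C)/\pi_P^*k(\mathbb{P}^1)$ induced by the projection $\pi_P: C \dashrightarrow \mathbb{P}^1$ from $P$ is Galois. A Galois point $P$ is called inner if $P$ is a smooth point of $C$ (in particular $P \in C$). $\tilde{\mathcal{R}}/H$ denotes the quotient curve. *)

(* Defs.v *)
(* A smooth projective curve over an algebraically closed field k is handled
   through its function field: a field K with an embedding iota : k -> K.  Its
   points are the valuation rings of K/k (the abstract nonsingular curve). *)
From HB Require Import structures.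
From mathcomp Require Import all_boot all_order all_algebra all_field.
From mathcomp Require Import mpoly.

Set Implicit Arguments.
Unset Strict Implicit.
Unset Printing Implicit Defensive.

Import GRing.Theory.
Local Open Scope ring_scope.

Section Curves.

Variable k : closedFieldType.

(* p(P) for a k-point P, and p(v) for a K-point v, of affine or homogeneous
   coordinates. *)
Definition eval_at n (p : {mpoly k[n]}) (P : 'cV[k]_n) : k :=
  p.@[fun i => P i 0].

Section FunctionField.

Variables (K : fieldType) (iota : {rmorphism k -> K}).

Definition eval_in n (p : {mpoly k[n]}) (v : 'cV[K]_n) : K :=
  mmap iota (fun i => v i 0) p.

(* K is the function field of the affine variety with set of k-points V, with
   coordinate functions v: the kernel of p |-> p(v) is the ideal of V, and every
   element of K is a quotient of polynomials in v. *)
Definition affine_function_field n (V : 'cV[k]_n -> Prop) (v : 'cV[K]_n) : Prop :=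
  (forall p, eval_in p v = 0 <-> forall P, V P -> eval_at p P = 0) /\
  (forall a, exists p r, eval_in r v != 0 /\ a = eval_in p v / eval_in r v).

(* K is the function field of the plane curve F = 0 (F an irreducible form): the
   field of fractions of degree 0 of k[X0,X1,X2]/(F), where g is the triple of
   homogeneous coordinates of the generic point.  This is also the condition
   that the morphism (g0 : g1 : g2) is birational onto that curve, i.e., that
   G/H |-> G(g)/H(g) is an isomorphism from the function field of F = 0 onto K. *)
Definition plane_function_field (F : {mpoly k[3]}) (g : 'cV[K]_3) : Prop :=
  (forall n (G : {mpoly k[3]}), G \is n.-homog ->
     eval_in G g = 0 <-> exists Q, G = Q * F) /\
  (forall a, exists n (G H : {mpoly k[3]}),
     [/\ G \is n.-homog, H \is n.-homog, eval_in H g != 0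
       & a = eval_in G g / eval_in H g]).

(* The valuation rings k < O < K of K/k, i.e., the points of the smooth curve. *)
Record curve_point (O : K -> Prop) : Prop := CurvePoint {
  curve_point_const : forall c, O (iota c);
  curve_point_add : forall a b, O a -> O b -> O (a + b);
  curve_point_mul : forall a b, O a -> O b -> O (a * b);
  curve_point_val : forall a, a != 0 -> O a \/ O a^-1;
  curve_point_proper : exists a, ~ O a
}.

Definition vanishes_at (O : K -> Prop) (a : K) : Prop :=
  O a /\ (a = 0 \/ ~ O a^-1).

Definition has_value (O : K -> Prop) (a : K) (c : k) : Prop :=
  vanishes_at O (a - iota c).

(* The morphism (f0 : f1 : f2) to P^2 sends the point O to P: after rescaling by
   some h, all the f_i are regular at O, with values the coordinates of P. *)
Definition maps_to (f : 'cV[K]_3) (O : K -> Prop) (P : 'cV[k]_3) : Prop :=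
  P != 0 /\ exists2 h : K, h != 0 & forall i, has_value O (h * f i 0) (P i 0).

(* The field of rational functions in the binary homogeneous coordinates w. *)
Definition pencil_field (w : 'cV[K]_2) (a : K) : Prop :=
  exists n (A B : {mpoly k[2]}),
    [/\ A \is n.-homog, B \is n.-homog, eval_in B w != 0
      & a = eval_in A w / eval_in B w].

End FunctionField.

Section Galois.

Variables (L : fieldType) (S : L -> Prop).

Definition coefs_in (p : {poly L}) : Prop := forall i, S p`_i.

Definition minimal_poly (a : L) (p : {poly L}) : Prop :=
  [/\ p \is monic, coefs_in p, root p a
    & forall r, coefs_in r -> root r a -> p %| r].

(* L is algebraic, separable and normal over its subfield S. *)
Definition galois_extension : Prop :=
  forall a : L, exists p : {poly L},
    [/\ minimal_poly a p, separable_poly p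
      & exists s : seq L, p = \prod_(b <- s) ('X - b%:P)].

End Galois.

Definition irreducible_mpoly n (F : {mpoly k[n]}) : Prop :=
  [/\ F != 0, F \isn't a GRing.unit
    & forall G H, F = G * H -> G \is a GRing.unit \/ H \is a GRing.unit].

(* Points of P^2 are represented by nonzero column vectors. *)
Definition same_point (P Q : 'cV[k]_3) : Prop := exists c : k, P = c *: Q.

Definition smooth_point (F : {mpoly k[3]}) (P : 'cV[k]_3) : Prop :=
  [/\ P != 0, eval_at F P = 0 & exists i, eval_at (mderiv i F) P != 0].

(* The rows of M are two independent linear forms vanishing at P, so that
   X |-> M *m X is the projection from P, in some coordinates on P^1. *)
Definition projection_from (P : 'cV[k]_3) (M : 'M[k]_(2, 3)) : Prop :=
  \rank M = 2%N /\ M *m P = 0.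

(* The function field L of the curve F = 0 is unique up to isomorphism, and the
   subfield of L does not depend on the coordinates M chosen on P^1. *)
Definition galois_point (F : {mpoly k[3]}) (P : 'cV[k]_3) : Prop :=
  P != 0 /\
  exists (L : fieldType) (iota : {rmorphism k -> L}) (g : 'cV[L]_3)
         (M : 'M[k]_(2, 3)),
    [/\ plane_function_field iota F g, projection_from P M
      & galois_extension (pencil_field iota (map_mx iota M *m g))].

Definition inner_galois_point (F : {mpoly k[3]}) (P : 'cV[k]_3) : Prop :=
  galois_point F P /\ smooth_point F P.

(* The plane curve F = 0, of degree d, is the image of (f0 : f1 : f2), which is
   birational onto it. *)
Definition plane_model (K : fieldType) (iota : {rmorphism k -> K}) (d : nat)
    (f : 'cV[K]_3) (F : {mpoly k[3]}) : Prop :=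
  [/\ f != 0,
      F \is d.-homog /\ irreducible_mpoly F,
      forall P : 'cV[k]_3, P != 0 ->
        (eval_at F P = 0 <-> exists2 O, curve_point iota O & maps_to iota f O P)
    & plane_function_field iota F f].

Definition has_plane_model_with_two_inner_galois_points
    (K : fieldType) (iota : {rmorphism k -> K}) (d : nat) : Prop :=
  exists (f : 'cV[K]_3) (F : {mpoly k[3]}),
    plane_model iota d f F /\
    exists P1 P2 : 'cV[k]_3,
      [/\ inner_galois_point F P1, inner_galois_point F P2
        & ~ same_point P1 P2].

Section Automorphisms.

Variables (K : fieldType) (iota : {rmorphism k -> K}).

(* Automorphisms of the smooth curve, acting on functions. *)
Definition curve_aut (s : K -> K) : Prop :=
  [/\ bijective s, {morph s : a b / a + b}, {morph s : a b / a * b}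
    & forall c, s (iota c) = iota c].

Definition aut_subgroup (H : (K -> K) -> Prop) : Prop :=
  [/\ forall s, H s -> curve_aut s,
      H id,
      forall s r, H s -> H r -> H (s \o r)
    & forall s, H s -> exists r, [/\ H r, cancel s r & cancel r s]].

(* L, embedded in K by j, is the function field of the quotient curve by H: the
   fixed field of H. *)
Definition quotient_function_field (H : (K -> K) -> Prop)
    (L : fieldType) (iotaL : {rmorphism k -> L}) (j : {rmorphism L -> K}) : Prop :=
  (forall c, j (iotaL c) = iota c) /\
  (forall a, (exists b, j b = a) <-> (forall s, H s -> s a = a)).

End Automorphisms.

End Curves.

Definition col4 (R : fieldType) (x y z t : R) : 'cV[R]_4 :=
  \col_i tnth [tuple x; y; z; t] i.

Definition ree_m (q0 q : nat) : nat := (q - 3 * q0 + 1)%N.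

Definition ree_cover (k : closedFieldType) (q0 q : nat) (P : 'cV[k]_4) : Prop :=
  exists x y z t : k,
    [/\ P = col4 x y z t,
        y ^+ q - y = x ^+ q0 * (x ^+ q - x),
        z ^+ q - z = x ^+ (2 * q0) * (x ^+ q - x)
      & x ^+ q - x = t ^+ ree_m q0 q].

Definition ree_cyclic_group (k : closedFieldType) (K : fieldType)
    (iota : {rmorphism k -> K}) (q0 q : nat) (x y z t : K) (s : K -> K) : Prop :=
  curve_aut iota s /\
  exists2 zeta : k, zeta ^+ ree_m q0 q = 1
    & [/\ s x = x, s y = y, s z = z & s t = iota zeta * t].

(* Main.v *)
Require Import Defs.
From HB Require Import structures.
From mathcomp Require Import all_boot all_order all_algebra all_fingroup all_field.
From mathcomp Require Import cyclic mpoly.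
From mathcomp Require Import ring zify.
From mathcomp Require boolp classical_sets.
Set Implicit Arguments.
Unset Strict Implicit.
Unset Printing Implicit Defensive.
Import GRing.Theory.
Local Open Scope ring_scope.

(** Put m = q - 3 q0 + 1, so that m (q + 1) (q + 3 q0 + 1) = q^3 + 1.  For every
    factorization m = n r, consider the curve
      y^q - y = x^q0 (x^q - x),   z^q - z = x^(2 q0) (x^q - x),   x^q - x = s^n.
    For n = m it is the given curve; for general n it is its quotient by the
    group of order r, with s = t^r.  These are all the quotients in question:
    H acts through a cyclic group of r-th roots of unity, where r divides m, and
    averaging over a generator shows that the fixed field is k(x, y, z, t^r)
    ([quotient_generator], [fixed_rational_power], [eval_in_power_eq0]).  So it
    is enough to treat the curve above for an arbitrary n, with function field K.

    The plane model is (1 : u : s) with u = w^r, where w is the polynomial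
    function called [w8] below, one of the ten functions which, together with x, y
    and z, embed the Ree curve in projective space.  The projections from the
    points (0 : 1 : 0) and (1 : 0 : 0) are given by s and s / u.

    The first point is Galois.  The q^3 translations
      x + al,   y + al^q0 x + be,   z - al^q0 y + al^(2 q0) x + ga
    with al, be, ga in F_q form a group that fixes s.  An invariant regular
    function is a polynomial in s: in each of the three Artin-Schreier steps from
    k[s] to k[s, x, y, z], a polynomial of degree less than q with q equal values
    is constant ([regular_fixed]).  Hence the fixed field is k(s), and K / k(s)
    is Galois by Artin.

    The model is birational, of degree q^3 + 1.  At a place where s has a pole,
    compare pole orders with that of s.  If a^q - a = b has a pole, then its order
    is q times that of a.  Applied to the equations of x, y, z, and to those of three of
    the ten functions, this shows that q^3 times the order of u is q^3 + 1 times
    the order of s, and the same holds for all conjugates of u ([ree_degree]).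
    Let l be the number of conjugates.  Their product is a polynomial in s, so that
    q^3 divides l (q^3 + 1); as l is at most q^3, it is equal to q^3
    ([full_orbit_lift]).  Therefore K = k(s, u), and the polynomial N with the
    conjugates of u as roots has total degree q^3 + 1 in s and u.  Its
    homogenization F is the equation of the model.
    As N is monic of degree q^3 in u, the curve F = 0 is smooth at (0 : 1 : 0).

    The second point is the image of the first one under a symmetry.  The Ree
    curve has an involution that sends w to 1 / w and, on the curve above, s to
    s / w^r ([ree_involution]).  Thus (1 : u : s) is sent to (u : 1 : s), a zero of
    F as well, so that exchanging the first two coordinates multiplies F by
    a constant.

    Finally, every point of the curve F = 0 is the image of a place, because its
    local ring is dominated by a valuation ring ([chevalley_extension]). *)

(** * The Ree functions and the identities among them in characteristic 3 *)

Section ReeFormulas.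
Variable R : comNzRingType.
Implicit Types x y z a A B C D : R.

(** The letters [w1], .., [w10] stand for the ten functions on the Ree curve other
    than x, y, z, in the classical numbering, as polynomials in x, y, z and
    A = x^(3 q0), B = y^(3 q0), C = z^(3 q0), with a = x^q0.  Here [wv] is the
    function called v in the literature.  The prefix phi_ marks
    the q0-th power of a function, and psi_ its 3 q0-th power, reduced by means of
    the equations of the curve to a polynomial in the same variables. *)
Definition w1 x A B := x * A - B.
Definition w2 x B C := x * B - C.
Definition w3 x y A C := x * C - A * x ^+ 3 + y ^+ 3.
Definition w4 x y z := y ^+ 2 - x * z.
Definition wv x y z A B := y * z - x * w1 x A B.
Definition w5 x y z A B := z ^+ 2 - y * w1 x A B.
Definition w7 x y z A B C := wv x y z A B + w2 x B C.
Definition psi_v x y A B C := B * C - A * (A * x ^+ 3 - y ^+ 3).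
Definition psi_w5 x y A B C := C ^+ 2 - B * (A * x ^+ 3 - y ^+ 3).
Definition psi_w7 x y z A B C := B * C - A ^+ 2 * x ^+ 3 - A * y ^+ 3 - z ^+ 3.
Definition w6 x z A B C := B * C - A ^+ 2 * x ^+ 3 + z ^+ 3 + x * w4 A B C.
Definition w8 x y z A B C :=
  C ^+ 2 - A * B * x ^+ 3 + B * y ^+ 3 + x * psi_w7 x y z A B C.

Definition phi_w1 x y a := a * x - y.
Definition phi_w2 y z a := a * y - z.
Definition phi_w3 x z a B := a * z - a ^+ 3 * x + B.
Definition phi_w6 x y z a C := y * z - a ^+ 3 * x ^+ 2 + C + a * w4 x y z.
Definition phi_w8 x y z a B C :=
  z ^+ 2 - a ^+ 3 * x * y + y * B + a * (y * z - a ^+ 3 * x ^+ 2 - x * B - C).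

Definition w9 x y z a C := w4 x y z * phi_w2 y z a - y * phi_w6 x y z a C.
Definition w10 x y z a B C := z * phi_w6 x y z a C - phi_w3 x z a B * w4 x y z.
Definition psi_w9 x z A B C := w4 A B C * w2 x B C - B * w6 x z A B C.
Definition psi_w10 x y z A B C := C * w6 x z A B C - w3 x y A C * w4 A B C.

(** The cofactor of [phi_w6] in [kernel_formE]. *)
Definition kernel_form x y z a B C :=
  z * C + y * a * C - y * z ^+ 2 + y ^+ 2 * B + y ^+ 2 * z * a - y ^+ 3 * a ^+ 2
  + x * a ^+ 2 * C + x * z ^+ 2 * a + x * y * a * B - x * y ^+ 2 * a ^+ 3
  + x ^+ 2 * a ^+ 2 * B - x ^+ 2 * z * a ^+ 3 + x ^+ 2 * y * a ^+ 4 + x ^+ 3 * a ^+ 5.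

End ReeFormulas.

Lemma rmorph_w8 (R S : comNzRingType) (th : {rmorphism R -> S}) (x y z A B C : R) :
  th (w8 x y z A B C) = w8 (th x) (th y) (th z) (th A) (th B) (th C).
Proof.
by rewrite /w8 /psi_w7 !(rmorphXn, rmorphD, rmorphN, rmorphM).
Qed.

Section ReeFunctions.
Variable R : fieldType.
Implicit Types x y z a A B C D : R.
Hypothesis char3 : 3 \in [pchar R].

(** The identities below hold modulo 3 only.  Each is reduced to one over the
    integers by an explicit multiple 3 s of 3, so that the commutative ring
    decision procedure applies; the cofactors s come from a computation. *)
Lemma eq_char3 (p r s : R) : p = r + 3%:R * s -> p = r.
Proof. by rewrite (pcharf0 char3) mul0r addr0. Qed.

Lemma cubeD (x y : R) : (x + y) ^+ 3 = x ^+ 3 + y ^+ 3.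
Proof. by apply: (eq_char3 (s := x ^+ 2 * y + x * y ^+ 2)); ring. Qed.

Lemma cubeN (x : R) : (- x) ^+ 3 = - x ^+ 3.
Proof. by ring. Qed.

Lemma cubeB (x y : R) : (x - y) ^+ 3 = x ^+ 3 - y ^+ 3.
Proof. by apply: (eq_char3 (s := x * y ^+ 2 - x ^+ 2 * y)); ring. Qed.

Ltac unfold_ree := rewrite /psi_w9 /psi_w10 /w9 /w10 /phi_w1 /phi_w2 /phi_w3 /phi_w6 /phi_w8
  /w6 /w8 /w7 /psi_v /psi_w5 /psi_w7 /w5 /wv /w4 /w3 /w2 /w1.
Ltac ring_mod3 r := unfold_ree; apply: (eq_char3 (s := r)); ring.

Section Identities.
Variables (x y z a A B C : R).
Hypothesis hA : A = a ^+ 3.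

Lemma cube_phi_w1 : phi_w1 x y a ^+ 3 = A * x ^+ 3 - y ^+ 3.
Proof. by rewrite cubeB exprMn hA. Qed.

Lemma cube_phi_w2 : phi_w2 y z a ^+ 3 = A * y ^+ 3 - z ^+ 3.
Proof. by rewrite cubeB exprMn hA. Qed.

Lemma cube_phi_w3 : phi_w3 x z a B ^+ 3 = A * z ^+ 3 - A ^+ 3 * x ^+ 3 + B ^+ 3.
Proof. by rewrite /phi_w3 -hA /w4 !(cubeD, cubeN, exprMn) -hA; ring. Qed.

Lemma cube_phi_w6 : phi_w6 x y z a C ^+ 3 =
  y ^+ 3 * z ^+ 3 - A ^+ 3 * x ^+ 6 + C ^+ 3 + A * (y ^+ 6 - x ^+ 3 * z ^+ 3).
Proof. by rewrite /phi_w6 -hA /w4 !(cubeD, cubeN, exprMn) -hA; ring. Qed.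

Lemma cube_phi_w8 : phi_w8 x y z a B C ^+ 3 =
  z ^+ 6 - A ^+ 3 * x ^+ 3 * y ^+ 3 + y ^+ 3 * B ^+ 3
  + A * (y ^+ 3 * z ^+ 3 - A ^+ 3 * x ^+ 6 - x ^+ 3 * B ^+ 3 - C ^+ 3).
Proof. by rewrite /phi_w8 -hA /w4 !(cubeD, cubeN, exprMn) -hA; ring. Qed.

Lemma w8_quadric : w8 x y z A B C =
  w2 x B C ^+ 2 - x * w6 x z A B C - w1 x A B * w3 x y A C.
Proof. by ring_mod3 (x * B * C - A ^+ 2 * x ^+ 4). Qed.

Lemma w68_wronskian : w8 x y z A B C * w4 A B C - w6 x z A B C * psi_w7 x y z A B C
  = phi_w8 x y z a B C ^+ 3.
Proof. by rewrite cube_phi_w8; ring_mod3 (A ^+ 2 * x ^+ 3 * B * C). Qed.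

(** D times the left-hand side is w4 sigma(w8) - sigma(w4) w8, by [sigma_w4] and
    [sigma_w8]. *)
Lemma kernel_formE : (a * y + z + a ^+ 2 * x) * w8 x y z A B C
  + w4 x y z * psi_w7 x y z A B C = phi_w6 x y z a C * kernel_form x y z a B C.
Proof.
rewrite /kernel_form hA.
ring_mod3 (- y ^+ 2 * z * a * C - x * y * z ^+ 3 * a + x ^+ 2 * z * a ^+ 3 * C - x ^+ 2 * y ^+ 3 * a ^+ 5
  - x ^+ 3 * y ^+ 2 * a ^+ 6).
Qed.

Lemma w8_wronskian_sqr : a ^+ 2 * w8 x y z A B C - z * psi_w7 x y z A B C
  + phi_w3 x z a B * kernel_form x y z a B C = phi_w8 x y z a B C ^+ 2.
Proof.
rewrite /kernel_form hA.
ring_mod3 (z ^+ 2 * a * C + y * a * B * C + y * z * a ^+ 2 * C - y * z ^+ 2 * B - y * z ^+ 3 * a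
 + x * z ^+ 2 * a * B + x * y * a * B ^+ 2 - x * y * a ^+ 4 * C + x * y * z * a ^+ 2 * B
 + x * y * z ^+ 2 * a ^+ 3 - x ^+ 2 * a ^+ 5 * C + x ^+ 2 * y * z * a ^+ 5 - x ^+ 3 * a ^+ 5 * B
 + x ^+ 3 * z * a ^+ 6 - x ^+ 3 * y * a ^+ 7 - x ^+ 4 * a ^+ 8).
Qed.

Lemma w8_wronskian_mul : y * psi_w7 x y z A B C - a * w8 x y z A B C
  - phi_w2 y z a * kernel_form x y z a B C = phi_w6 x y z a C * phi_w8 x y z a B C.
Proof.
rewrite /kernel_form hA.
ring_mod3 (- y * z ^+ 3 - y ^+ 3 * a * B - y ^+ 3 * z * a ^+ 2 + x * z ^+ 3 * a + x * y * z * a * B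
 + x * y ^+ 3 * a ^+ 4 + x ^+ 2 * y * z * a ^+ 4 - x ^+ 3 * y * a ^+ 6).
Qed.

(** This and the next identity compare the increments of [w10] and [w9] with that
    of [w8]: they say that the quotients y' = w10 / w8 and z' = w9 / w8 satisfy
    the equations of the curve with respect to x' = w6 / w8, for which
    [w68_wronskian] plays the same role. *)
Lemma w10_wronskian : w8 x y z A B C *
    (a ^+ 2 * phi_w6 x y z a C + phi_w3 x z a B * (a * y + z + a ^+ 2 * x))
  - w10 x y z a B C * psi_w7 x y z A B C = phi_w6 x y z a C * phi_w8 x y z a B C ^+ 2.
Proof.
rewrite -w8_wronskian_sqr [RHS]mulrDr [X in _ = _ + X]mulrCA -kernel_formE /w10.
by ring.
Qed.

Lemma w9_wronskian : - (w8 x y z A B C *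
    ((a * y + z + a ^+ 2 * x) * phi_w2 y z a + a * phi_w6 x y z a C))
  - w9 x y z a C * psi_w7 x y z A B C = phi_w6 x y z a C ^+ 2 * phi_w8 x y z a B C.
Proof.
rewrite [phi_w6 _ _ _ _ _ ^+ 2]expr2 -[RHS]mulrA -w8_wronskian_mul [RHS]mulrBr [X in _ = _ - X]mulrCA.
by rewrite -kernel_formE /w9; ring.
Qed.

(** This and the next five identities express how the involution acts, up to the
    factor [w8]: w1 and w3 are exchanged, w4 goes to w5, and w6 to x, whereas w2 and
    v change sign. *)
Lemma w1_dual : w6 x z A B C * phi_w6 x y z a C ^+ 3 - psi_w10 x y z A B C * w8 x y z A B C
  = w3 x y A C * phi_w8 x y z a B C ^+ 3.
Proof.
rewrite cube_phi_w8 cube_phi_w6.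
ring_mod3 (x ^+ 3 * y ^+ 3 * A ^+ 2 * B * C + x ^+ 4 * A ^+ 2 * B * C ^+ 2 - x ^+ 6 * A ^+ 3 * B * C).
Qed.

Lemma w2_dual : w6 x z A B C * psi_w10 x y z A B C - psi_w9 x z A B C * w8 x y z A B C
  = - (w2 x B C * phi_w8 x y z a B C ^+ 3).
Proof.
rewrite cube_phi_w8.
ring_mod3 (B ^+ 2 * C ^+ 3 + z ^+ 3 * B * C ^+ 2 + x * B ^+ 3 * C ^+ 2 - x * A * B * C ^+ 3
 - x ^+ 3 * A ^+ 2 * B * C ^+ 2 - x ^+ 3 * z ^+ 3 * A ^+ 2 * C - 2%:R * x ^+ 4 * A ^+ 2 * B ^+ 2 * C
 + x ^+ 4 * A ^+ 3 * C ^+ 2 + x ^+ 6 * A ^+ 4 * C).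
Qed.

Lemma w3_dual : w6 x z A B C * psi_w9 x z A B C - phi_w3 x z a B ^+ 3 * w8 x y z A B C
  = w1 x A B * phi_w8 x y z a B C ^+ 3.
Proof.
rewrite cube_phi_w8 cube_phi_w3.
ring_mod3 (- B ^+ 3 * C ^+ 2 - z ^+ 3 * B ^+ 2 * C - x * B ^+ 4 * C + x * A * B ^+ 2 * C ^+ 2
 + x ^+ 3 * A ^+ 2 * B ^+ 2 * C + x ^+ 3 * z ^+ 3 * A ^+ 2 * B + x ^+ 4 * A ^+ 2 * B ^+ 3
 - x ^+ 6 * A ^+ 4 * B).
Qed.

Lemma w4_dual : w10 x y z a B C ^+ 2 - w6 x z A B C * w9 x y z a C
  = w8 x y z A B C * w5 x y z A B.
Proof.
rewrite hA.
ring_mod3 (y * z ^+ 3 * C + y ^+ 2 * z ^+ 4 - y ^+ 3 * z ^+ 2 * B + x * y * z ^+ 3 * B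
 + x * y ^+ 3 * z ^+ 2 * a ^+ 3 - x ^+ 2 * z ^+ 2 * a ^+ 3 * C - 2%:R * x ^+ 2 * y * z ^+ 3 * a ^+ 3
 + 2%:R * x ^+ 2 * y ^+ 2 * z * a ^+ 3 * B - x ^+ 3 * z ^+ 2 * a ^+ 3 * B
 - 2%:R * x ^+ 3 * y ^+ 2 * z * a ^+ 6 + 2%:R * x ^+ 4 * z ^+ 2 * a ^+ 6).
Qed.

Lemma v_dual : w10 x y z a B C * w9 x y z a C - w6 x z A B C * w3 x y A C
  = - (w8 x y z A B C * wv x y z A B).
Proof.
rewrite hA.
ring_mod3 (- y ^+ 2 * z ^+ 2 * C - y ^+ 3 * z ^+ 3 + y ^+ 4 * z * B - x * y ^+ 2 * z ^+ 2 * B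
 - x * y ^+ 4 * z * a ^+ 3 + x ^+ 2 * y * z * a ^+ 3 * C + 2%:R * x ^+ 2 * y ^+ 2 * z ^+ 2 * a ^+ 3
 - x ^+ 2 * y ^+ 3 * a ^+ 3 * B + x ^+ 3 * y ^+ 3 * a ^+ 6 - x ^+ 4 * y * z * a ^+ 6).
Qed.

Lemma w6_dual : w6 x z A B C * psi_w5 x y A B C
  - (psi_v x y A B C - phi_w2 y z a ^+ 3) * w8 x y z A B C = x * phi_w8 x y z a B C ^+ 3.
Proof. by rewrite cube_phi_w8 cube_phi_w2; ring_mod3 (x ^+ 4 * A ^+ 2 * B * C). Qed.

End Identities.

(** For the curve, phi is the q0-Frobenius, so that sigma is the q-Frobenius, as
    q = 3 q0^2.  An arbitrary endomorphism phi keeps q0 out of the computations. *)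
Section TwistedCurve.
Variable phi : {rmorphism R -> R}.
Definition sigma (u : R) : R := phi (phi u) ^+ 3.

Definition on_ree_curve x y z :=
  sigma y - y = phi x * (sigma x - x) /\ sigma z - z = phi x ^+ 2 * (sigma x - x).

Definition ree_w x y z := w8 x y z (phi x ^+ 3) (phi y ^+ 3) (phi z ^+ 3).

Lemma sigmaD u v : sigma (u + v) = sigma u + sigma v.
Proof. by rewrite /sigma !rmorphD cubeD. Qed.
Lemma sigmaN u : sigma (- u) = - sigma u.
Proof. by rewrite /sigma !rmorphN cubeN. Qed.
Lemma sigmaB u v : sigma (u - v) = sigma u - sigma v.
Proof. by rewrite sigmaD sigmaN. Qed.
Lemma sigmaM u v : sigma (u * v) = sigma u * sigma v.
Proof. by rewrite /sigma !rmorphM exprMn. Qed.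
Lemma sigmaX u n : sigma (u ^+ n) = sigma u ^+ n.
Proof. by rewrite /sigma !rmorphXn -!exprM mulnC. Qed.
Lemma sigma_phi u : sigma (phi u) = phi (sigma u).
Proof. by rewrite /sigma rmorphXn. Qed.
Lemma phi_cube u : phi (phi u ^+ 3) = sigma u.
Proof. by rewrite rmorphXn. Qed.
Lemma sigmaV u : sigma u^-1 = (sigma u)^-1.
Proof. by rewrite /sigma !fmorphV exprVn. Qed.

Let phiE := (rmorphD phi, rmorphN phi, rmorphM phi).
Let sigmaE := (sigmaD, sigmaN, sigmaM, sigmaX).

Variables x y z : R.
Hypothesis curve : on_ree_curve x y z.
Let a := phi x.
Let A := a ^+ 3.
Let B := phi y ^+ 3.
Let C := phi z ^+ 3.
Let D := sigma x - x.

Let sx : sigma x = x + D. Proof. by rewrite /D addrC subrK. Qed.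
Let sy : sigma y = y + a * D. Proof. by rewrite -curve.1 addrC subrK. Qed.
Let sz : sigma z = z + a ^+ 2 * D. Proof. by rewrite -curve.2 addrC subrK. Qed.
Let sa : sigma a = a + phi D. Proof. by rewrite sigma_phi sx rmorphD. Qed.
Let phiA : phi A = x + D. Proof. by rewrite /A phi_cube sx. Qed.
Let phiB : phi B = y + a * D. Proof. by rewrite /B phi_cube sy. Qed.
Let phiC : phi C = z + a ^+ 2 * D. Proof. by rewrite /C phi_cube sz. Qed.
Let sA : sigma A = A + phi D ^+ 3. Proof. by rewrite sigmaX sa cubeD. Qed.
Let sB : sigma B = B + (x + D) * phi D ^+ 3.
Proof. by rewrite sigmaX sigma_phi sy rmorphD rmorphM cubeD exprMn -/(sigma x) sx. Qed.
Let sC : sigma C = C + (x + D) ^+ 2 * phi D ^+ 3.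
Proof.
by rewrite sigmaX sigma_phi sz rmorphD rmorphM cubeD exprMn rmorphXn exprAC -/(sigma x) sx.
Qed.

Let phi_cubes : (phi x = a) * (phi (x ^+ 3) = A) * (phi (y ^+ 3) = B) * (phi (z ^+ 3) = C).
Proof. by rewrite !rmorphXn. Qed.

Let pE := (phiA, phiB, phiC, phi_cubes, phiE, rmorphXn phi).
Let sE := (sA, sB, sC, sx, sy, sz, sigmaE).

(** The images of A, B, C under phi are sigma x, sigma y, sigma z, which the equations
    of the curve express by x, y, z, a and D; the terms with D cancel. *)
Lemma phi_w1E : phi (w1 x A B) = phi_w1 x y a.
Proof. by rewrite /w1 /phi_w1 !pE; ring. Qed.
Lemma phi_w2E : phi (w2 x B C) = phi_w2 y z a.
Proof. by rewrite /w2 /phi_w2 !pE; ring. Qed.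
Lemma phi_w3E : phi (w3 x y A C) = phi_w3 x z a B.
Proof. by rewrite /w3 /phi_w3 !pE /A; ring. Qed.
Lemma phi_w6E : phi (w6 x z A B C) = phi_w6 x y z a C.
Proof.
rewrite /w6 /w4 !pE /A.
by ring_mod3 (y * a ^+ 2 * D - x * a ^+ 3 * D).
Qed.
Lemma phi_w8E : phi (w8 x y z A B C) = phi_w8 x y z a B C.
Proof.
rewrite /w8 /psi_w7 !pE /A.
by ring_mod3 (z * a ^+ 2 * D - x * a ^+ 4 * D).
Qed.
Lemma psi_w4E : phi (w4 x y z) ^+ 3 = w4 A B C.
Proof. by rewrite /w4 !rmorphB !rmorphM cubeB !exprMn -/a; rewrite -/A /B /C; ring. Qed.
Lemma psi_w5E : phi (w5 x y z A B) ^+ 3 = psi_w5 x y A B C.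
Proof.
rewrite /w5 rmorphB [phi (y * _)]rmorphM phi_w1E cubeB [X in _ - X]exprMn.
by rewrite (cube_phi_w1 _ _ (erefl A)) rmorphXn exprAC.
Qed.
Lemma psi_vE : phi (wv x y z A B) ^+ 3 = psi_v x y A B C.
Proof. by rewrite /wv rmorphB !rmorphM phi_w1E cubeB !exprMn (cube_phi_w1 _ _ (erefl A)). Qed.
Lemma psi_w7E : phi (w7 x y z A B C) ^+ 3 = psi_w7 x y z A B C.
Proof.
rewrite /w7 rmorphD phi_w2E cubeD psi_vE (cube_phi_w2 _ _ (erefl A)) /psi_v /psi_w7.
by ring_mod3 (A * y ^+ 3).
Qed.

Lemma sigma_w1 : sigma (w1 x A B) = w1 x A B + A * D.
Proof. by rewrite /w1 !sE; ring. Qed.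
Lemma sigma_w2 : sigma (w2 x B C) = w2 x B C + B * D.
Proof. by rewrite /w2 !sE; ring. Qed.
Lemma sigma_w3 : sigma (w3 x y A C) = w3 x y A C + C * D.
Proof.
rewrite /w3 !sE /A.
ring_mod3 (y * a ^+ 2 * D ^+ 2 + y ^+ 2 * a * D - x * a ^+ 3 * D ^+ 2 - x ^+ 2 * a ^+ 3 * D).
Qed.
Lemma sigma_w4 : sigma (w4 x y z) = w4 x y z - (a * y + z + a ^+ 2 * x) * D.
Proof. by rewrite /w4 !sE; ring_mod3 (a * y * D). Qed.
Lemma sigma_w6 : sigma (w6 x z A B C) = w6 x z A B C + w4 A B C * D.
Proof.
rewrite /w6 /w4 !sE /A; set d := phi D.
ring_mod3 (B * D ^+ 2 * d ^+ 3 - a ^+ 3 * D ^+ 3 * d ^+ 3 + z * a ^+ 4 * D ^+ 2 + z ^+ 2 * a ^+ 2 * D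
 + 2%:R * x * B * D * d ^+ 3 - 3%:R * x * a ^+ 3 * D ^+ 2 * d ^+ 3 - x * a ^+ 6 * D ^+ 2
 + x ^+ 2 * B * d ^+ 3 - 3%:R * x ^+ 2 * a ^+ 3 * D * d ^+ 3 - x ^+ 2 * a ^+ 6 * D
 - x ^+ 3 * a ^+ 3 * d ^+ 3).
Qed.
Lemma sigma_w7 : sigma (w7 x y z A B C) =
  w7 x y z A B C + (a * z + a ^+ 2 * y + w1 x A B) * D.
Proof.
rewrite /w7 /wv sigmaD sigma_w2 sigmaB !sigmaM sigma_w1 sx sy sz /A.
ring_mod3 (B * D - x * a ^+ 3 * D).
Qed.
Lemma sigma_w8 : sigma (w8 x y z A B C) = w8 x y z A B C + psi_w7 x y z A B C * D.
Proof.
rewrite (w8_quadric x y z A B C) !sigmaB sigmaX !sigmaM sigma_w1 sigma_w2 sigma_w3 sigma_w6 sx /A.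
ring_mod3 (x ^+ 3 * a ^+ 6 * D - B * C * D).
Qed.

Lemma sigma_w9 : sigma (w9 x y z a C) = w9 x y z a C
  - ((a * y + z + a ^+ 2 * x) * phi_w2 y z a + a * phi_w6 x y z a C) * D.
Proof.
rewrite /w9 -phi_w6E -phi_w2E sigmaB !sigmaM !sigma_phi sigma_w6 sigma_w2 sy.
rewrite [phi (_ + w4 A B C * D)]rmorphD [phi (_ + B * D)]rmorphD [phi (w4 _ _ _ * D)]rmorphM.
rewrite [phi (B * D)]rmorphM.
rewrite -psi_w4E phi_cube sigma_w4 phiB phi_w6E phi_w2E.
set p := phi_w6 _ _ _ _ _; set r := phi_w2 _ _ _.
by ring.
Qed.
Lemma sigma_w10 : sigma (w10 x y z a B C) = w10 x y z a B C
  + (a ^+ 2 * phi_w6 x y z a C + phi_w3 x z a B * (a * y + z + a ^+ 2 * x)) * D.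
Proof.
rewrite /w10 -phi_w6E -phi_w3E sigmaB !sigmaM !sigma_phi sigma_w6 sigma_w3 sz.
rewrite [phi (_ + w4 A B C * D)]rmorphD [phi (_ + C * D)]rmorphD [phi (w4 _ _ _ * D)]rmorphM.
rewrite [phi (C * D)]rmorphM.
rewrite -psi_w4E phi_cube sigma_w4 phiC phi_w6E phi_w3E.
set p := phi_w6 _ _ _ _ _; set r := phi_w3 _ _ _ _.
by ring.
Qed.
Lemma psi_w9E : phi (w9 x y z a C) ^+ 3 = psi_w9 x z A B C.
Proof.
rewrite /w9 -phi_w6E -phi_w2E rmorphB !rmorphM cubeB !exprMn psi_w4E -!/(sigma _).
by rewrite sigma_w2 sigma_w6 /psi_w9 -/B; ring.
Qed.
Lemma psi_w10E : phi (w10 x y z a B C) ^+ 3 = psi_w10 x y z A B C.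
Proof.
rewrite /w10 -phi_w6E -phi_w3E rmorphB !rmorphM cubeB !exprMn psi_w4E -!/(sigma _).
by rewrite sigma_w3 sigma_w6 /psi_w10 -/C; ring.
Qed.

End TwistedCurve.

(** The involution is x' = w6 / w8, y' = w10 / w8, z' = w9 / w8.  The equations of
    the curve for (x', y', z') follow from the identities that give the increments
    sigma f - f of w6, w8, w9 and w10.  That w8 goes to its inverse is read off
    from the quadric [w8_quadric], whose other terms are permuted by the
    involution. *)
Lemma ree_involution (phi : {rmorphism R -> R}) x y z (curve : on_ree_curve phi x y z) : ree_w phi x y z != 0 ->
  exists x' y' z', [/\ on_ree_curve phi x' y' z',
    sigma phi x' - x' = (sigma phi x - x) * phi (ree_w phi x y z) ^+ 3 / (ree_w phi x y z * sigma phi (ree_w phi x y z))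
    & ree_w phi x' y' z' = (ree_w phi x y z)^-1].
Proof.
rewrite /ree_w; set A := phi x ^+ 3; set B := phi y ^+ 3; set C := phi z ^+ 3.
set D := sigma phi x - x; set a := phi x in A *; move=> w8n0.
set W8 := w8 x y z A B C in w8n0 *.
have p8n0 : phi_w8 x y z a B C != 0 by rewrite -(phi_w8E curve) fmorph_eq0.
have s8n0 : sigma phi W8 != 0 by rewrite /sigma expf_eq0 /= !fmorph_eq0.
rewrite (phi_w8E curve).
pose x' := w6 x z A B C / W8; pose y' := w10 x y z a B C / W8; pose z' := w9 x y z a C / W8.
have px' : phi x' = phi_w6 x y z a C / phi_w8 x y z a B C.
  by rewrite fmorph_div (phi_w6E curve) (phi_w8E curve).
have py' : phi y' ^+ 3 = psi_w10 x y z A B C / phi_w8 x y z a B C ^+ 3.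
  by rewrite fmorph_div (phi_w8E curve) expr_div_n (psi_w10E curve).
have pz' : phi z' ^+ 3 = psi_w9 x z A B C / phi_w8 x y z a B C ^+ 3.
  by rewrite fmorph_div (phi_w8E curve) expr_div_n (psi_w9E curve).
have s6 : sigma phi (w6 x z A B C) = w6 x z A B C + w4 A B C * D := sigma_w6 curve.
have s9 : sigma phi (w9 x y z a C) = w9 x y z a C
    - ((a * y + z + a ^+ 2 * x) * phi_w2 y z a + a * phi_w6 x y z a C) * D := sigma_w9 curve.
have s10 : sigma phi (w10 x y z a B C) = w10 x y z a B C
    + (a ^+ 2 * phi_w6 x y z a C + phi_w3 x z a B * (a * y + z + a ^+ 2 * x)) * D
  := sigma_w10 curve.
have hw := w68_wronskian x y z B C (erefl A).
have hs : sigma phi W8 = W8 + psi_w7 x y z A B C * D := sigma_w8 curve.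
have hx : sigma phi x' - x' = D * phi_w8 x y z a B C ^+ 3 / (W8 * sigma phi W8).
  rewrite sigmaM sigmaV s6 -hw -/W8; move: s8n0; rewrite hs => s8n0.
  by rewrite /x'; field; apply/andP.
exists x', y', z'.
have hc : on_ree_curve phi x' y' z'.
  split; rewrite hx px' sigmaM sigmaV.
    rewrite s10; have := w10_wronskian x y z B C (erefl A); rewrite -/W8.
    set d := _ + phi_w3 _ _ _ _ * _; set p6 := phi_w6 _ _ _ _ _.
    set p7 := psi_w7 _ _ _ _ _ _; set q8 := phi_w8 _ _ _ _ _ _ => e.
    have -> : p6 / q8 * (D * q8 ^+ 3 / (W8 * sigma phi W8)) = D * (p6 * q8 ^+ 2) / (W8 * sigma phi W8).
      by field; rewrite w8n0 s8n0.
    rewrite -e; move: s8n0; rewrite hs => s8n0.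
    by rewrite -/p7 /y'; field; apply/andP.
  rewrite s9; have := w9_wronskian x y z B C (erefl A); rewrite -/W8.
  set d := _ + a * _; set p6 := phi_w6 _ _ _ _ _.
  set p7 := psi_w7 _ _ _ _ _ _; set q8 := phi_w8 _ _ _ _ _ _ => e.
  have -> : (p6 / q8) ^+ 2 * (D * q8 ^+ 3 / (W8 * sigma phi W8))
      = D * (p6 ^+ 2 * q8) / (W8 * sigma phi W8).
    by field; rewrite w8n0 s8n0.
  rewrite -e; move: s8n0; rewrite hs => s8n0.
  by rewrite -/p7 /z'; field; apply/andP.
split => //.
set A' := phi x' ^+ 3; set B' := phi y' ^+ 3; set C' := phi z' ^+ 3.
set q := phi_w8 x y z a B C ^+ 3.
have qn0 : q != 0 by rewrite expf_neq0.
have eA : A' = phi_w6 x y z a C ^+ 3 / q by rewrite /A' px' expr_div_n.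
have h1 : w1 x' A' B' = w3 x y A C / W8.
  rewrite /w1 eA /B' py' -/q.
  (* Multiplying by q, the cube of phi w8, clears the denominators of B'. *)
  have -> : w3 x y A C / W8 = (w3 x y A C * q) / (W8 * q) by field; apply/andP.
  by rewrite -(w1_dual x y z B C (erefl A)) -/W8 /x'; field; apply/andP.
have h2 : w2 x' B' C' = - (w2 x B C / W8).
  rewrite /w2 /B' /C' py' pz' -/q.
  have -> : - (w2 x B C / W8) = - (w2 x B C * q) / (W8 * q) by field; apply/andP.
  by rewrite -(w2_dual x y z B C (erefl A)) -/W8 /x'; field; apply/andP.
have hp1 : phi_w1 x' y' (phi x') = phi_w3 x z a B / phi_w8 x y z a B C.
  by rewrite -(phi_w1E hc) h1 fmorph_div (phi_w3E curve) (phi_w8E curve).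
have hp2 : phi_w2 y' z' (phi x') = - (phi_w2 y z a / phi_w8 x y z a B C).
  by rewrite -(phi_w2E hc) h2 rmorphN fmorph_div (phi_w2E curve) (phi_w8E curve).
have h3 : w3 x' y' A' C' = w1 x A B / W8.
  have -> : w3 x' y' A' C' = x' * C' - phi_w1 x' y' (phi x') ^+ 3.
    by rewrite (cube_phi_w1 _ _ (erefl A')) /w3; ring.
  rewrite hp1 expr_div_n /C' pz' -/q.
  have -> : w1 x A B / W8 = (w1 x A B * q) / (W8 * q) by field; apply/andP.
  by rewrite -(w3_dual x y z B C (erefl A)) -/W8 /x'; field; apply/andP.
have h4 : w4 x' y' z' = w5 x y z A B / W8.
  have := w4_dual x y z B C (erefl A); rewrite -/W8 => e.
  have -> : w5 x y z A B / W8 = W8 * w5 x y z A B / W8 ^+ 2 by field.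
  by rewrite -e /w4 /x' /y' /z'; field.
have h4p : w4 A' B' C' = psi_w5 x y A B C / q.
  by rewrite -(psi_w4E phi x' y' z') h4 fmorph_div expr_div_n (psi_w5E curve) (phi_w8E curve).
have hv : wv x' y' z' A' B' = - (wv x y z A B / W8).
  have := v_dual x y z B C (erefl A); rewrite -/W8 => e.
  have -> : - (wv x y z A B / W8) = - (W8 * wv x y z A B) / W8 ^+ 2 by field.
  by rewrite -e /wv h1 /x' /y' /z'; field.
have hvp : psi_v x' y' A' B' C' = - (psi_v x y A B C / q).
  by rewrite -(psi_vE hc) hv rmorphN fmorph_div cubeN expr_div_n (psi_vE curve) (phi_w8E curve).
have h6 : w6 x' z' A' B' C' = x / W8.
  have -> : w6 x' z' A' B' C' = psi_v x' y' A' B' C' - phi_w2 y' z' (phi x') ^+ 3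
      + x' * w4 A' B' C'.
    by rewrite (cube_phi_w2 _ _ (erefl A')) /psi_v /w6; ring.
  rewrite hvp hp2 cubeN expr_div_n -/q h4p.
  have -> : x / W8 = (x * q) / (W8 * q) by field; apply/andP.
  by rewrite -(w6_dual x y z B C (erefl A)) -/W8 /x'; field; apply/andP.
rewrite (w8_quadric x' y' z' A' B' C') h1 h2 h3 h6.
have e8 : W8^-1 = (w2 x B C ^+ 2 - x * w6 x z A B C - w1 x A B * w3 x y A C) / W8 ^+ 2.
  by rewrite -(w8_quadric x y z A B C) -/W8; field.
by rewrite [RHS]e8 /x'; field.
Qed.

Section Translations.
Variable phi : {rmorphism R -> R}.

Definition translate_y (al be x y : R) := y + phi al * x + be.
Definition translate_z (al ga x y z : R) := z - phi al * y + phi al ^+ 2 * x + ga.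

Lemma on_ree_curve_translate al be ga x y z :
  sigma phi al = al -> sigma phi be = be -> sigma phi ga = ga -> on_ree_curve phi x y z ->
  on_ree_curve phi (x + al) (translate_y al be x y) (translate_z al ga x y z).
Proof.
rewrite /translate_y /translate_z => ha hb hc [hy hz]; split.
  rewrite !sigmaD sigmaM sigma_phi ha hb rmorphD.
  have -> : sigma phi y = y + phi x * (sigma phi x - x) by rewrite -hy; ring.
  by ring.
rewrite !sigmaD sigmaN !sigmaM sigma_phi ha hc rmorphD.
have -> : sigma phi y = y + phi x * (sigma phi x - x) by rewrite -hy; ring.
have -> : sigma phi z = z + phi x ^+ 2 * (sigma phi x - x) by rewrite -hz; ring.
by apply: (eq_char3 (s := - phi al * phi x * (sigma phi x - x))); ring.
Qed.

(** Two points of the curve over the same value of x^q - x differ by a translation.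
    So automorphisms that fix s are translations, and the set of all translations
    is closed under composition without any computation of the group law. *)
Lemma ree_curve_fibre x y z x' y' z' :
  on_ree_curve phi x y z -> on_ree_curve phi x' y' z' ->
  sigma phi x' - x' = sigma phi x - x ->
  exists al be ga, [/\ sigma phi al = al, sigma phi be = be, sigma phi ga = ga &
    [/\ x' = x + al, y' = translate_y al be x y & z' = translate_z al ga x y z]].
Proof.
move=> [hy hz] [hy' hz'] hx.
have ey : sigma phi y = y + phi x * (sigma phi x - x) by rewrite -hy; ring.
have ez : sigma phi z = z + phi x ^+ 2 * (sigma phi x - x) by rewrite -hz; ring.
have ey' : sigma phi y' = y' + phi x' * (sigma phi x - x) by rewrite -hx -hy'; ring.
have ez' : sigma phi z' = z' + phi x' ^+ 2 * (sigma phi x - x) by rewrite -hx -hz'; ring.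
pose al := x' - x.
have sal : sigma phi al = al.
  by rewrite /al sigmaB; apply: (addIr (- (x' - x))); rewrite subrr -(subrr (sigma phi x - x)) -{1}hx; ring.
have ex' : x' = x + al by rewrite /al; ring.
exists al, (y' - y - phi al * x), (z' - z + phi al * y - phi al ^+ 2 * x); split => //.
- rewrite !sigmaB sigmaM sigma_phi sal ey ey' ex' rmorphD.
  by ring.
- rewrite !(sigmaD, sigmaN) !sigmaM sigma_phi sal ey ez ez' ex' rmorphD.
  by apply: (eq_char3 (s := phi al * phi x * (sigma phi x - x))); ring.
- by split; rewrite // /translate_y /translate_z; ring.
Qed.
End Translations.

End ReeFunctions.

(** * Chevalley's extension of a local ring to a valuation ring *)
Section Chevalley.
Variable K : fieldType.
Implicit Types (B J : K -> Prop) (a b c : K).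

(** The pairs to which Zorn's lemma applies.  The ideal is proper but need not be
    prime: a maximal pair consists of a valuation ring and its maximal ideal in any
    case. *)
Record ring_with_ideal B J : Prop := RingWithIdeal {
  ideal_ring1 : B 1;
  ideal_ringB : forall a b, B a -> B b -> B (a - b);
  ideal_ringM : forall a b, B a -> B b -> B (a * b);
  ideal0 : J 0;
  idealB : forall a b, J a -> J b -> J (a - b);
  ideal_sub : forall a, J a -> B a;
  idealM : forall a b, B a -> J b -> J (a * b);
  ideal_proper : ~ J 1
}.

Definition adjoin B c : K -> Prop := fun a => exists2 p : {poly K}, forall i, B p`_i & a = p.[c].

Section Ideal.
Variables (B J : K -> Prop).
Hypothesis BJ : ring_with_ideal B J.

Lemma ideal_ring0 : B 0. Proof. exact: (ideal_sub BJ (ideal0 BJ)). Qed.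
Lemma ideal_ringN a : B a -> B (- a).
Proof. by rewrite -sub0r; apply: (ideal_ringB BJ); exact: ideal_ring0. Qed.
Lemma ideal_ringD a b : B a -> B b -> B (a + b).
Proof. by move=> Ba Bb; rewrite -[b]opprK; apply: (ideal_ringB BJ) => //; exact: ideal_ringN. Qed.
Lemma ideal_ringX a n : B a -> B (a ^+ n).
Proof. by move=> Ba; elim: n => [|n IH]; [exact: ideal_ring1 BJ | rewrite exprS; exact: (ideal_ringM BJ)]. Qed.
Lemma idealN a : J a -> J (- a).
Proof. by rewrite -sub0r; apply: (idealB BJ); exact: ideal0 BJ. Qed.
Lemma idealD a b : J a -> J b -> J (a + b).
Proof. by move=> Ba Bb; rewrite -[b]opprK; apply: (idealB BJ) => //; exact: idealN. Qed.
Lemma ideal_sum (I : Type) (r : seq I) (P : pred I) (F : I -> K) :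
  (forall i, J (F i)) -> J (\sum_(i <- r | P i) F i).
Proof. by move=> JF; apply: big_ind => // [|a b]; [exact: ideal0 BJ | exact: idealD]. Qed.
Lemma ideal_ring_sum (I : Type) (r : seq I) (P : pred I) (F : I -> K) :
  (forall i, B (F i)) -> B (\sum_(i <- r | P i) F i).
Proof. by move=> JF; apply: big_ind => // [|a b]; [exact: ideal_ring0 | exact: ideal_ringD]. Qed.

Lemma adjoin_ideal c : ~ adjoin J c 1 -> ring_with_ideal (adjoin B c) (adjoin J c).
Proof.
move=> J1; split=> //.
- exists 1; last by rewrite hornerC.
  by move=> i; rewrite coef1; case: (i == 0%N); [exact: ideal_ring1 BJ|exact: ideal_ring0].
- move=> _ _ [p Bp ->] [r Br ->]; exists (p - r); last by rewrite !hornerE.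
  by move=> i; rewrite coefB; exact: (ideal_ringB BJ).
- move=> _ _ [p Bp ->] [r Br ->]; exists (p * r); last by rewrite hornerM.
  by move=> i; rewrite coefM; apply: ideal_ring_sum => j; exact: (ideal_ringM BJ).
- by exists 0; rewrite ?horner0 // => i; rewrite coef0; exact: ideal0 BJ.
- move=> _ _ [p Bp ->] [r Br ->]; exists (p - r); last by rewrite !hornerE.
  by move=> i; rewrite coefB; exact: (idealB BJ).
- by move=> _ [p Bp ->]; exists p => // i; exact: (ideal_sub BJ).
- move=> _ _ [p Bp ->] [r Br ->]; exists (p * r); last by rewrite hornerM.
  by move=> i; rewrite coefM; apply: ideal_sum => j; exact: (idealM BJ).
Qed.

Lemma adjoinE c : (forall b, B b -> adjoin B c b) * (forall b, J b -> adjoin J c b) * adjoin B c c.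
Proof.
have h (S : K -> Prop) : S 0 -> forall b, S b -> adjoin S c b.
  move=> S0 b Sb; exists b%:P; last by rewrite hornerC.
  by move=> i; rewrite coefC; case: (i == 0%N).
split; first by split; apply: h; [exact: ideal_ring0|exact: ideal0 BJ].
exists 'X; last by rewrite hornerX.
by move=> i; rewrite coefX; case: (i == 1%N); [exact: ideal_ring1 BJ|exact: ideal_ring0].
Qed.

Hypothesis maximal : forall B' J', ring_with_ideal B' J' -> (forall a, B a -> B' a) ->
  (forall a, J a -> J' a) -> forall a, B' a -> B a.

Lemma maximal_adjoin c : B c \/ adjoin J c 1.
Proof.
case: (boolp.pselect (adjoin J c 1)) => [|/adjoin_ideal h]; [by right|left].
by case: (adjoinE c) => [[BB' JJ'] Bc]; exact: (maximal h BB' JJ').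
Qed.

(** If the inverse of 1 - j were not in B, then 1 = p(1 / (1 - j)) with coefficients
    in J; multiplication by a power of 1 - j puts that power in J, whereas it is
    congruent to 1 modulo J. *)
Lemma maximal_unit j : J j -> B (1 - j)^-1.
Proof.
move=> Jj; have nz : 1 - j != 0.
  by apply/eqP => /eqP; rewrite subr_eq0 => /eqP e; apply: (ideal_proper BJ); rewrite e.
have J1 n : J (1 - (1 - j) ^+ n).
  elim: n => [|n IH]; first by rewrite expr0 subrr; exact: ideal0 BJ.
  have -> : 1 - (1 - j) ^+ n.+1 = (1 - j) * (1 - (1 - j) ^+ n) + j by rewrite exprS; ring.
  apply: idealD => //; apply: (idealM BJ) => //; apply: (ideal_ringB BJ); first exact: ideal_ring1 BJ.
  exact: (ideal_sub BJ).
case: (maximal_adjoin (1 - j)^-1) => [//|[p Jp e]]; case: (ideal_proper BJ).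
have : J ((1 - j) ^+ size p).
  rewrite -[X in J X]mulr1 {2}e horner_coef mulr_sumr; apply: ideal_sum => i.
  have -> : (1 - j) ^+ size p * (p`_i * (1 - j)^-1 ^+ i) = (1 - j) ^+ (size p - i) * p`_i.
    rewrite -{1}(subnK (ltnW (ltn_ord i))) exprD exprVn; field.
    by rewrite expf_neq0.
  apply: (idealM BJ) => //; apply: ideal_ringX; apply: (ideal_ringB BJ); first exact: ideal_ring1 BJ.
  exact: (ideal_sub BJ).
by move=> /idealD /(_ (J1 (size p))); rewrite addrC subrK.
Qed.

(** If neither a nor its inverse is in B, then 1 is a polynomial in a, and one in
    the inverse of a, with coefficients in J.  The relation of smaller degree can be
    used to lower the degree of the other, so the induction is on the sum of the
    degrees. *)
Lemma maximal_valuation a : a != 0 -> B a \/ B a^-1.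
Proof.
move=> a0.
suff key n b (p r : {poly K}) : b != 0 -> (size p + size r <= n)%N ->
    (forall i, J p`_i) -> (forall i, J r`_i) -> 1 = p.[b] -> 1 = r.[b^-1] -> False.
  case: (maximal_adjoin a) => [|[p Jp ep]]; first by left.
  case: (maximal_adjoin a^-1) => [|[r Jr er]]; first by right.
  by case: (key _ _ p r a0 (leqnn _) Jp Jr ep er).
elim: n b p r => [|n IH] b p r b0 hn Jp Jr ep er.
  move: hn; rewrite leqn0 addn_eq0 size_poly_eq0 => /andP[/eqP p0 _].
  by move: ep; rewrite p0 horner0 => /eqP; rewrite oner_eq0.
wlog le_rp : b p r b0 hn Jp Jr ep er / (size r <= size p)%N.
  move=> W; case: (leqP (size r) (size p)) => h; first exact: (W b p r).
  apply: (W b^-1 r p) => //; first by rewrite invr_eq0.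
  - by rewrite addnC.
  - by rewrite invrK.
  - exact: ltnW.
have p0 : p != 0 by apply: contra_eqN ep => /eqP ->; rewrite horner0 oner_eq0.
have sp : size p = (size p).-1.+1 by rewrite prednK // size_poly_gt0.
set m := (size p).-1 in sp.
have r1 : 1 - r`_0 != 0.
  apply/eqP => /eqP; rewrite subr_eq0 => /eqP e; apply: (ideal_proper BJ); rewrite e; exact: Jr.
have br := maximal_unit (Jr 0%N).
(* The relation for r, multiplied by b^m and divided by its unit 1 - r_0, expresses
   b^m in lower powers of b; substitute this for the leading term of p. *)
pose p' := \poly_(i < m) (p`_i + p`_m * ((1 - r`_0)^-1 * r`_(m - i))).
apply: (IH b p' r) => //.
- by have := size_poly m (fun i => p`_i + p`_m * ((1 - r`_0)^-1 * r`_(m - i))); rewrite -/p'; lia.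
- move=> i; rewrite coef_poly; case: ifP => _; last exact: ideal0 BJ.
  apply: idealD => //; apply: (idealM BJ); first exact: (ideal_sub BJ).
  exact: (idealM BJ).
have er' : 1 - r`_0 = \sum_(i < m) r`_(m - i) * b^-1 ^+ (m - i).
  have -> : 1 = \sum_(i < m.+1) r`_i * b^-1 ^+ i.
    rewrite er (horner_coef_wide _ (n := m.+1)) //; by rewrite -sp.
  rewrite big_ord_recl expr0 mulr1 addrC addKr (reindex_inj rev_ord_inj) /=.
  by apply: eq_bigr => i _; rewrite /bump /= add1n subnSK.
rewrite [LHS]ep (horner_coef_wide b (n := m.+1)); last by rewrite -sp.
rewrite big_ord_recr /= horner_poly.
under [RHS]eq_bigr do rewrite mulrDl.
rewrite big_split /=; congr (_ + _).
under eq_bigr do rewrite -!mulrA.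
rewrite -mulr_sumr -mulr_sumr; congr (_ * _).
apply: (mulfI r1); rewrite mulrA mulfV // mul1r er' mulr_suml; apply: eq_bigr => i _.
rewrite -mulrA; congr (_ * _).
have -> : b ^+ m = b ^+ (m - i) * b ^+ i by rewrite -exprD subnK // ltnW.
by rewrite exprVn mulKf // expf_neq0.
Qed.

Lemma maximal_nonunit a : J a -> a = 0 \/ ~ B a^-1.
Proof.
move=> Ja; case: (eqVneq a 0) => [|a0]; [by left|right => Ba].
by apply: (ideal_proper BJ); rewrite -(mulVf a0); exact: (idealM BJ).
Qed.
End Ideal.

(** The set that Zorn's lemma orders, by inclusion of the rings and of the ideals. *)
Record ring_ideal_above B0 J0 := RingIdeal {
  ri_ring : K -> Prop; ri_ideal : K -> Prop;
  ri_proper : ring_with_ideal ri_ring ri_ideal;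
  ri_ring_sub : forall a, B0 a -> ri_ring a;
  ri_ideal_sub : forall a, J0 a -> ri_ideal a
}.

Theorem chevalley_extension B0 J0 : ring_with_ideal B0 J0 ->
  exists O : K -> Prop, [/\ O 1, forall a b, O a -> O b -> O (a - b),
    forall a b, O a -> O b -> O (a * b), forall a, a != 0 -> O a \/ O a^-1 &
    (forall a, B0 a -> O a) /\ (forall a, J0 a -> a = 0 \/ ~ O a^-1)].
Proof.
move=> BJ0.
pose le (X Y : ring_ideal_above B0 J0) := boolp.asbool
  ((forall a, ri_ring X a -> ri_ring Y a) /\ (forall a, ri_ideal X a -> ri_ideal Y a)).
pose X0 : ring_ideal_above B0 J0 := RingIdeal BJ0 (fun _ => id) (fun _ => id).
have leX0 X : le X0 X by apply/boolp.asboolP; split; [exact: ri_ring_sub|exact: ri_ideal_sub].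
have lexx X : le X X by apply/boolp.asboolP; split.
have [|X Y Z|A Atot|X Xmax] := @classical_sets.ZL_preorder _ X0 le.
- exact: lexx.
- move=> /boolp.asboolP[h1 h2] /boolp.asboolP[h3 h4]; apply/boolp.asboolP.
  by split => a h; [apply: h3; exact: h1|apply: h4; exact: h2].
- pose A' X := X = X0 \/ A X.
  have dir X Y : A' X -> A' Y -> exists2 Z, A' Z & le X Z && le Y Z.
    move=> [->|AX] [->|AY].
    + by exists X0; [left|rewrite lexx].
    + by exists Y; [right|rewrite leX0 lexx].
    + by exists X; [right|rewrite leX0 lexx].
    + case: (Atot _ _ AX AY) => h; first by exists Y; [right|rewrite h lexx].
      by exists X; [right|rewrite h lexx].
  pose UB a := exists2 X, A' X & ri_ring X a.
  pose UJ a := exists2 X, A' X & ri_ideal X a.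
  have A'0 : A' X0 by left.
  have pU : ring_with_ideal UB UJ.
    have X0p := ri_proper X0.
    split.
    + by exists X0 => //; exact: ideal_ring1 X0p.
    + move=> a b [X AX Xa] [Y AY Yb]; have [Z AZ /andP[]] := dir X Y AX AY.
      move=> /boolp.asboolP[h1 _] /boolp.asboolP[h2 _]; exists Z => //.
      by apply: (ideal_ringB (ri_proper Z)); [exact: h1|exact: h2].
    + move=> a b [X AX Xa] [Y AY Yb]; have [Z AZ /andP[]] := dir X Y AX AY.
      move=> /boolp.asboolP[h1 _] /boolp.asboolP[h2 _]; exists Z => //.
      by apply: (ideal_ringM (ri_proper Z)); [exact: h1|exact: h2].
    + by exists X0 => //; exact: ideal0 X0p.
    + move=> a b [X AX Xa] [Y AY Yb]; have [Z AZ /andP[]] := dir X Y AX AY.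
      move=> /boolp.asboolP[_ h1] /boolp.asboolP[_ h2]; exists Z => //.
      by apply: (idealB (ri_proper Z)); [exact: h1|exact: h2].
    + by move=> a [X AX Xa]; exists X => //; exact: (ideal_sub (ri_proper X)).
    + move=> a b [X AX Xa] [Y AY Yb]; have [Z AZ /andP[]] := dir X Y AX AY.
      move=> /boolp.asboolP[h1 _] /boolp.asboolP[_ h2]; exists Z => //.
      by apply: (idealM (ri_proper Z)); [exact: h1|exact: h2].
    + by move=> [X AX]; exact: (ideal_proper (ri_proper X)).
  have s1 a : B0 a -> UB a by exists X0.
  have s2 a : J0 a -> UJ a by exists X0.
  exists (RingIdeal pU s1 s2) => X AX; apply/boolp.asboolP.
  by split => a Xa; exists X => //; right.
have Xp := ri_proper X.
have max B' J' : ring_with_ideal B' J' -> (forall a, ri_ring X a -> B' a) ->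
    (forall a, ri_ideal X a -> J' a) -> forall a, B' a -> ri_ring X a.
  move=> h hB hJ.
  have sB a : B0 a -> B' a by move=> h0; apply: hB; exact: ri_ring_sub.
  have sJ a : J0 a -> J' a by move=> h0; apply: hJ; exact: ri_ideal_sub.
  have leX : le X (RingIdeal h sB sJ) by apply/boolp.asboolP.
  by have /boolp.asboolP[] := Xmax _ leX.
exists (ri_ring X); split.
- exact: ideal_ring1 Xp.
- exact: ideal_ringB Xp.
- exact: ideal_ringM Xp.
- exact: maximal_valuation Xp max.
- split; first exact: ri_ring_sub.
  by move=> a /(ri_ideal_sub X); exact: maximal_nonunit Xp _.
Qed.

End Chevalley.

(** * Pole orders at a place *)
Section Places.
Variables (k : closedFieldType) (K : fieldType) (iota : {rmorphism k -> K}).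

Lemma place_above (B J : K -> Prop) : ring_with_ideal B J -> (forall c, B (iota c)) ->
  (exists2 a, J a & a != 0) ->
  exists O, [/\ curve_point iota O, forall a, B a -> O a & forall a, J a -> vanishes_at O a].
Proof.
move=> BJ Bk [a Ja a0].
have [O [O1 OB OM Oval [BO JO]]] := chevalley_extension BJ.
have O0 : O 0 by rewrite -(subrr 1); exact: OB.
have ON b : O b -> O (- b) by rewrite -sub0r; exact: OB.
exists O; split => //.
- split => //; first by move=> c; exact: BO.
  + by move=> b c Ob Oc; rewrite -[c]opprK; apply: OB => //; exact: ON.
  + exists a^-1; case: (JO _ Ja) => [e|//].
    by rewrite e eqxx in a0.
- by move=> b Jb; split; [exact/BO/(ideal_sub BJ)|exact: JO].
Qed.

Section Place.
Variable O : K -> Prop.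
Hypothesis pO : curve_point iota O.

Lemma place1 : O 1.
Proof. by rewrite -(rmorph1 iota); exact: curve_point_const pO _. Qed.
Lemma place0 : O 0.
Proof. by rewrite -(rmorph0 iota); exact: curve_point_const pO _. Qed.
Lemma placeN a : O a -> O (- a).
Proof.
move=> Oa; rewrite -mulN1r -(rmorphN1 iota).
by apply: (curve_point_mul pO) => //; exact: curve_point_const pO _.
Qed.
Lemma placeB a b : O a -> O b -> O (a - b).
Proof. by move=> Oa Ob; apply: (curve_point_add pO) => //; exact: placeN. Qed.
Lemma placeX a n : O a -> O (a ^+ n).
Proof.
by move=> Oa; elim: n => [|n IH]; [exact: place1|rewrite exprS; exact: (curve_point_mul pO)].
Qed.
Lemma placeV a : ~ O a -> O a^-1.
Proof.
move=> nOa; case: (eqVneq a 0) => [a0|/(curve_point_val pO)[]//].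
by case: nOa; rewrite a0; exact: place0.
Qed.

Lemma place_root a n : (0 < n)%N -> O (a ^+ n) -> O a.
Proof.
case: n => // n _ Oan; case: (boolp.pselect (O a)) => // nOa.
have a0 : a != 0 by apply/eqP => e; apply: nOa; rewrite e; exact: place0.
have -> : a = a ^+ n.+1 * a^-1 ^+ n by rewrite exprS exprVn mulfK // expf_neq0.
by apply: (curve_point_mul pO) => //; apply: placeX; exact: placeV.
Qed.

Lemma place_unit c : c = 0 \/ ~ O c^-1 -> O (1 - c)^-1.
Proof.
case => [->|nO]; first by rewrite subr0 invr1; exact: place1.
have c0 : c != 0 by apply/eqP => e; apply: nO; rewrite e invr0; exact: place0.
case: (eqVneq (1 - c) 0) => [->|c1]; first by rewrite invr0; exact: place0.
have e0 : c / (1 - c) != 0 by rewrite mulf_neq0 ?invr_eq0.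
case: (curve_point_val pO e0) => h.
  have -> : (1 - c)^-1 = c / (1 - c) + 1 by field.
  by apply: (curve_point_add pO) => //; exact: place1.
case: nO; have -> : c^-1 = (c / (1 - c))^-1 + 1.
  by field; rewrite c0 andbT; move: c1; apply: contra_neq => ->; rewrite ?subrr.
by apply: (curve_point_add pO) => //; exact: place1.
Qed.

(** The preorder whose classes of nonzero elements form the value group; it serves in
    place of the valuation, so that no value group has to be constructed. *)
Definition dominated a b := exists2 c, O c & a = c * b.

Lemma dominated_refl a : dominated a a.
Proof. by exists 1; rewrite ?mul1r //; exact: place1. Qed.
Lemma dominated_trans b a c : dominated a b -> dominated b c -> dominated a c.
Proof. by move=> [u Ou ->] [w Ow ->]; exists (u * w); rewrite ?mulrA //; exact: (curve_point_mul pO). Qed.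
Lemma dominatedM a b c d : dominated a b -> dominated c d -> dominated (a * c) (b * d).
Proof. by move=> [u Ou ->] [w Ow ->]; exists (u * w); [exact: (curve_point_mul pO)|ring]. Qed.
Lemma dominatedX a b n : dominated a b -> dominated (a ^+ n) (b ^+ n).
Proof. by move=> [u Ou ->]; exists (u ^+ n); rewrite ?exprMn //; exact: placeX. Qed.
Lemma dominatedD a b c : dominated a c -> dominated b c -> dominated (a + b) c.
Proof. by move=> [u Ou ->] [w Ow ->]; exists (u + w); rewrite ?mulrDl //; exact: (curve_point_add pO). Qed.
Lemma dominated_root a b n : (0 < n)%N -> b != 0 -> dominated (a ^+ n) (b ^+ n) -> dominated a b.
Proof.
move=> n0 b0 [u Ou e]; exists (a / b); last by rewrite divfK.
by apply: (place_root n0); rewrite expr_div_n e mulfK ?expf_neq0.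
Qed.

Section Degree.
Variables (s : K) (N : nat).
Hypotheses (pole_s : ~ O s) (N0 : (0 < N)%N).

Lemma pole_neq0 : s != 0.
Proof. by apply/eqP => e; apply: pole_s; rewrite e; exact: place0. Qed.

Lemma dominated_pole i j : (i <= j)%N -> dominated (s ^+ i) (s ^+ j).
Proof.
move=> ij; exists (s^-1 ^+ (j - i)); first by apply: placeX; exact: placeV.
by rewrite -{2}(subnK ij) exprD exprVn mulKf // expf_neq0 // pole_neq0.
Qed.

Lemma dominated_pole_le i j : dominated (s ^+ i) (s ^+ j) -> (i <= j)%N.
Proof.
move=> [u Ou e]; case: leqP => // ji; case: pole_s; apply: (@place_root _ (i - j)); first by rewrite subn_gt0.
have -> // : s ^+ (i - j) = u.
by rewrite -[LHS](@mulfK _ (s ^+ j)) ?expf_neq0 ?pole_neq0 // -exprD subnK ?(ltnW ji) // e mulfK // expf_neq0 // pole_neq0.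
Qed.

(** The number i bounds N times the pole order of a, measured with that of s as the
    unit; so N is a common denominator of the orders that occur.  For N a power of
    the characteristic, N-th powers are additive, and the ultrametric inequality
    [deg_leD] follows from that for [dominated]. *)
Definition deg_le a i := dominated (a ^+ N) (s ^+ i).
Definition deg_eq a i := deg_le a i /\ dominated (s ^+ i) (a ^+ N).

Lemma deg_eq_le a i j : deg_eq a i -> deg_le a j -> (i <= j)%N.
Proof. by move=> [_ h] /(dominated_trans h); exact: dominated_pole_le. Qed.
Lemma deg_eq_uniq a i j : deg_eq a i -> deg_eq a j -> i = j.
Proof.
move=> hi hj; apply/eqP; rewrite eqn_leq; apply/andP; split.
  exact: deg_eq_le hi hj.1.
exact: deg_eq_le hj hi.1.
Qed.
Lemma deg_eq_neq0 a i : deg_eq a i -> a != 0.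
Proof.
move=> [_ [u _]] e; apply/eqP => a0; move: e; rewrite a0 expr0n -leqn0 leqNgt N0 /= mulr0.
by apply/eqP; rewrite expf_neq0 // pole_neq0.
Qed.
Lemma deg_leW a i j : (i <= j)%N -> deg_le a i -> deg_le a j.
Proof. by move=> ij /dominated_trans; apply; exact: dominated_pole. Qed.
Lemma deg_leM a b i j : deg_le a i -> deg_le b j -> deg_le (a * b) (i + j).
Proof. by rewrite /deg_le exprMn exprD; exact: dominatedM. Qed.
Lemma deg_eqM a b i j : deg_eq a i -> deg_eq b j -> deg_eq (a * b) (i + j).
Proof. by rewrite /deg_eq /deg_le exprMn exprD => -[h1 h2] [h3 h4]; split; exact: dominatedM. Qed.
Lemma deg_eqX a i n : deg_eq a i -> deg_eq (a ^+ n) (n * i).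
Proof.
by rewrite /deg_eq /deg_le exprAC mulnC exprM => -[h1 h2]; split; exact: dominatedX.
Qed.
Lemma deg_eq_root a i n : (0 < n)%N -> deg_eq (a ^+ n) (n * i) -> deg_eq a i.
Proof.
move=> n0 h; have := deg_eq_neq0 h; rewrite expf_eq0 n0 /= => a0.
move: h; rewrite /deg_eq /deg_le exprAC mulnC exprM => -[h1 h2].
by split; apply: (dominated_root n0) => //; rewrite expf_neq0 ?pole_neq0.
Qed.
Lemma deg_eq_pole : deg_eq s N.
Proof. by split; exact: dominated_refl. Qed.
Lemma deg_eqN a i : deg_eq a i -> deg_eq (- a) i.
Proof.
rewrite /deg_eq /deg_le exprNn => -[h1 h2]; split.
  by rewrite -[s ^+ i]mul1r; apply: dominatedM => //; exists ((-1) ^+ N); rewrite ?mulr1 //; apply/placeX/placeN/place1.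
rewrite -[s ^+ i]mul1r; apply: dominatedM => //; exists ((-1) ^+ N); first by apply/placeX/placeN/place1.
by rewrite -expr2 exprAC sqrrN expr1n expr1n.
Qed.
Lemma deg_le_dominated a b i : dominated a b -> deg_le b i -> deg_le a i.
Proof. by move=> /(@dominatedX _ _ N) h; exact: dominated_trans h. Qed.
Lemma deg_eq_dominated a b i : dominated a b -> dominated b a -> deg_eq b i -> deg_eq a i.
Proof.
move=> ab ba [h1 h2]; split; first exact: deg_le_dominated ab h1.
by apply: (dominated_trans h2); exact: dominatedX.
Qed.
Lemma deg_le_const c : deg_le (iota c) 0.
Proof.
exists (iota c ^+ N); last by rewrite mulr1.
by apply: placeX; exact: curve_point_const pO _.
Qed.
Lemma deg_eq_const c : c != 0 -> deg_eq (iota c) 0.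
Proof.
move=> c0; split; first exact: deg_le_const.
exists (iota c^-1 ^+ N); first by apply: placeX; exact: curve_point_const pO _.
by rewrite -exprMn -rmorphM mulVf // rmorph1 expr1n.
Qed.

Hypothesis frobN : [pchar K].-nat N.

Lemma deg_leD a b i : deg_le a i -> deg_le b i -> deg_le (a + b) i.
Proof. by rewrite /deg_le exprDn_pchar //; exact: dominatedD. Qed.
Lemma deg_leN a i : deg_le a i -> deg_le (- a) i.
Proof.
rewrite /deg_le exprNn => h; rewrite -[s ^+ i]mul1r; apply: dominatedM => //.
by exists ((-1) ^+ N); rewrite ?mulr1 //; apply/placeX/placeN/place1.
Qed.
Lemma deg_le0 i : deg_le 0 i.
Proof. by exists 0; rewrite ?mul0r ?expr0n -?leqn0 1?leqNgt ?N0 //; exact: place0. Qed.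

Lemma deg_eqD a b i j : deg_eq a i -> deg_le b j -> (j < i)%N -> deg_eq (a + b) i.
Proof.
move=> [h1 h2] hb ji; split.
  by apply: deg_leD => //; exact: deg_leW (ltnW ji) hb.
have [u Ou eu] := h2; have [w Ow ew] := hb.
have s0 := pole_neq0.
have e : (a + b) ^+ N * u = s ^+ i * (1 - (- u * w * s^-1 ^+ (i - j))).
  have es : s ^+ i * s^-1 ^+ (i - j) = s ^+ j.
    by rewrite -{1}(subnK (ltnW ji)) exprD exprVn mulrAC mulfV ?mul1r // expf_neq0.
  have -> : s ^+ i * (1 - (- u * w * s^-1 ^+ (i - j)))
      = s ^+ i + u * w * (s ^+ i * s^-1 ^+ (i - j)) by ring.
  by rewrite exprDn_pchar // ew es eu; ring.
set c := _ * s^-1 ^+ _ in e.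
have hc : c = 0 \/ ~ O c^-1.
  case: (eqVneq c 0) => [|c0]; [by left|right => Oc].
  case: pole_s; apply: (@place_root _ (i - j)); first by rewrite subn_gt0.
  have -> : s ^+ (i - j) = - u * w * c^-1.
    move: c0; rewrite /c !mulf_eq0 !negb_or oppr_eq0 => /andP[/andP[u0 w0] _].
    by rewrite exprVn; field; rewrite oppr_eq0 u0 w0 expf_neq0.
  by apply: (curve_point_mul pO) => //; apply: (curve_point_mul pO) => //; exact: placeN.
have c1 : 1 - c != 0.
  apply/eqP => /eqP; rewrite subr_eq0 => /eqP c1; case: hc => [c0|].
    by move: c1; rewrite c0 => /eqP; rewrite oner_eq0.
  by rewrite -c1 invr1; apply; exact: place1.
exists (u / (1 - c)); first by apply: (curve_point_mul pO) => //; exact: place_unit.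
by rewrite mulrAC [u * _]mulrC e mulfK.
Qed.

(** As b has a pole, so has a, and then a^q dominates a: the quotient of b by a^q is
    the unit 1 - a^(1 - q). *)
Lemma deg_eq_artin_schreier q a b i : (1 < q)%N -> (0 < i)%N -> a ^+ q - a = b ->
  deg_eq b (q * i) -> deg_eq a i.
Proof.
move=> q1 i0 eb hb; have q0 : (0 < q)%N by exact: ltnW.
have nOa : ~ O a.
  move=> Oa; have Ob : O b by rewrite -eb; apply: placeB => //; exact: placeX.
  case: pole_s; have [u Ou e] := hb.2; apply: (@place_root _ (q * i)); first by rewrite muln_gt0 q0.
  by rewrite e; apply: (curve_point_mul pO) => //; exact: placeX.
have a0 : a != 0 by apply/eqP => e; apply: nOa; rewrite e; exact: place0.
have OV : O (a^-1 ^+ q.-1) by apply: placeX; exact: placeV.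
have e : b = (1 - a^-1 ^+ q.-1) * a ^+ q.
  by rewrite -eb -{1 3}(prednK q0) exprS exprVn; field; rewrite expf_neq0.
apply: (deg_eq_root q0); apply: deg_eq_dominated hb.
  exists (1 - a^-1 ^+ q.-1)^-1.
    apply: place_unit; right; rewrite exprVn invrK => /place_root h; apply: nOa; apply: h; lia.
  rewrite e mulKf //; apply/eqP => /eqP; rewrite subr_eq0 exprVn => /eqP e1.
  apply: nOa; apply: (@place_root _ q.-1); first by lia.
  by rewrite -[X in O X]invrK -e1 invr1; exact: place1.
by exists (1 - a^-1 ^+ q.-1) => //; apply: placeB => //; exact: place1.
Qed.

Lemma deg_eq_horner (p : {poly k}) : p != 0 -> deg_eq (map_poly iota p).[s] ((size p).-1 * N).
Proof.
elim/poly_ind: p => [|p c IH]; first by rewrite eqxx.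
rewrite rmorphD rmorphM /= map_polyX map_polyC /= hornerD hornerMX hornerC => pc0.
case: (eqVneq p 0) => [p0|p0].
  move: pc0; rewrite p0 mul0r add0r rmorph0 horner0 mul0r add0r polyC_eq0 => c0.
  by rewrite size_polyC c0 /= mul0n; exact: deg_eq_const.
rewrite size_MXaddC (negPf p0) /= -(prednK (n := size p)) ?size_poly_gt0 //.
apply: (@deg_eqD _ _ _ 0); last by rewrite mulSn; lia.
  by rewrite mulSn addnC; apply: deg_eqM deg_eq_pole; exact: IH.
exact: deg_le_const.
Qed.

(** This and [deg_eq_const_prod] are meant for the minimal polynomial of u over k(s),
    whose roots all have the same pole order d. *)
Lemma deg_le_coef_prod (bs : seq K) d j : (forall b, b \in bs -> deg_le b d) ->
  deg_le (\prod_(b <- bs) ('X - b%:P))`_j ((size bs - j) * d).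
Proof.
elim: bs j => [|b bs IH] j h.
  rewrite big_nil coef1; case: (j == 0%N) => /=; last exact: deg_le0.
  by have := deg_le_const 1; rewrite rmorph1.
have {}IH i := IH i (fun c hc => h c (mem_behead (s := b :: bs) hc)).
have hb : deg_le b d by apply: h; exact: mem_head.
rewrite big_cons mulrBl coefB coefXM coefCM; apply: deg_leD.
  case: j => [|j] /=; first exact: deg_le0.
  by rewrite subSS; exact: IH.
apply: deg_leN; case: (leqP j (size bs)) => hj.
  by have -> /= : ((size (b :: bs) - j) * d = d + (size bs - j) * d)%N;
    [rewrite /= subSn // mulSn | exact: deg_leM].
rewrite [X in b * X]nth_default ?mulr0; first exact: deg_le0.
by rewrite size_prod_XsubC.
Qed.

Lemma deg_eq_const_prod (bs : seq K) d : (forall b, b \in bs -> deg_eq b d) ->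
  deg_eq (\prod_(b <- bs) ('X - b%:P))`_0 (size bs * d).
Proof.
elim: bs => [|b bs IH] h.
  by rewrite big_nil coef1 mul0n /=; have := @deg_eq_const 1; rewrite rmorph1; apply; exact: oner_neq0.
rewrite big_cons mulrBl coefB coefXM coefCM /= sub0r -mulNr mulSn; apply: deg_eqM.
  by apply: deg_eqN; apply: h; exact: mem_head.
by apply: IH => c hc; apply: h; exact: mem_behead.
Qed.

End Degree.
End Place.
End Places.

(** * Plane forms as polynomials in two variables *)
Section Mmap.
Variables (n : nat) (R : nzRingType).

Lemma rmorph_mmap (S S' : comNzRingType) (th : {rmorphism S -> S'}) (f : {rmorphism R -> S})
    (f' : {rmorphism R -> S'}) (h : 'I_n -> S) (h' : 'I_n -> S') (p : {mpoly R[n]}) :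
  th \o f =1 f' -> th \o h =1 h' -> th (mmap f h p) = mmap f' h' p.
Proof.
move=> ef eh; rewrite /mmap rmorph_sum; apply: eq_bigr => m _.
rewrite rmorphM -ef /= /mmap1 rmorph_prod; congr (_ * _); apply: eq_bigr => i _.
by rewrite rmorphXn -eh.
Qed.

Lemma eq_mmap (S : comNzRingType) (f f' : {rmorphism R -> S}) (h h' : 'I_n -> S) (p : {mpoly R[n]}) :
  f =1 f' -> h =1 h' -> mmap f h p = mmap f' h' p.
Proof. exact: (@rmorph_mmap _ _ idfun). Qed.

Lemma mmap_homog (S : comNzRingType) (f : {rmorphism R -> S}) (h : 'I_n -> S) (c : S) d
    (p : {mpoly R[n]}) : p \is d.-homog ->
  mmap f (fun i => c * h i) p = c ^+ d * mmap f h p.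
Proof.
move=> /dhomogP hp; rewrite /mmap mulr_sumr [LHS]big_seq [RHS]big_seq.
apply: eq_bigr => m /hp <-; rewrite mulrCA; congr (_ * _).
by rewrite /mmap1 /= mdegE -prodrXr -big_split /=; apply: eq_bigr => i _; rewrite exprMn.
Qed.
End Mmap.

Definition col3 (R : nzRingType) (a b c : R) : 'cV[R]_3 := \col_i tnth [tuple a; b; c] i.

(** A polynomial in U with coefficients in k[S] is a polynomial in two variables:
    [(G`_j)`_i] is the coefficient of U^j S^i.  The homogenization is taken with
    respect to X0, the other two coordinates being X1 = U and X2 = S. *)
Section Homogenization.
Variable k : fieldType.
Implicit Types (G Q N : {poly {poly k}}) (P : {mpoly k[3]}).

Definition mon n j i : 'X_{1..3} := [multinom tnth [tuple n - i - j; j; i] l | l < 3]%N.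

(** For a polynomial of total degree more than n, the subtraction in [mon] is
    truncated and the result is meaningless; hence the hypothesis [tdeg_le]. *)
Definition hom n G : {mpoly k[3]} :=
  \sum_(j < n.+1) \sum_(i < n.+1) (G`_j)`_i *: 'X_[mon n j i].

Definition tdeg_le n G := forall j i, (n < i + j)%N -> (G`_j)`_i = 0.

Definition const2 : {rmorphism k -> {poly {poly k}}} := polyC \o polyC.

Definition dehom : {rmorphism {mpoly k[3]} -> {poly {poly k}}} :=
  mmap const2 (fun l => tnth [tuple 1; 'X; 'X%:P] l).

Lemma mdeg3 (m : 'X_{1..3}) : mdeg m = (m ord0 + m (lift ord0 ord0) + m (lift ord0 (lift ord0 ord0)))%N.
Proof. by rewrite mdegE !big_ord_recl big_ord0 addn0 addnA. Qed.

Lemma mon_mnm (m : 'X_{1..3}) : mon (mdeg m) (m (lift ord0 ord0)) (m (lift ord0 (lift ord0 ord0))) = m.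
Proof.
apply/mnmP => i; rewrite mnmE mdeg3.
case: i => [[|[|[|//]]] hi]; rewrite (tnth_nth 0%N) /=.
- have -> : Ordinal hi = ord0 by exact: val_inj.
  lia.
- by congr (m _); exact: val_inj.
- by congr (m _); exact: val_inj.
Qed.

Lemma mdeg_mon n j i : (i + j <= n)%N -> mdeg (mon n j i) = n.
Proof. by move=> h; rewrite mdeg3 !mnmE !(tnth_nth 0%N) /=; lia. Qed.

Lemma dehomX (m : 'X_{1..3}) :
  dehom 'X_[m] = ('X^(m (lift ord0 (lift ord0 ord0))))%:P * 'X^(m (lift ord0 ord0)).
Proof.
rewrite /dehom /= mmapX /mmap1 !big_ord_recl big_ord0 mulr1 !(tnth_nth 0) /= expr1n mul1r mulrC.
by rewrite rmorphXn.
Qed.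

Lemma dehomZ c P : dehom (c *: P) = c%:P%:P * dehom P.
Proof. by rewrite /dehom /= mmapZ. Qed.

Lemma hom0 n : hom n 0 = 0.
Proof. by rewrite /hom big1 // => j _; rewrite big1 // => i _; rewrite !coef0 scale0r. Qed.

Lemma hom_homog n G : tdeg_le n G -> hom n G \is n.-homog.
Proof.
move=> hG; apply: rpred_sum => j _; apply: rpred_sum => i _.
case: (leqP (i + j) n) => h; last by rewrite hG // scale0r dhomog0.
by apply: dhomogZ; rewrite dhomogX; apply/eqP; exact: mdeg_mon.
Qed.

Lemma tdeg_le_size n G : tdeg_le n G -> (size G <= n.+1)%N /\ forall j, (size (G`_j)%R <= n.+1)%N.
Proof.
move=> hG; split=> [|j]; apply/leq_sizeP => i hi; last by rewrite hG //; lia.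
by apply/polyP => l; rewrite coef0 hG //; lia.
Qed.

Lemma dehom_hom n G : tdeg_le n G -> dehom (hom n G) = G.
Proof.
move=> hG; have [s1 s2] := tdeg_le_size hG.
transitivity (\sum_(j < n.+1) (\sum_(i < n.+1) (G`_j)`_i *: 'X^i)%:P * 'X^j); last first.
  rewrite -[RHS](coefK) poly_def (big_ord_widen n.+1 (fun j => G`_j *: 'X^j)) // [RHS]big_mkcond /=.
  apply: eq_bigr => j _; rewrite -poly_def mul_polyC; case: ltnP => h.
    congr (_ *: _); apply/polyP => i; rewrite coef_poly; case: ltnP => // hi.
    by rewrite nth_default // (leq_trans (s2 j)).
  have -> : G`_j = 0 by rewrite nth_default.
  by rewrite poly_def big1 ?scale0r // => i _; rewrite coef0 scale0r.
rewrite /hom rmorph_sum /=; apply: eq_bigr => j _.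
rewrite !rmorph_sum /= mulr_suml; apply: eq_bigr => i _.
by rewrite dehomZ dehomX !mnmE !(tnth_nth 0%N) /= -mul_polyC polyCM mulrA.
Qed.

Lemma coef_dehom P n j i : P \is n.-homog -> (i + j <= n)%N ->
  ((dehom P)`_j)`_i = P@_(mon n j i).
Proof.
move=> /dhomogP hP ij; rewrite [in LHS](mpolyE P) rmorph_sum /= !coef_sum.
rewrite [in RHS](mpolyE P) raddf_sum /=.
rewrite [LHS]big_seq [RHS]big_seq; apply: eq_bigr => m /hP mn.
rewrite dehomZ dehomX mulrA -rmorphM /= mcoeffZ mcoeffX !coefCM coefXn.
set a := m _; set b := m _.
have -> : (m == mon n j i) = (i == a) && (j == b).
  apply/eqP/andP => [e|[/eqP -> /eqP ->]]; last by rewrite /a /b -mn mon_mnm.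
  by rewrite /a /b e !mnmE !(tnth_nth 0%N) /= !eqxx.
by case: (j == b); rewrite ?mulr1 ?mulr0 ?coef0 ?andbF ?mulr0 // coefCM coefXn andbT.
Qed.

Lemma tdeg_dehom P n : P \is n.-homog -> tdeg_le n (dehom P).
Proof.
move=> /dhomogP hP j i ij; rewrite (mpolyE P) rmorph_sum /= !coef_sum big_seq big1 // => m /hP mn.
rewrite dehomZ dehomX mulrA -rmorphM /= !coefCM coefXn.
case: eqP => [jb|_]; rewrite ?mulr0 ?coef0 // mulr1 coefCM coefXn.
case: eqP => [ia|_]; rewrite ?mulr0 // .
by move: ij; have {}mn : mdeg m = n := mn; rewrite -mn mdeg3 ia jb; lia.
Qed.

Lemma hom_dehom P n : P \is n.-homog -> hom n (dehom P) = P.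
Proof.
move=> hP; have hd := tdeg_dehom hP; have hh := hom_homog hd.
apply/mpolyP => m; case: (eqVneq (mdeg m) n) => [mn|mn]; last first.
  by rewrite (dhomog_nemf_coeff hh mn) (dhomog_nemf_coeff hP mn).
rewrite -[m]mon_mnm mn -!coef_dehom //; first by rewrite dehom_hom.
all: by rewrite -mn mdeg3; lia.
Qed.

Lemma tdeg_leM n m G Q : tdeg_le n G -> tdeg_le m Q -> tdeg_le (n + m) (G * Q).
Proof.
move=> hG hQ; rewrite -(dehom_hom hG) -(dehom_hom hQ) -rmorphM /=.
by apply: tdeg_dehom; apply: dhomogM; exact: hom_homog.
Qed.

Lemma homM n m G Q : tdeg_le n G -> tdeg_le m Q -> hom (n + m) (G * Q) = hom n G * hom m Q.
Proof.
move=> hG hQ; rewrite -{1}(dehom_hom hG) -{1}(dehom_hom hQ) -rmorphM /= hom_dehom //.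
by apply: dhomogM; exact: hom_homog.
Qed.

(** The restriction of a form to the line X0 = 0, with X1 = 1; for [hom n G] this
    is the part of G of degree n.  As a morphism to a domain, it makes top degrees additive. *)
Definition at_infinity : {rmorphism {mpoly k[3]} -> {poly k}} :=
  mmap polyC (fun l => tnth [tuple 0; 1; 'X] l).

Lemma coef_at_infinity n G i : tdeg_le n G ->
  (at_infinity (hom n G))`_i = if (i <= n)%N then (G`_(n - i))`_i else 0.
Proof.
move=> hG; rewrite /hom rmorph_sum /= coef_sum.
have aX a b : (a + b <= n)%N ->
    at_infinity 'X_[mon n a b] = if (a + b == n)%N then 'X^b else 0.
  move=> ab; rewrite /at_infinity /= mmapX /mmap1 !big_ord_recl big_ord0 mulr1 !mnmE !(tnth_nth 0) /=.
  rewrite /= expr1n mul1r expr0n.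
  have -> : (n - b - a == 0)%N = (a + b == n)%N by apply/eqP/eqP; lia.
  by case: eqP; rewrite ?mul1r ?mul0r.
have aZ c a b : (c != 0 -> (a + b <= n)%N) -> (at_infinity (c *: 'X_[mon n a b]))`_i =
    (if (a + b == n)%N && (b == i) then c else 0).
  move=> h; rewrite /at_infinity /= mmapZ -[mmap _ _ _]/(at_infinity _) coefCM.
  case: (eqVneq c 0) => [->|/h ab]; first by rewrite mul0r if_same.
  rewrite aX //; case: eqP => _ /=; last by rewrite coef0 mulr0.
  by rewrite coefXn eq_sym; case: eqP; rewrite ?mulr1 ?mulr0.
have c0 a b : (G`_a)`_b != 0 -> (a + b <= n)%N.
  by move=> h; rewrite addnC leqNgt; apply: contra h => h; rewrite hG.
case: leqP => hi; last first.
  rewrite big1 // => a _; rewrite rmorph_sum coef_sum big1 // => b _.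
  rewrite aZ; last exact: c0.
  by case: ifP => // /andP[_ /eqP e]; have := ltn_ord b; rewrite e; lia.
have hin : (n - i < n.+1)%N by lia.
have hin' : (i < n.+1)%N by lia.
rewrite (bigD1 (Ordinal hin)) //= rmorph_sum coef_sum (bigD1 (Ordinal hin')) //=.
rewrite aZ; last exact: c0.
rewrite subnK // !eqxx /= big1 ?addr0 => [|b bi]; last first.
  by rewrite aZ; [case: ifP => // /andP[_ /eqP e]; case/eqP: bi; exact: val_inj|exact: c0].
rewrite big1 ?addr0 // => a ai; rewrite rmorph_sum coef_sum big1 // => b _.
rewrite aZ; last exact: c0.
case: ifP => // /andP[/eqP e1 /eqP e2]; case/eqP: ai; apply: val_inj => /=; lia.
Qed.

Lemma tdeg_leW n m G : (n <= m)%N -> tdeg_le n G -> tdeg_le m G.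
Proof. by move=> nm hG j i h; apply: hG; lia. Qed.

Lemma tdeg_le_exists Q : exists D, tdeg_le D Q.
Proof.
exists (size Q + \max_(j < size Q) size (Q`_j)%R)%N => j i h.
case: (ltnP j (size Q)) => hj; last by rewrite [Q`_j]nth_default ?coef0.
set M := (\max_(j < size Q) _)%N in h.
have hM : (size (Q`_j)%R <= M)%N.
  exact: (leq_bigmax (F := fun j : 'I_(size Q) => size (Q`_j)%R) (Ordinal hj)).
rewrite nth_default // (leq_trans hM) //; move: h hj; clear; move: (size Q) M => a b; lia.
Qed.

(** If Q had larger degree than the product allows, its top part would be killed by
    multiplication with the nonzero top part of N; descend on a bound for the degree
    of Q. *)
Lemma tdeg_le_dvd N d (Q : {poly {poly k}}) n : tdeg_le d N -> at_infinity (hom d N) != 0 ->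
  tdeg_le n (Q * N) -> Q = 0 \/ (d <= n)%N /\ tdeg_le (n - d) Q.
Proof.
move=> hN N0 hQN.
suff key D : tdeg_le D Q -> Q = 0 \/ (d <= n)%N /\ tdeg_le (n - d) Q.
  by have [D /key] := tdeg_le_exists Q.
elim/ltn_ind: D => D IH hQ.
case: (leqP (D + d) n) => Dd.
  by right; split; [lia|move=> j i h; apply: hQ; lia].
have top0 : at_infinity (hom D Q) = 0.
  have : at_infinity (hom (D + d) (Q * N)) = 0.
    apply/polyP => i; rewrite coef0 coef_at_infinity; last exact: tdeg_leM.
    by case: leqP => // hi; apply: hQN; lia.
  by rewrite homM // rmorphM => /eqP; rewrite mulf_eq0 (negPf N0) orbF => /eqP.
have hQ' j i : (D <= i + j)%N -> (Q`_j)`_i = 0.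
  case: (ltngtP D (i + j)) => // [h|e] _; first exact: hQ.
  by have := coef_at_infinity i hQ; rewrite top0 coef0 e leq_addr addKn => <-.
case: D {top0 Dd hQ} IH hQ' => [|D] IH hQ; last by apply: (IH D) => // j i h; apply: hQ.
by left; apply/polyP => j; apply/polyP => i; rewrite !coef0 hQ.
Qed.
End Homogenization.
Arguments dehom {k}.
Arguments at_infinity {k}.

(** * The plane model attached to two functions and its Galois points *)
Section Values.
Variables (k : closedFieldType) (K : fieldType) (iota : {rmorphism k -> K}) (O : K -> Prop).
Hypothesis pO : curve_point iota O.

Lemma vanishes0 : vanishes_at O 0.
Proof. by split; [exact: place0 pO|left]. Qed.

Lemma vanishesM a b : O a -> vanishes_at O b -> vanishes_at O (a * b).
Proof.
move=> Oa [Ob [->|nO]]; first by rewrite mulr0; exact: vanishes0.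
split; first exact: (curve_point_mul pO).
case: (eqVneq a 0) => [->|a0]; first by left; rewrite mul0r.
right=> h; apply: nO; have -> : b^-1 = a * (a * b)^-1 by rewrite invfM mulVKf.
exact: (curve_point_mul pO).
Qed.

Lemma vanishesD a b : vanishes_at O a -> vanishes_at O b -> vanishes_at O (a + b).
Proof.
move=> va vb; split; first exact: (curve_point_add pO va.1 vb.1).
case: (eqVneq (a + b) 0) => [->|ab0]; [by left|right => Oc].
set c := (a + b)^-1 in Oc.
have e : c * a + c * b = 1 by rewrite -mulrDr mulVf.
have [_ ca] := vanishesM Oc va.
have [_ cb] := vanishesM Oc vb.
have := place_unit pO ca; rewrite -e addrC addKr.
case: cb => [cb0|//]; move: e ca; rewrite cb0 addr0 => -> [/eqP|]; first by rewrite oner_eq0.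
by rewrite invr1 => h; case: h; exact: place1 pO.
Qed.

Lemma vanishes_const c : vanishes_at O (iota c) -> c = 0.
Proof.
case=> _ [/eqP|h]; first by rewrite fmorph_eq0 => /eqP.
case: h; rewrite -fmorphV; exact: curve_point_const pO _.
Qed.

Lemma has_value_O a c : has_value iota O a c -> O a.
Proof.
case=> h _; rewrite -[a](subrK (iota c)); apply: (curve_point_add pO) => //.
exact: curve_point_const pO _.
Qed.

Lemma has_value_const c : has_value iota O (iota c) c.
Proof. by rewrite /has_value subrr; exact: vanishes0. Qed.

Lemma has_valueD a b c e : has_value iota O a c -> has_value iota O b e ->
  has_value iota O (a + b) (c + e).
Proof. by rewrite /has_value rmorphD opprD addrACA; exact: vanishesD. Qed.

Lemma has_valueM a b c e : has_value iota O a c -> has_value iota O b e ->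
  has_value iota O (a * b) (c * e).
Proof.
move=> ha hb; rewrite /has_value rmorphM.
have -> : a * b - iota c * iota e = b * (a - iota c) + iota c * (b - iota e) by ring.
by apply: vanishesD; apply: vanishesM => //; [exact: has_value_O hb|exact: curve_point_const pO _].
Qed.

Lemma has_value_eval n (G : {mpoly k[n]}) (v : 'cV[K]_n) (P : 'cV[k]_n) :
  (forall i, has_value iota O (v i 0) (P i 0)) -> has_value iota O (eval_in iota G v) (eval_at G P).
Proof.
move=> h; rewrite /eval_in /eval_at /meval /mmap.
apply: (big_ind2 (has_value iota O)) => [|a c b e|m _].
- by rewrite -(rmorph0 iota); exact: has_value_const.
- exact: has_valueD.
apply: has_valueM; first exact: has_value_const.
apply: (big_ind2 (has_value iota O)) => [|a c b e|i _].
- by rewrite -(rmorph1 iota); exact: has_value_const.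
- exact: has_valueM.
elim: (m i) => [|l IH]; first by rewrite !expr0 -(rmorph1 iota); exact: has_value_const.
by rewrite !exprS; exact: has_valueM.
Qed.
End Values.

Lemma eval_in_scale (k K : fieldType) (iota : {rmorphism k -> K}) n d (G : {mpoly k[n]}) (c : K) (v : 'cV[K]_n) :
  G \is d.-homog -> mmap iota (fun i => (c *: v) i 0) G = c ^+ d * mmap iota (fun i => v i 0) G.
Proof. by move=> /(mmap_homog iota (fun i => v i 0) c) <-; apply: eq_mmap => // i; rewrite mxE. Qed.

(** Abstractly, let K = k(s, u), let N be the minimal polynomial of u over k[s], of
    degree d - 1 in u and of total degree d, and let F be its homogenization. *)
Section PlaneModel.
Variables (k : closedFieldType) (K : fieldType) (iota : {rmorphism k -> K}).
Variables (u s : K) (d : nat) (N : {poly {poly k}}).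

Definition ev1 : {rmorphism {poly k} -> K} := horner_eval s \o map_poly iota.
Definition ev : {rmorphism {poly {poly k}} -> K} :=
  horner_eval u \o map_poly ev1.

Lemma ev1C c : ev1 c%:P = iota c.
Proof. by rewrite /ev1 /= map_polyC /horner_eval hornerC. Qed.
Lemma ev1X : ev1 'X = s.
Proof. by rewrite /ev1 /= map_polyX /horner_eval hornerX. Qed.
Lemma evC p : ev p%:P = ev1 p.
Proof. by rewrite /ev /= map_polyC /horner_eval hornerC. Qed.
Lemma evX : ev 'X = u.
Proof. by rewrite /ev /= map_polyX /horner_eval hornerX. Qed.

Definition generic_point : 'cV[K]_3 := col3 1 u s.
Local Notation f := generic_point.
Local Notation F := (hom d N).

Lemma eval_dehom P : eval_in iota P f = ev (dehom P).
Proof.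
rewrite /eval_in /dehom; symmetry; apply: rmorph_mmap => [c|i]; rewrite [LHS]/=; first exact: (etrans (evC _) (ev1C c)).
rewrite mxE; case: i => [[|[|[|//]]] hi]; rewrite !(tnth_nth 0) /=.
- exact: (rmorph1 ev).
- exact: evX.
- exact: (etrans (evC _) ev1X).
Qed.

Hypotheses (d_gt2 : (2 < d)%N) (hN : tdeg_le d N) (N_monic : N \is monic) (sizeN : size N = d)
  (Ntop : (N`_0)`_d != 0).
Hypothesis ev_ker : forall G, ev G = 0 -> exists Q, G = Q * N.
Hypothesis ev_N : ev N = 0.

Lemma F_homog : F \is d.-homog. Proof. exact: hom_homog. Qed.

Lemma F_infinity : at_infinity F != 0.
Proof.
by apply: contraNneq Ntop => h; have := coef_at_infinity d hN; rewrite h coef0 leqnn subnn => <-.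
Qed.

Lemma F_neq0 : F != 0.
Proof. by apply: contraNneq F_infinity => ->; rewrite rmorph0. Qed.

Lemma eval_F : eval_in iota F f = 0.
Proof. by rewrite eval_dehom dehom_hom. Qed.

Lemma msize_F : msize F = d.+1.
Proof.
have e := dhomog_uniq F_neq0 (dhomog_msize F_homog) F_homog.
by rewrite -[in RHS]e prednK // lt0n mmeasure_poly_eq0 F_neq0.
Qed.

Lemma kernel_F n G : G \is n.-homog -> eval_in iota G f = 0 <-> exists Q, G = Q * F.
Proof.
move=> hG; split=> [|[Q ->]]; last first.
  by rewrite /eval_in rmorphM /= -/(eval_in iota F f) eval_F mulr0.
rewrite eval_dehom => /ev_ker [Q eQ]; have := tdeg_dehom hG.
rewrite eQ => /(tdeg_le_dvd hN F_infinity) [Q0|[dn hQ]].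
  by exists 0; rewrite mul0r -(hom_dehom hG) eQ Q0 mul0r hom0.
by exists (hom (n - d) Q); rewrite -homM // subnK // -eQ hom_dehom.
Qed.

(** Evaluation at the generic point of the cone over the curve: it kills only the
    multiples of F, whereas evaluation at the generic point also kills X0 - 1. *)
Definition scale : {rmorphism {mpoly k[3]} -> {poly K}} :=
  mmap (polyC \o iota) (fun i => 'X * (f i 0)%:P).

Lemma scale_homog n P : P \is n.-homog -> scale P = 'X^n * (eval_in iota P f)%:P.
Proof.
move=> hP.
have -> : scale P = 'X^n * mmap (polyC \o iota) (fun i => (f i 0)%:P) P.
  exact: (mmap_homog (polyC \o iota) (fun i => (f i 0)%:P) 'X hP).
by congr (_ * _); symmetry; apply: rmorph_mmap.
Qed.

Lemma scale_ker P : scale P = 0 -> exists Q, P = Q * F.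
Proof.
move=> P0; have comp n : exists Q, pihomog mdeg n P = Q * F.
  apply/(kernel_F (pihomogP mdeg n P)).
  case: (ltnP n (msize P)) => [nP|Pn]; last first.
    suff -> : pihomog mdeg n P = 0 by rewrite /eval_in rmorph0.
    rewrite pihomogE big_seq_cond big1 // => m /andP[mP /eqP mn].
    by have := msize_mdeg_lt mP; rewrite mn ltnNge Pn.
  have := congr1 (fun r : {poly K} => r`_n) P0.
  rewrite [X in scale X](pihomog_partitionE (mf := mdeg) (leqnn (msize P))) rmorph_sum coef_sum coef0 (bigD1 (Ordinal nP)) //=.
  rewrite (scale_homog (pihomogP mdeg n P)) coefXnM ltnn subnn coefC eqxx big1 ?addr0 // => i ni.
  rewrite (scale_homog (pihomogP mdeg i P)) coefXnM coefC; case: ltnP => // h.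
  by case: eqP => // e; case/eqP: ni; apply: val_inj => /=; lia.
rewrite (pihomog_partitionE (mf := mdeg) (leqnn (msize P))).
elim/big_ind: _ => [|x y [Q ->] [Q' ->]|i _]; last exact: comp.
  by exists 0; rewrite mul0r.
by exists (Q + Q'); rewrite mulrDl.
Qed.

(** If F = G H, one of the factors, say G, vanishes at the generic point of the cone,
    so that it is a multiple of F; then H is a unit. *)
Lemma F_irreducible : irreducible_mpoly F.
Proof.
split; first exact: F_neq0.
  apply/negP => Fu; have := msize_F; move: Fu; rewrite unfold_in /= => /andP[/eqP -> _].
  by rewrite msizeC; case: (_ != 0) => /=; lia.
move=> G H e; have : scale G * scale H = 0.
  by rewrite -rmorphM -e (scale_homog F_homog) eval_F mulr0.
have unit_of A B : F = A * B -> scale A = 0 -> B \is a GRing.unit.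
  move=> eF /scale_ker [Q eA]; have : (Q * B) * F = 1 * F by rewrite mul1r {2}eF eA; ring.
  by move/(mulIf F_neq0)/mpoly_intro_unit.
move=> /eqP; rewrite mulf_eq0 => /orP[] /eqP h; [right|left].
  exact: unit_of h.
by apply: unit_of h; rewrite mulrC.
Qed.

(** The generic point lies on no line, as the degree of N in u is d - 1 > 1.  So no
    coordinate vanishes there, and it is not a constant point. *)
Lemma generic_independent (c0 c1 c2 : k) : iota c0 + iota c1 * u + iota c2 * s = 0 ->
  [/\ c0 = 0, c1 = 0 & c2 = 0].
Proof.
pose G : {poly {poly k}} := c0%:P%:P + c1%:P%:P * 'X + (c2%:P * 'X)%:P.
have -> : iota c0 + iota c1 * u + iota c2 * s = ev G.
  by rewrite /G !(rmorphD ev) !(rmorphM ev) !evC (rmorphM ev1) !ev1C evX ev1X.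
move=> /ev_ker [Q eG].
have G0 : G = 0.
  rewrite eG; case: (eqVneq Q 0) => [->|Q0]; first by rewrite mul0r.
  have : (size G < size (Q * N)%R)%N.
    rewrite size_Mmonic // sizeN.
    have : (0 < size Q)%N by rewrite size_poly_gt0.
    have : (size G <= 2)%N.
      rewrite /G !(leq_trans (size_polyD _ _)) // !geq_max; apply/andP; split; last first.
        by rewrite (leq_trans (size_polyC_leq1 _)).
      rewrite (leq_trans (size_polyD _ _)) // geq_max (leq_trans (size_polyC_leq1 _)) //=.
      by rewrite mul_polyC (leq_trans (size_scale_leq _ _)) // size_polyX.
    lia.
  by rewrite -eG ltnn.
have g0 : c0%:P + c2%:P * 'X = 0.
  have <- : G`_0 = c0%:P + c2%:P * 'X by rewrite /G !coefD !coefC coefCM coefX /= mulr0 addr0.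
  by rewrite G0 coef0.
have g1 : c1%:P = 0.
  have <- : G`_1 = c1%:P by rewrite /G !coefD !coefC coefCM coefX /= mulr1 add0r addr0.
  by rewrite G0 coef0.
split; last 1 first.
- by have /(congr1 (fun r : {poly k} => r`_1)) := g0; rewrite coefD coefC coefMX coefC /= add0r coef0.
- by have /(congr1 (fun r : {poly k} => r`_0)) := g0; rewrite coefD coefC coefMX /= addr0 coef0.
- by apply/eqP; rewrite -polyC_eq0 g1.
Qed.

Hypothesis ev_gen : forall a, exists A B, ev B != 0 /\ a = ev A / ev B.

Lemma plane_function_field_generic : plane_function_field iota F f.
Proof.
split=> [n G hG|a]; first exact: (kernel_F hG).
have [A [B [B0 ->]]] := ev_gen a.
have [n1 h1] := tdeg_le_exists A; have [n2 h2] := tdeg_le_exists B.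
have hA := tdeg_leW (leq_addr n2 n1) h1; have hB := tdeg_leW (leq_addl n1 n2) h2.
exists (n1 + n2)%N, (hom (n1 + n2) A), (hom (n1 + n2) B).
by rewrite !eval_dehom !dehom_hom //; split=> //; exact: hom_homog.
Qed.

Definition swap01 : 'S_3 := tperm ord0 (lift ord0 ord0).
Definition swapped_point : 'cV[K]_3 := col3 u 1 s.

Lemma eval_swap G : eval_in iota (msym swap01 G) f = eval_in iota G swapped_point.
Proof.
rewrite /eval_in /msym; apply: rmorph_mmap => [c|i]; first exact: mmapC.
rewrite /= mmapX mmap1U !mxE /swap01.
case: i => [[|[|[|//]]] hi]; rewrite permE /= !(tnth_nth 0) //=.
Qed.

Lemma swapK (G : {mpoly k[3]}) : msym swap01 (msym swap01 G) = G.
Proof. by rewrite -msymMm tperm2 msym1m. Qed.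

Hypothesis swap_F : eval_in iota F swapped_point = 0.

(** The exchanged form vanishes at the generic point, so it is a multiple of F, and
    it has the same degree. *)
Lemma swap_scale : exists2 c, c != 0 & msym swap01 F = c *: F.
Proof.
have hs : msym swap01 F \is d.-homog.
  by rewrite -(pihomog_dE F_homog) msym_pihomog pihomogP.
have [Q eQ] : exists Q, msym swap01 F = Q * F.
  by apply/(kernel_F hs); rewrite eval_swap.
have s0 : msym swap01 F != 0.
  by apply: contraNneq F_neq0 => h; rewrite -(swapK F) h rmorph0.
have Q0 : Q != 0 by apply: contraNneq s0 => h; rewrite eQ h mul0r.
have ss : msize (msym swap01 F) = d.+1.
  have e := dhomog_uniq s0 (dhomog_msize hs) hs.
  by rewrite -[in RHS]e prednK // lt0n mmeasure_poly_eq0.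
have := msizeM Q0 F_neq0; rewrite -eQ ss msize_F addnS /= -add1n => /addIn e.
have /msize_poly1P [c c0 eQc] : msize Q == 1%N by rewrite -e.
by exists c => //; rewrite eQ eQc mul_mpolyC.
Qed.

Lemma plane_function_field_swapped : plane_function_field iota F swapped_point.
Proof.
have [c c0 ec] := swap_scale.
have hsym n (G : {mpoly k[3]}) : G \is n.-homog -> msym swap01 G \is n.-homog.
  by move=> hG; rewrite -(pihomog_dE hG) msym_pihomog pihomogP.
split=> [n G hG|a].
  rewrite -eval_swap kernel_F; last exact: hsym hG.
  split=> -[Q eQ].
    exists (c *: msym swap01 Q).
    by rewrite -(swapK G) eQ msymM ec -scalerAr scalerAl.
  by exists (c *: msym swap01 Q); rewrite eQ msymM ec -scalerAr scalerAl.
have [_ /(_ a) [n [G [H [hG hH H0 e]]]]] := plane_function_field_generic.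
exists n, (msym swap01 G), (msym swap01 H).
by rewrite -!eval_swap !swapK; split => //; exact: hsym.
Qed.

Definition unit_point (i : 'I_3) : 'cV[k]_3 := \col_j (j == i)%:R.

(** The value of a form at a vertex of the coordinate triangle is the coefficient of
    a pure power.  So smoothness at a vertex can be read off from two
    coefficients ([smooth_unit_point]). *)
Lemma eval_unit_point n (G : {mpoly k[3]}) i : G \is n.-homog -> eval_at G (unit_point i) = G@_(U_(i) *+ n).
Proof.
move=> /dhomogP hG; rewrite [in RHS](mpolyE G) raddf_sum /= /eval_at /meval /mmap.
rewrite [LHS]big_seq [RHS]big_seq; apply: eq_bigr => m /hG mn.
have {}mn : mdeg m = n := mn.
rewrite mcoeffZ mcoeffX; congr (_ * _); rewrite /mmap1.
case: (eqVneq m (U_(i) *+ n)%MM) => [->|mi].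
  rewrite big1 //= => j _; rewrite mxE mulmnE mnm1E eq_sym.
  by case: eqP => _; rewrite ?expr1n // mul0n expr0.
have [j ji mj] : exists2 j, j != i & m j != 0%N.
  apply/exists_inP; apply: contraNT mi => /exists_inPn h; apply/eqP/mnmP => j.
  have h0 l : l != i -> m l = 0%N by move=> /h; rewrite negbK => /eqP.
  rewrite mulmnE mnm1E eq_sym; case: eqVneq => [->|/h0 ->]; last by rewrite mul0n.
  by rewrite mul1n -mn mdegE (bigD1 i) //= big1 ?addn0 // => l /h0.
by rewrite (bigD1 j) //= mxE (negPf ji) expr0n (negPf mj) mul0r.
Qed.

Lemma mderiv_homog n (G : {mpoly k[3]}) i : G \is n.+1.-homog -> mderiv i G \is n.-homog.
Proof.
move=> /dhomogP hG; apply/dhomogP => m; rewrite mcoeff_msupp mcoeff_deriv => h.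
have : G@_(m + U_(i)) != 0 by apply: contraNneq h => ->; rewrite mul0rn.
by rewrite -mcoeff_msupp => /hG /=; rewrite mdegD mdeg1 addn1 => -[].
Qed.

Lemma smooth_unit_point (G : {mpoly k[3]}) (i j : 'I_3) : G \is d.-homog -> G@_(U_(i) *+ d) = 0 -> i != j ->
  G@_(U_(i) *+ d.-1 + U_(j)) != 0 -> smooth_point G (unit_point i).
Proof.
move=> hG G0 ij Gj; have d0 : d = d.-1.+1 by rewrite prednK //; lia.
split.
- apply/eqP => /colP /(_ i); rewrite !mxE eqxx => /eqP; rewrite oner_eq0 //.
- by rewrite (eval_unit_point i hG).
- exists j; rewrite (@eval_unit_point d.-1); last by apply: mderiv_homog; rewrite -d0.
  by rewrite mcoeff_deriv mulmnE mnm1E (negPf ij) mul0n mulr1n.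
Qed.

(** The coefficient of X1^d vanishes and that of X1^(d-1) X0 is 1, as N is monic of
    degree d - 1 in u. *)
Lemma smooth_unit_point1 : smooth_point F (unit_point (lift ord0 ord0)).
Proof.
have coefF j i : (i + j <= d)%N -> F@_(mon d j i) = (N`_j)`_i.
  by move=> h; rewrite -coef_dehom ?F_homog // dehom_hom.
apply: (@smooth_unit_point _ _ ord0) => //; first exact: F_homog.
  have -> : (U_(lift ord0 ord0) *+ d)%MM = mon d d 0.
    apply/mnmP => i; rewrite mulmnE mnm1E mnmE.
    by case: i => [[|[|[|//]]] hi]; rewrite (tnth_nth 0%N) /=; lia.
  by rewrite coefF ?addn0 ?add0n // [N`_d]nth_default ?coef0 ?sizeN.
have -> : (U_(lift ord0 ord0) *+ d.-1 + U_(ord0))%MM = mon d d.-1 0.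
  apply/mnmP => i; rewrite mnmDE mulmnE !mnm1E mnmE.
  by case: i => [[|[|[|//]]] hi]; rewrite (tnth_nth 0%N) /=; lia.
rewrite coefF; last by lia.
by have /monicP := N_monic; rewrite lead_coefE sizeN => ->; rewrite coef1 oner_eq0.
Qed.

Lemma smooth_unit_point0 : smooth_point F (unit_point ord0).
Proof.
have [c c0 ec] := swap_scale.
have coefS (m m' : 'X_{1..3}) : [multinom m (swap01 i) | i < 3] = m' -> F@_m = 0 <-> F@_m' = 0.
  move=> <-; rewrite -mcoeff_sym ec mcoeffZ; split=> [->|/eqP]; first by rewrite mulr0.
  by rewrite mulf_eq0 (negPf c0) => /eqP.
have coefF j i : (i + j <= d)%N -> F@_(mon d j i) = (N`_j)`_i.
  by move=> h; rewrite -coef_dehom ?F_homog // dehom_hom.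
have swapE i : swap01 i = tnth [tuple lift ord0 ord0; ord0; lift ord0 (lift ord0 ord0)] i.
  rewrite /swap01 permE /=; case: i => [[|[|[|//]]] hi] //=.
  by rewrite (tnth_nth ord0) /=; apply: val_inj.
apply: (@smooth_unit_point _ _ (lift ord0 ord0)) => //; first exact: F_homog.
  apply/(coefS _ (mon d d 0)); last by rewrite coefF ?addn0 ?add0n // [N`_d]nth_default ?coef0 ?sizeN.
  apply/mnmP => i; rewrite !mnmE mulmnE mnm1E swapE.
  by case: i => [[|[|[|//]]] hi]; rewrite !(tnth_nth 0%N) /= ?subnn ?mul1n ?mul0n //; lia.
apply/negP => /eqP /(coefS _ (mon d d.-1 0)) h; have : F@_(mon d d.-1 0) = 0.
  apply: h; apply/mnmP => i; rewrite [LHS]mnmE [RHS]mnmE mnmDE mulmnE !mnm1E swapE.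
  by case: i => [[|[|[|//]]] hi]; rewrite !(tnth_nth 0%N) /=; lia.
rewrite coefF; last by lia.
by have /monicP := N_monic; rewrite lead_coefE sizeN => ->; rewrite coef1 => /eqP; rewrite oner_eq0.
Qed.

Lemma generic_point_neq0 i : f i 0 != 0.
Proof.
rewrite mxE; case: i => [[|[|[|//]]] hi]; rewrite (tnth_nth 0) /=; first exact: oner_neq0.
- apply/eqP => u0; have [|_ /eqP] := @generic_independent 0 1 0.
    by rewrite u0 !rmorph0 mulr0 mul0r !addr0.
  by rewrite oner_eq0.
- apply/eqP => s0; have [|_ _ /eqP] := @generic_independent 0 0 1.
    by rewrite s0 !rmorph0 mulr0 mul0r !addr0.
  by rewrite oner_eq0.
Qed.

(** Rescale the generic point so that its i-th coordinate is the constant P_i.  A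
    polynomial relation G between the coordinates of this affine point can then be
    homogenized by means of X_i / P_i, becomes a multiple of F, and holds at P. *)
Lemma specialization (P : 'cV[k]_3) (i : 'I_3) (G : {mpoly k[3]}) : P i 0 != 0 -> eval_at F P = 0 ->
  eval_in iota G ((iota (P i 0) / f i 0) *: f) = 0 -> eval_at G P = 0.
Proof.
set c := _ / _ => Pi0 FP0 Gv0.
have fi0 := generic_point_neq0 i.
have c0 : c != 0 by rewrite mulf_neq0 ?invr_eq0 ?fmorph_eq0.
pose X : {mpoly k[3]} := (P i 0)^-1 *: 'X_i.
pose H := \sum_(n < msize G) pihomog mdeg n G * X ^+ (msize G - n).
have hH : H \is (msize G).-homog.
  apply: rpred_sum => n _; have e : (n + 1 * (msize G - n))%N = msize G.
    by rewrite mul1n subnKC // ltnW.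
  have hX : X \is 1.-homog by apply: dhomogZ; rewrite dhomogX /= mdeg1.
  by have := dhomogM (pihomogP mdeg n G) (dhomogMn (msize G - n) hX); rewrite e.
have evalH (R : fieldType) (th : {rmorphism k -> R}) (w : 'I_3 -> R) : w i = th (P i 0) ->
    mmap th w H = mmap th w G.
  move=> wi; rewrite [in RHS](pihomog_partitionE (mf := mdeg) (leqnn (msize G))) !rmorph_sum.
  apply: eq_bigr => n _; rewrite rmorphM rmorphXn /= /X mmapZ mmapX mmap1U wi -rmorphM mulVf //.
  by rewrite rmorph1 expr1n mulr1.
have hv : ((c *: f) i 0) = iota (P i 0) by rewrite mxE divfK.
have : c ^+ msize G * eval_in iota H f = 0.
  by rewrite -(eval_in_scale _ _ _ hH) evalH.
move/eqP; rewrite mulf_eq0 expf_eq0 (negPf c0) andbF /= => /eqP /(kernel_F hH) [Q eQ].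
have -> : eval_at G P = eval_at Q P * eval_at F P; last by rewrite FP0 mulr0.
by rewrite /eval_at /meval -(evalH k idfun) // eQ; exact: rmorphM.
Qed.

(** The coordinates of the rescaled generic point generate a ring, and the relations
    that specialize to P form a proper ideal J of it by [specialization]; any place
    above this pair maps to P.  The ideal J is nonzero, because otherwise the generic
    point would be constant. *)
Lemma place_over_point (P : 'cV[k]_3) : P != 0 -> eval_at F P = 0 ->
  exists2 O, curve_point iota O & maps_to iota f O P.
Proof.
move=> P0 FP0.
have [i Pi0] : exists i, P i 0 != 0.
  apply/existsP; apply: contraNT P0 => /existsPn h; apply/eqP/colP => i.
  by rewrite mxE; apply/eqP; have := h i; rewrite negbK.
have fi0 := generic_point_neq0 i.
set c := iota (P i 0) / f i 0.
have c0 : c != 0 by rewrite mulf_neq0 ?invr_eq0 ?fmorph_eq0.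
pose v := c *: f.
have spec G : eval_in iota G v = 0 -> eval_at G P = 0 by exact: specialization.
pose B a := exists G, a = eval_in iota G v.
pose J a := exists2 G, a = eval_in iota G v & eval_at G P = 0.
have evC e : eval_in iota (e%:MP_[3]) v = iota e by rewrite /eval_in mmapC.
have ideal : ring_with_ideal B J.
  rewrite /B /J /eval_in /eval_at /meval; split.
  - by exists 1; rewrite rmorph1.
  - by move=> _ _ [G ->] [H ->]; exists (G - H); rewrite rmorphB.
  - by move=> _ _ [G ->] [H ->]; exists (G * H); rewrite rmorphM.
  - by exists 0; rewrite rmorph0.
  - by move=> _ _ [G -> G0] [H -> H0]; exists (G - H); rewrite rmorphB //= G0 H0 subr0.
  - by move=> a [G -> _]; exists G.
  - by move=> _ _ [G ->] [H -> H0]; exists (G * H); rewrite rmorphM //= H0 mulr0.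
  - move=> [G e G0]; have := spec (G - 1); rewrite /eval_in /eval_at /meval !rmorphB !rmorph1 /= -e subrr.
    by move=> /(_ erefl); rewrite G0 sub0r => /eqP; rewrite oppr_eq0 oner_eq0.
have Jv j : J (v j 0 - iota (P j 0)).
  exists ('X_j - (P j 0)%:MP).
    by rewrite /eval_in rmorphB /= mmapX mmap1U mmapC.
  by rewrite /eval_at /meval rmorphB /= mmapX mmap1U mmapC subrr.
have [j vj] : exists j, v j 0 - iota (P j 0) != 0.
  apply/existsP; apply: contraT => /existsPn h.
  have {}h j : iota (P i 0) * f j 0 = iota (P j 0) * f i 0.
    have := h j; rewrite negbK subr_eq0 mxE => /eqP <-.
    by rewrite /c mulrAC divfK.
  case/eqP: Pi0; case: i fi0 h @c {c0 v spec B J evC ideal Jv} => [[|[|[|//]]] hi] fi0 h _.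
  - have := h (lift ord0 ord0); rewrite !mxE !(tnth_nth 0) /= mulr1 => e.
    have [|] // := @generic_independent (- P (lift ord0 ord0) 0) (P (Ordinal hi) 0) 0.
    by rewrite rmorphN rmorph0 mul0r addr0 e addNr.
  - have := h ord0; rewrite !mxE !(tnth_nth 0) /= mulr1 => e.
    have [|] // := @generic_independent (P (Ordinal hi) 0) (- P ord0 0) 0.
    by rewrite rmorphN rmorph0 mul0r addr0 e mulNr subrr.
  - have := h ord0; rewrite !mxE !(tnth_nth 0) /= mulr1 => e.
    have [|] // := @generic_independent (P (Ordinal hi) 0) 0 (- P ord0 0).
    by rewrite rmorphN rmorph0 mul0r addr0 e mulNr subrr.
have [||O [pO BO JO]] := @place_above _ _ iota B J ideal.
- by move=> e; exists e%:MP.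
- by exists (v j 0 - iota (P j 0)).
exists O => //; split=> //; exists c => // l.
by have := JO _ (Jv l); rewrite /has_value mxE.
Qed.

Lemma point_under_place (P : 'cV[k]_3) O : curve_point iota O -> maps_to iota f O P -> eval_at F P = 0.
Proof.
move=> pO [_ [h h0 hv]].
have := has_value_eval pO F (v := h *: f) (P := P) _.
rewrite {1}/eval_in (eval_in_scale _ _ _ F_homog) -/(eval_in iota F f) eval_F mulr0 /has_value sub0r -rmorphN.
move=> H; apply/eqP; rewrite -oppr_eq0; apply/eqP; apply: (vanishes_const pO); apply: H => i.
by rewrite mxE; exact: hv.
Qed.

Lemma plane_model_generic : plane_model iota d f F.
Proof.
split.
- by apply/eqP => /colP /(_ ord0); rewrite [RHS]mxE; apply/eqP; exact: generic_point_neq0.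
- by split; [exact: F_homog|exact: F_irreducible].
- move=> P P0; split; first exact: place_over_point.
  by move=> [O pO]; exact: point_under_place.
- exact: plane_function_field_generic.
Qed.

Definition rational_in_s (a : K) := exists p r : {poly k},
  (map_poly iota r).[s] != 0 /\ a = (map_poly iota p).[s] / (map_poly iota r).[s].

(** The coordinates of the projection, from either of the two points: for the second
    one, the field K is seen as the function field of F = 0 through the exchanged
    generic point, so that the same subfield k(s) occurs. *)
Definition pencil_coordinates : 'cV[K]_2 := \col_i tnth [tuple 1; s] i.

Lemma pencil_rational a : pencil_field iota pencil_coordinates a <-> rational_in_s a.
Proof.
pose toX (A : {mpoly k[2]}) : {poly k} := mmap polyC (fun i => tnth [tuple 1; 'X] i) A.
have evA A : eval_in iota A pencil_coordinates = (map_poly iota (toX A)).[s].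
  rewrite /eval_in /toX; symmetry.
  apply: (rmorph_mmap (th := horner_eval s \o map_poly iota)) => [c|i] /=.
    by rewrite map_polyC /horner_eval hornerC.
  rewrite mxE; case: i => [[|[|//]] hi]; rewrite !(tnth_nth 0) /=.
    by rewrite rmorph1 /horner_eval hornerC.
  by rewrite map_polyX /horner_eval hornerX.
split=> [[n [A [B [_ _ B0 ->]]]]|[p [r [r0 ->]]]].
  by exists (toX A), (toX B); rewrite -!evA.
pose mon2 n i : 'X_{1..2} := [multinom tnth [tuple n - i; i] l | l < 2]%N.
pose toM n (p : {poly k}) : {mpoly k[2]} := \sum_(i < n.+1) p`_i *: 'X_[mon2 n i].
have hM n q : toM n q \is n.-homog.
  apply: rpred_sum => i _; apply: dhomogZ; rewrite dhomogX.
  rewrite /= mdegE !big_ord_recl big_ord0 !mnmE !(tnth_nth 0%N) /= addn0 subnK //.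
  by rewrite -ltnS.
have evM n (q : {poly k}) : (size q <= n.+1)%N -> eval_in iota (toM n q) pencil_coordinates = (map_poly iota q).[s].
  move=> sq; rewrite /eval_in rmorph_sum (horner_coef_wide _ (n := n.+1)) ?size_map_poly //.
  apply: eq_bigr => i _; rewrite /= mmapZ mmapX coef_map /mmap1 !big_ord_recl big_ord0 !mnmE !mxE.
  by rewrite !(tnth_nth 0) /= expr1n mul1r mulr1.
exists (size p + size r)%N, (toM (size p + size r)%N p), (toM (size p + size r)%N r).
by rewrite !evM //; lia.
Qed.

Hypothesis galois_s : galois_extension rational_in_s.

Lemma galois_pencil : galois_extension (pencil_field iota pencil_coordinates).
Proof.
have -> // : pencil_field iota pencil_coordinates = rational_in_s.
by apply: boolp.funext => a; apply: boolp.propext; exact: pencil_rational.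
Qed.

Definition projection_matrix (i : 'I_3) : 'M[k]_(2, 3) :=
  \matrix_(a, b) (b == tnth [tuple i; lift ord0 (lift ord0 ord0)] a)%:R.

Lemma projection_from_unit (i j : 'I_3) : i != j -> i != lift ord0 (lift ord0 ord0) ->
  j != lift ord0 (lift ord0 ord0) -> projection_from (unit_point j) (projection_matrix i).
Proof.
move=> ij i2 j2; split.
  have h : projection_matrix i *m (projection_matrix i)^T = 1%:M.
    apply/matrixP => a b; rewrite !mxE; under eq_bigr do rewrite !mxE -natrM mulnb.
    rewrite (bigD1 (tnth [tuple i; lift ord0 (lift ord0 ord0)] a)) //= eqxx /=.
    rewrite big1 ?addr0 => [|l /negPf -> //].
    case: a => [[|[|//]] ha]; case: b => [[|[|//]] hb]; rewrite !(tnth_nth ord0) /= ?eqxx //.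
      by rewrite (negPf i2).
    by rewrite eq_sym (negPf i2).
  apply/eqP; rewrite eqn_leq rank_leq_row /=.
  have := mxrankM_maxl (projection_matrix i) (projection_matrix i)^T.
  by rewrite h mxrank1.
apply/colP => a; rewrite !mxE big1 // => l _; rewrite !mxE -natrM mulnb.
case: eqP => //= ->; case: eqP => // e; move: e ij j2.
by case: a => [[|[|//]] ha]; rewrite (tnth_nth ord0) /= => ->; rewrite eqxx.
Qed.

Lemma two_inner_galois_points : has_plane_model_with_two_inner_galois_points iota d.
Proof.
exists f, F; split; first exact: plane_model_generic.
have unit0 i : unit_point i != 0.
  by apply/eqP => /colP /(_ i); rewrite !mxE eqxx => /eqP; rewrite oner_eq0.
have proj (g : 'cV[K]_3) i : g i 0 = 1 -> g (lift ord0 (lift ord0 ord0)) 0 = s ->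
    map_mx iota (projection_matrix i) *m g = pencil_coordinates.
  move=> g0 g2; apply/colP => a; rewrite !mxE.
  under eq_bigr do rewrite !mxE rmorph_nat.
  rewrite (bigD1 (tnth [tuple i; lift ord0 (lift ord0 ord0)] a)) //= eqxx mul1r.
  rewrite big1 ?addr0 => [|l /negPf ->]; last by rewrite mul0r.
  by case: a => [[|[|//]] ha]; rewrite !(tnth_nth ord0) /= (tnth_nth 0).
exists (unit_point (lift ord0 ord0)), (unit_point ord0); split.
- split; last exact: smooth_unit_point1.
  split; first exact: unit0.
  exists K, iota, f, (projection_matrix ord0); split.
  + exact: plane_function_field_generic.
  + exact: projection_from_unit.
  + by rewrite proj ?mxE ?(tnth_nth 0) //; exact: galois_pencil.
- split; last exact: smooth_unit_point0.
  split; first exact: unit0.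
  exists K, iota, swapped_point, (projection_matrix (lift ord0 ord0)); split.
  + exact: plane_function_field_swapped.
  + exact: projection_from_unit.
  + by rewrite proj ?mxE ?(tnth_nth 0) //; exact: galois_pencil.
- move=> [c /colP /(_ (lift ord0 ord0))]; rewrite !mxE eqxx /= mulr0 => /eqP.
  by rewrite oner_eq0.
Qed.
End PlaneModel.

(** * Artin's theorem for a finite set of automorphisms closed under composition *)
Section Artin.
Variables (K : fieldType) (I : finType) (tau : I -> {rmorphism K -> K}) (i0 : I).
Hypothesis tau1 : tau i0 =1 id.
Hypothesis tauM : forall i j, exists l, tau i \o tau j =1 tau l.

Definition fixed_by (a : K) := forall i, tau i a = a.
Definition conjugates (a : K) : seq K := undup [seq tau i a | i <- enum I].
Definition orbit_poly (a : K) : {poly K} := \prod_(b <- conjugates a) ('X - b%:P).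

Lemma conjugatesP a b : reflect (exists i, b = tau i a) (b \in conjugates a).
Proof.
rewrite mem_undup; apply: (iffP mapP) => [[i _ ->]|[i ->]]; first by exists i.
by exists i; rewrite ?mem_enum.
Qed.

Lemma mem_conjugates a : a \in conjugates a.
Proof. by apply/conjugatesP; exists i0; rewrite tau1. Qed.

Lemma size_conjugates a : (0 < size (conjugates a) <= #|I|)%N.
Proof.
apply/andP; split; first by have := mem_conjugates a; case: conjugates.
by rewrite (leq_trans (size_undup _)) // size_map -cardE.
Qed.

Lemma perm_conjugates i a : perm_eq (map (tau i) (conjugates a)) (conjugates a).
Proof.
have u : uniq (map (tau i) (conjugates a)).
  by rewrite map_inj_uniq ?undup_uniq //; exact: fmorph_inj.
have sub : {subset map (tau i) (conjugates a) <= conjugates a}.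
  move=> _ /mapP [_ /conjugatesP [j ->] ->]; apply/conjugatesP.
  by have [l hl] := tauM i j; exists l; rewrite -hl.
have [e1 e2] := uniq_min_size u sub (eq_leq (esym (size_map _ _))).
exact: uniq_perm u (undup_uniq _) e2.
Qed.

Lemma orbit_poly_fixed i a : map_poly (tau i) (orbit_poly a) = orbit_poly a.
Proof.
rewrite /orbit_poly rmorph_prod -[RHS](perm_big _ (perm_conjugates i a)) big_map /=.
by apply: eq_bigr => b _; rewrite rmorphB /= map_polyX map_polyC.
Qed.

Lemma orbit_poly_coef_fixed a j : fixed_by (orbit_poly a)`_j.
Proof. by move=> i; rewrite -coef_map orbit_poly_fixed. Qed.

Lemma root_conjugates (p : {poly K}) a : (forall j, fixed_by p`_j) -> root p a ->
  orbit_poly a %| p.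
Proof.
move=> hp pa; apply: uniq_roots_dvdp; last by rewrite uniq_rootsE undup_uniq.
apply/allP => _ /conjugatesP [i ->]; rewrite /root.
have -> : p = map_poly (tau i) p by apply/polyP => j; rewrite coef_map [RHS]hp.
by rewrite horner_map (eqP pa) rmorph0.
Qed.

Lemma artin_galois : galois_extension fixed_by.
Proof.
move=> a; exists (orbit_poly a); split; last by exists (conjugates a).
  split.
  - exact: monic_prod_XsubC.
  - exact: orbit_poly_coef_fixed.
  - by rewrite root_prod_XsubC mem_conjugates.
  - by move=> r; exact: root_conjugates.
by rewrite /orbit_poly separable_prod_XsubC undup_uniq.
Qed.

Lemma fixed_prod_conjugates a : fixed_by (\prod_(b <- conjugates a) b).
Proof. by move=> i; rewrite rmorph_prod -[RHS](perm_big _ (perm_conjugates i a)) big_map. Qed.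

(** Multiply numerator and denominator by the other conjugates of the denominator. *)
Lemma fixed_fraction (Rg : K -> Prop) : Rg 1 -> (forall a b, Rg a -> Rg b -> Rg (a * b)) ->
  (forall i a, Rg a -> Rg (tau i a)) ->
  forall p r, Rg p -> Rg r -> r != 0 -> fixed_by (p / r) ->
  exists p' r', [/\ Rg p' /\ fixed_by p', Rg r' /\ fixed_by r', r' != 0 & p / r = p' / r'].
Proof.
move=> R1 RM Rtau p r Rp Rr r0 fpr.
pose r' := \prod_(b <- conjugates r) b.
have Rprod (bs : seq K) : {subset bs <= conjugates r} -> Rg (\prod_(b <- bs) b).
  move=> sub; rewrite big_seq; apply: big_ind => // b /sub /conjugatesP [i ->].
  exact: Rtau.
have r'0 : r' != 0.
  rewrite /r' prodf_seq_neq0; apply/allP => _ /conjugatesP [i ->] /=.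
  by rewrite fmorph_eq0.
exists (p / r * r'), r'; split => //.
- split; last by move=> i; rewrite rmorphM fpr fixed_prod_conjugates.
  rewrite /r' (big_rem r) ?mem_conjugates //= mulrA divfK //; apply: RM => //.
  by apply: Rprod => b; exact: mem_rem.
- by split; [exact: Rprod|exact: fixed_prod_conjugates].
- by rewrite mulfK.
Qed.

Section Primitive.
Variable u : K.
Hypothesis full_orbit : size (conjugates u) = #|I|.

Lemma conj_inj : injective (fun i => tau i u).
Proof.
apply/injectiveP; rewrite /injectiveb /dinjectiveb.
apply: (leq_size_uniq (undup_uniq [seq tau i u | i <- enum I])).
  by move=> b; rewrite mem_undup.
by rewrite size_map -cardE -full_orbit.
Qed.

(** Let D be the product of the u - tau j u over j != i0.  The Lagrange polynomial
    that takes the value (tau i a) (tau i D) at each tau i u has invariant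
    coefficients, and the value a D at u; dividing by the same expression for a = 1
    avoids any discussion of D.  So a is rational in u over the fixed field. *)
Lemma lagrange_interpolation a : exists P : {poly K}, exists2 Q : {poly K},
  (forall j, fixed_by P`_j) /\ (forall j, fixed_by Q`_j) & Q.[u] != 0 /\ a = P.[u] / Q.[u].
Proof.
pose L b := \sum_i tau i b *: \prod_(j | j != i) ('X - (tau j u)%:P).
have Lfix b j : fixed_by (L b)`_j.
  move=> l; suff e : map_poly (tau l) (L b) = L b by rewrite -[in RHS]e coef_map.
  (* Composition with tau l permutes the indices, which permutes the summands. *)
  have [f hf] := fin_all_exists (tauM l).
  have fi : injective f.
    move=> i i' e; apply: conj_inj; apply: (fmorph_inj (tau l)).
    have := hf i u; have := hf i' u => /= -> ->; by rewrite e.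
  rewrite /L rmorph_sum /= [RHS](reindex_inj fi) /=; apply: eq_bigr => i _.
  rewrite map_polyZ rmorph_prod /= -(hf i b) /=; congr (_ *: _).
  rewrite [RHS](reindex_inj fi) /=; apply: eq_big => [j'|j' _]; first by rewrite (inj_eq fi).
  by rewrite rmorphB /= map_polyX map_polyC -(hf j' u).
have Lu b : (L b).[u] = b * \prod_(j | j != i0) (u - tau j u).
  rewrite /L horner_sum (bigD1 i0) //= [X in _ + X]big1 ?addr0 => [|i ii0].
    by rewrite hornerZ tau1 horner_prod; congr (_ * _); apply: eq_bigr => j _; rewrite hornerXsubC.
  by rewrite hornerZ horner_prod (bigD1 i0) 1?eq_sym //= hornerXsubC tau1 subrr mul0r mulr0.
have D0 : \prod_(j | j != i0) (u - tau j u) != 0.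
  apply/prodf_neq0 => j ji; rewrite subr_eq0; apply: contra ji => /eqP e.
  by apply/eqP; apply: conj_inj; rewrite -e tau1.
exists (L a); exists (L 1); first by split.
by rewrite !Lu mul1r; split => //; rewrite mulfK.
Qed.
End Primitive.
End Artin.

(** * Morphisms between function fields *)
Lemma rmorphism_of (K L : fieldType) (f : K -> L) : f 1 = 1 -> {morph f : a b / a - b} ->
  {morph f : a b / a * b} -> exists g : {rmorphism K -> L}, g =1 f.
Proof.
move=> f1 fB fM.
have hM : monoid_morphism f by split.
pose g : {rmorphism K -> L} := HB.pack f (GRing.isZmodMorphism.Build _ _ f fB)
  (GRing.isMonoidMorphism.Build _ _ f hM).
by exists g.
Qed.

Lemma char3_pnat (F : fieldType) e : 3 \in [pchar F] -> [pchar F].-nat (3 ^ e)%N.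
Proof. by move=> h; rewrite pnatX pnatE // h. Qed.

Definition cube_power (F : fieldType) (char3 : 3 \in [pchar F]) (e : nat) (a : F) : F := a ^+ (3 ^ e).

Section CubePower.
Variables (F : fieldType) (char3 : 3 \in [pchar F]) (e : nat).
Local Notation phi := (cube_power char3 e).

Lemma cube_power_zmod_morphism : zmod_morphism phi.
Proof.
move=> a b; rewrite /cube_power exprDn_pchar; last exact: char3_pnat.
by rewrite exprNn -signr_odd oddX /= orbT mulN1r.
Qed.
Lemma cube_power_monoid_morphism : monoid_morphism phi.
Proof. by split=> [|a b]; rewrite /cube_power ?expr1n ?exprMn. Qed.
HB.instance Definition _ := GRing.isZmodMorphism.Build F F phi cube_power_zmod_morphism.
HB.instance Definition _ := GRing.isMonoidMorphism.Build F F phi cube_power_monoid_morphism.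
End CubePower.

(** The q0-Frobenius, bundled as a ring morphism. *)
Definition cube_frob (F : fieldType) (char3 : 3 \in [pchar F]) (e : nat) : {rmorphism F -> F} :=
  cube_power char3 e.

Lemma cube_frobE (F : fieldType) (char3 : 3 \in [pchar F]) e (a : F) :
  cube_frob char3 e a = a ^+ (3 ^ e).
Proof. by []. Qed.

Section Substitution.
Variables (k : closedFieldType) (K : fieldType) (iota : {rmorphism k -> K}) (N : nat).
Variables (V : 'cV[k]_N -> Prop) (v : 'cV[K]_N).
Hypothesis hV : affine_function_field iota V v.

Lemma eval_in_eq0 p : (forall P, V P -> eval_at p P = 0) -> eval_in iota p v = 0.
Proof. by move=> h; apply/hV.1. Qed.

Lemma rmorph_ext (th th' : {rmorphism K -> K}) : (forall c, th (iota c) = th' (iota c)) ->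
  (forall i, th (v i 0) = th' (v i 0)) -> th =1 th'.
Proof.
move=> hi hv a; have [p [r [_ ->]]] := hV.2 a.
have h w : th (eval_in iota w v) = th' (eval_in iota w v).
  rewrite /eval_in (rmorph_mmap (f' := th \o iota) (h' := fun i => th (v i 0))) //.
  by symmetry; apply: rmorph_mmap => [c|i] /=; rewrite ?hi ?hv.
by rewrite !fmorph_div !h.
Qed.

(** A field K given by its coordinate functions maps to K by sending these to any
    point v' that satisfies exactly the same polynomial relations.  The morphism is
    defined on quotients, by a choice of numerator and denominator for each
    element. *)
Lemma rmorphism_of_point (v' : 'cV[K]_N) :
  (forall p, eval_in iota p v = 0 <-> eval_in iota p v' = 0) ->
  exists th : {rmorphism K -> K}, (forall c, th (iota c) = iota c) /\ forall i, th (v i 0) = v' i 0.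
Proof.
move=> hv'.
pose ev : {rmorphism {mpoly k[N]} -> K} := mmap iota (fun i => v i 0).
pose ev' : {rmorphism {mpoly k[N]} -> K} := mmap iota (fun i => v' i 0).
have ev0 p : ev p = 0 <-> ev' p = 0 := hv' p.
have [num hnum] := boolp.choice (fun a => hV.2 a).
have [den hden] := boolp.choice hnum.
have den0 a : ev (den a) != 0 := (hden a).1.
have eq_num a : a = ev (num a) / ev (den a) := (hden a).2.
have den0' a : ev' (den a) != 0 by apply: contraNneq (den0 a) => /ev0 ->.
pose f a := ev' (num a) / ev' (den a).
have fE p r : ev r != 0 -> f (ev p / ev r) = ev' p / ev' r.
  move=> r0; have r0' : ev' r != 0 by apply: contraNneq r0 => /ev0 ->.
  rewrite /f; set a := ev p / ev r; apply/eqP; rewrite eqr_div // -subr_eq0.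
  rewrite -!rmorphM -rmorphB; apply/eqP/ev0; rewrite rmorphB !rmorphM; apply/eqP.
  by rewrite subr_eq0 -eqr_div // -eq_num.
have fE1 p : f (ev p) = ev' p.
  by have := fE p 1; rewrite !rmorph1 !divr1; apply; exact: oner_neq0.
have [||a b|g gf] := @rmorphism_of _ _ f _ _ _.
- by rewrite -(rmorph1 ev) fE1 !rmorph1.
- move=> a b; rewrite {1}(eq_num a) {1}(eq_num b) -mulNr addf_div //.
  by rewrite -rmorphN -!rmorphM -rmorphD fE ?rmorphM ?mulf_neq0 // rmorphD !rmorphM rmorphN /f -addf_div // mulNr.
- rewrite {1}(eq_num a) {1}(eq_num b) mulf_div -!rmorphM fE ?rmorphM ?mulf_neq0 //.
  by rewrite /f mulf_div.
exists g; split=> [c|i]; rewrite gf.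
  have -> : iota c = ev c%:MP by rewrite /ev /= mmapC.
  by rewrite fE1 /ev' /= !mmapC.
have -> : v i 0 = ev 'X_i by rewrite /ev /= mmapX mmap1U.
by rewrite fE1 /ev' /= mmapX mmap1U.
Qed.

(** A polynomial map that induces a surjection of V onto itself extends to the
    function field; surjectivity is what makes the map of coordinate rings
    injective. *)
Lemma substitution (w : 'I_N -> {mpoly k[N]}) :
  (forall P, V P -> V (\col_i eval_at (w i) P)) ->
  (forall P, V P -> exists2 P', V P' & P = \col_i eval_at (w i) P') ->
  exists th : {rmorphism K -> K}, (forall c, th (iota c) = iota c) /\
    forall i, th (v i 0) = eval_in iota (w i) v.
Proof.
move=> hw hw'.
have [p|th [h1 h2]] := @rmorphism_of_point (\col_i eval_in iota (w i) v); last first.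
  by exists th; split=> // i; rewrite h2 mxE.
pose pw := mmap (@mpolyC N k) w p.
have e : eval_in iota p (\col_i eval_in iota (w i) v) = eval_in iota pw v.
  rewrite /pw /eval_in; symmetry; apply: rmorph_mmap => [c|i]; first exact: mmapC.
  by rewrite /= mxE.
have eP P : eval_at pw P = eval_at p (\col_i eval_at (w i) P).
  rewrite /eval_at /meval /pw; apply: (rmorph_mmap (th := mmap idfun (fun i => P i 0)) (f' := idfun)) => [c|i].
    exact: mmapC.
  by rewrite /= mxE.
rewrite e; split=> /hV.1 h; apply/hV.1 => P VP.
  by rewrite eP; apply: h; exact: hw.
by have [P' VP' ->] := hw' _ VP; rewrite -eP; exact: h.
Qed.
End Substitution.

(** * Artin-Schreier towers and their translations *)
Lemma artin_schreier_roots (k : closedFieldType) (q : nat) : (1 < q)%N -> q%:R = 0 :> k ->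
  exists rs : seq k, [/\ uniq rs, size rs = q & 'X^q - 'X = \prod_(c <- rs) ('X - c%:P)].
Proof.
move=> q1 q0; pose p : {poly k} := 'X^q - 'X.
have sp : size p = q.+1 by rewrite size_polyDl size_polyXn // size_polyN size_polyX.
have lp : lead_coef p = 1.
  by rewrite lead_coefE sp coefB coefXn coefX eqxx gtn_eqF //= subr0.
have [rs] := closed_field_poly_normal p; rewrite lp scale1r => ep.
exists rs; split=> //.
  rewrite -separable_prod_XsubC -ep unlock derivB derivX derivXn -mulr_natr -polyC_natr q0 mulr0 sub0r.
  by rewrite -scaleN1r coprimepZr ?oppr_eq0 ?oner_eq0 // coprimep1.
by have := sp; rewrite ep size_prod_XsubC => -[].
Qed.

Section ArtinSchreierTower.
Variables (K : fieldType) (q : nat).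
Hypothesis q1 : (1 < q)%N.

Record subring (S : K -> Prop) : Prop := Subring {
  subring1 : S 1;
  subringB : forall a b, S a -> S b -> S (a - b);
  subringM : forall a b, S a -> S b -> S (a * b)
}.

Section Subring.
Variable S : K -> Prop.
Hypothesis hS : subring S.
Lemma subring0 : S 0. Proof. by rewrite -(subrr 1); apply: (subringB hS); exact: subring1 hS. Qed.
Lemma subringN a : S a -> S (- a).
Proof. by rewrite -sub0r; apply: (subringB hS); exact: subring0. Qed.
Lemma subringD a b : S a -> S b -> S (a + b).
Proof. by move=> Sa Sb; rewrite -[b]opprK; apply: (subringB hS) => //; exact: subringN. Qed.
Lemma subring_sum (I : Type) (r : seq I) (P : pred I) (F : I -> K) :
  (forall i, S (F i)) -> S (\sum_(i <- r | P i) F i).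
Proof. by move=> h; apply: big_ind => // [|a b]; [exact: subring0|exact: subringD]. Qed.
Lemma subringX a n : S a -> S (a ^+ n).
Proof.
by move=> Sa; elim: n => [|n IH]; [exact: subring1 hS|rewrite exprS; exact: (subringM hS)].
Qed.
Lemma subring_coef_prod (bs : seq K) j : (forall b, b \in bs -> S b) ->
  S (\prod_(b <- bs) ('X - b%:P))`_j.
Proof.
elim: bs j => [|b bs IH] j h.
  by rewrite big_nil coef1; case: (j == 0%N); [exact: subring1 hS|exact: subring0].
have {}IH i := IH i (fun c hc => h c (mem_behead (s := b :: bs) hc)).
rewrite big_cons mulrBl coefB coefXM coefCM; apply: (subringB hS).
  by case: (j == 0%N); [exact: subring0|exact: IH].
by apply: (subringM hS) => //; apply: h; exact: mem_head.
Qed.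
End Subring.

(** The ring S[y], for y^q - y in S.  The degree bound is part of the definition since
    it is what [bounded_adjoin_invariant] needs; a leading term of degree q can be
    reduced by the equation of y. *)
Definition bounded_adjoin (S : K -> Prop) (y a : K) : Prop :=
  exists2 P : {poly K}, (forall i, S P`_i) /\ (size P <= q)%N & a = P.[y].

Section Adjoin.
Variables (S : K -> Prop) (y : K).
Hypotheses (hS : subring S) (hy : S (y ^+ q - y)).
Local Notation Sy := (bounded_adjoin S y).

Lemma bounded_adjoin_const a : S a -> Sy a.
Proof.
move=> Sa; exists a%:P; last by rewrite hornerC.
split=> [i|]; last by rewrite (leq_trans (size_polyC_leq1 _)) // ltnW.
by rewrite coefC; case: (i == 0%N) => //; exact: subring0.
Qed.

Lemma bounded_adjoin_gen : Sy y.
Proof.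
exists 'X; last by rewrite hornerX.
split=> [i|]; last by rewrite size_polyX.
by rewrite coefX; case: (i == 1%N); [exact: subring1 hS|exact: subring0].
Qed.

Lemma bounded_adjoinB a b : Sy a -> Sy b -> Sy (a - b).
Proof.
move=> [P [SP sP] ->] [Q [SQ sQ] ->]; exists (P - Q); last by rewrite !hornerE.
split=> [i|]; first by rewrite coefB; exact: (subringB hS).
by rewrite (leq_trans (size_polyD _ _)) // geq_max size_polyN sP.
Qed.

Lemma bounded_adjoinMl a b : S a -> Sy b -> Sy (a * b).
Proof.
move=> Sa [P [SP sP] ->]; exists (a *: P); last by rewrite hornerZ.
split=> [i|]; first by rewrite coefZ; exact: (subringM hS).
by rewrite (leq_trans (size_scale_leq _ _)).
Qed.

Lemma bounded_adjoinMgen b : Sy b -> Sy (y * b).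
Proof.
move=> [P [SP sP] ->]; have := hy; set b0 := y ^+ q - y => Sb0.
pose P' := \poly_(i < q) (if i is j.+1 then P`_j else 0) + P`_q.-1 *: (b0%:P + 'X).
exists P'; last first.
  rewrite /P' hornerD hornerZ !hornerE horner_poly [P.[y]](horner_coef_wide y sP).
  have eq1 : q = q.-1.+1 by rewrite prednK // ltnW.
  have El (f : nat -> K) : \sum_(i < q) f i = f 0%N + \sum_(i < q.-1) f i.+1.
    by rewrite [in LHS]eq1 big_ord_recl.
  have Er (f : nat -> K) : \sum_(i < q) f i = \sum_(i < q.-1) f i + f q.-1.
    by rewrite [in LHS]eq1 big_ord_recr.
  rewrite (Er (fun i => P`_i * y ^+ i)) (El (fun i => (if i is j.+1 then P`_j else 0) * y ^+ i)).
  rewrite mul0r add0r mulrDr mulr_sumr; congr (_ + _).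
    by apply: eq_bigr => i _; rewrite exprS mulrCA.
  by rewrite /b0 subrK mulrCA -exprS -eq1.
split=> [i|].
  rewrite /P' coefD coefZ coefD coefC coefX coef_poly; apply: (subringD hS).
    by case: ifP => _; [case: i => [|j]|]; by [exact: subring0|].
  apply: (subringM hS) => //; apply: (subringD hS).
    by case: (i == 0%N) => //; exact: subring0.
  by case: (i == 1%N); [exact: subring1 hS|exact: subring0].
rewrite /P' (leq_trans (size_polyD _ _)) // geq_max size_poly /=.
rewrite (leq_trans (size_scale_leq _ _)) // (leq_trans (size_polyD _ _)) // geq_max size_polyX q1 andbT.
by rewrite (leq_trans (size_polyC_leq1 _)) // ltnW.
Qed.

Lemma bounded_adjoin_subring : subring Sy.
Proof.
have S0 : Sy 0 by apply: bounded_adjoin_const; exact: subring0.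
have SD a b : Sy a -> Sy b -> Sy (a + b).
  move=> ha hb; rewrite -[b]opprK; apply: bounded_adjoinB => //.
  by rewrite -sub0r; exact: bounded_adjoinB.
split.
- by apply: bounded_adjoin_const; exact: subring1 hS.
- exact: bounded_adjoinB.
- move=> a b [P [SP _] ->] hb; rewrite horner_coef mulr_suml.
  apply: big_ind => // i _; rewrite -mulrA; apply: bounded_adjoinMl => //.
  by elim: (nat_of_ord i) => [|j IH]; rewrite ?mul1r // exprS -mulrA; exact: bounded_adjoinMgen.
Qed.

(** P - a has degree less than q, and the q roots y + c; so P is the constant a, which
    is one of its coefficients. *)
Lemma bounded_adjoin_invariant (cs : seq K) (a : K) (P : {poly K}) : uniq cs -> size cs = q ->
  (forall i, S P`_i) -> (size P <= q)%N -> (forall c, c \in cs -> P.[y + c] = a) -> S a.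
Proof.
move=> ucs scs SP sP hP.
suff e : P = a%:P by have := SP 0%N; rewrite e coefC.
apply/eqP; rewrite -subr_eq0; apply: contraT => n0.
have := max_poly_roots n0 (rs := map (+%R y) cs); rewrite size_map scs => h.
have : (q < size (P - a%:P)%R)%N.
  apply: h; last by rewrite map_inj_uniq //; exact: addrI.
  by apply/allP => _ /mapP [c hc ->]; rewrite /root hornerD hornerN hornerC hP ?subrr.
rewrite ltnNge (leq_trans (size_polyD _ _)) // geq_max sP size_polyN.
by rewrite (leq_trans (size_polyC_leq1 _)) // ltnW.
Qed.
End Adjoin.

Lemma bounded_adjoin_fixed (S : K -> Prop) (y : K) (th : {rmorphism K -> K}) :
  (forall a, S a -> th a = a) -> th y = y -> forall a, bounded_adjoin S y a -> th a = a.
Proof.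
move=> hth hy _ [P [SP _] ->]; rewrite -horner_map hy; congr (_.[_]).
by apply/polyP => i; rewrite coef_map [LHS]hth.
Qed.
End ArtinSchreierTower.

(** * The function field of the quotient x^q - x = s^n of the Ree cover *)
Definition ree_points (k : closedFieldType) (q0 q n : nat) (P : 'cV[k]_4) : Prop :=
  exists x y z s : k, [/\ P = col4 x y z s, y ^+ q - y = x ^+ q0 * (x ^+ q - x),
    z ^+ q - z = x ^+ (2 * q0) * (x ^+ q - x) & x ^+ q - x = s ^+ n].

Section Exponents.
Variable e : nat.
Let q0 := (3 ^ e)%N.
Let q := (3 * q0 ^ 2)%N.

Lemma q0_gt0 : (0 < q0)%N. Proof. by rewrite expn_gt0. Qed.

Lemma q_gt2 : (2 < q)%N.
Proof. by rewrite /q; have := q0_gt0; nia. Qed.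

Lemma q_pow3 : q = (3 ^ (2 * e).+1)%N.
Proof. by rewrite /q /q0 -expnM -expnS mulnC. Qed.

Lemma ree_m_mul : (ree_m q0 q * ((q + 1) * (q + 3 * q0 + 1)) = q ^ 3 + 1)%N.
Proof.
rewrite /ree_m; have h : (3 * q0 <= q)%N by rewrite /q; have := q0_gt0; nia.
have hq : (3 * q = (3 * q0) ^ 2)%N by rewrite /q; lia.
move: h hq; move: (3 * q0)%N (q) => a b h; rewrite -{2 3 4}(subnK h); set c := (b - a)%N.
move=> hq; have : (b = c + a)%N by rewrite subnK. nia.
Qed.
End Exponents.

Section CubePowerCurve.
Variables (F : fieldType) (char3 : 3 \in [pchar F]) (e : nat).
Let q0 := (3 ^ e)%N.
Let q := (3 * q0 ^ 2)%N.

Lemma sigma_cube_power a : sigma (cube_frob char3 e) a = a ^+ q.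
Proof. rewrite /sigma !cube_frobE -!exprM; congr (_ ^+ _); rewrite /q /q0; nia. Qed.

Lemma on_ree_curve_cube_power x y z : on_ree_curve (cube_frob char3 e) x y z <->
  y ^+ q - y = x ^+ q0 * (x ^+ q - x) /\ z ^+ q - z = x ^+ (2 * q0) * (x ^+ q - x).
Proof. by rewrite /on_ree_curve !sigma_cube_power cube_frobE -exprM [(_ * 2)%N]mulnC. Qed.
End CubePowerCurve.

Section ReeFunctionField.
Variables (k : closedFieldType) (char3 : 3 \in [pchar k]) (e n r : nat).
Let q0 := (3 ^ e)%N.
Let q := (3 * q0 ^ 2)%N.
Hypothesis nr : (n * r = ree_m q0 q)%N.
Variables (K : fieldType) (iota : {rmorphism k -> K}) (x y z s : K).
Hypothesis hK : affine_function_field iota (@ree_points k q0 q n) (col4 x y z s).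

Local Notation i0 := (@Ordinal 4 0 isT).
Local Notation i1 := (@Ordinal 4 1 isT).
Local Notation i2 := (@Ordinal 4 2 isT).
Local Notation i3 := (@Ordinal 4 3 isT).
Local Notation V := (@ree_points k q0 q n).
Local Notation v := (col4 x y z s).

Let char3K : 3 \in [pchar K]. Proof. by rewrite (fmorph_pchar iota). Qed.
Local Notation phik := (cube_frob char3 e).
Local Notation phiK := (cube_frob char3K e).

Lemma n_gt0 : (0 < n)%N.
Proof. by move: nr; rewrite /ree_m; case: n => //; rewrite mul0n addn1. Qed.

Lemma phiK_iota c : phiK (iota c) = iota (phik c).
Proof. by rewrite !cube_frobE rmorphXn. Qed.

Lemma ree_pointsP P : V P <-> on_ree_curve phik (P i0 0) (P i1 0) (P i2 0) /\
  P i0 0 ^+ q - P i0 0 = P i3 0 ^+ n.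
Proof.
rewrite on_ree_curve_cube_power; split=> [[a [b [c [d [-> h1 h2 h3]]]]]|[[h1 h2] h3]].
  by rewrite !mxE !(tnth_nth 0).
exists (P i0 0), (P i1 0), (P i2 0), (P i3 0); split=> //.
apply/colP => i; rewrite mxE; case: i => [[|[|[|[|//]]]] hi]; rewrite (tnth_nth 0) /=.
all: by congr (P _ 0); exact: val_inj.
Qed.

Lemma eval_inX i : eval_in iota 'X_i v = tnth [tuple x; y; z; s] i.
Proof. by rewrite /eval_in mmapX mmap1U mxE. Qed.

Definition evK : {rmorphism {mpoly k[4]} -> K} := mmap iota (fun i => v i 0).
Definition evP (P : 'cV[k]_4) : {rmorphism {mpoly k[4]} -> k} := mmap idfun (fun i => P i 0).

Lemma eval_atE p P : eval_at p P = evP P p. Proof. by []. Qed.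
Lemma eval_inE p : eval_in iota p v = evK p. Proof. by []. Qed.
Lemma evKX i : evK 'X_i = tnth [tuple x; y; z; s] i.
Proof. exact: eval_inX. Qed.
Lemma evKC c : evK c%:MP = iota c.
Proof. by rewrite /evK /= mmapC. Qed.
Lemma evPX P i : evP P 'X_i = P i 0.
Proof. by rewrite /evP /= mmapX mmap1U. Qed.
Lemma evPC P c : evP P c%:MP = c.
Proof. by rewrite /evP /= mmapC. Qed.
Lemma evK_eq0 p : (forall P, V P -> evP P p = 0) -> evK p = 0.
Proof. exact: (eval_in_eq0 hK). Qed.
Lemma evP_eq0 p P : evK p = 0 -> V P -> evP P p = 0.
Proof. by move=> h; exact: (hK.1 p).1. Qed.

Lemma ree_equations : on_ree_curve phiK x y z /\ x ^+ q - x = s ^+ n.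
Proof.
have rE (S : comNzRingType) (f : {rmorphism {mpoly k[4]} -> S}) :=
  (rmorphXn f, rmorphD f, rmorphN f, rmorphM f).
split.
  apply/on_ree_curve_cube_power; split; apply/eqP; rewrite -subr_eq0; apply/eqP.
    have := @evK_eq0 ('X_i1 ^+ q - 'X_i1 - 'X_i0 ^+ q0 * ('X_i0 ^+ q - 'X_i0)).
    rewrite !rE !evKX !(tnth_nth 0) /=; apply=> P /ree_pointsP [/on_ree_curve_cube_power [h _] _].
    by rewrite !rE !evPX h subrr.
  have := @evK_eq0 ('X_i2 ^+ q - 'X_i2 - 'X_i0 ^+ (2 * q0) * ('X_i0 ^+ q - 'X_i0)).
  rewrite !rE !evKX !(tnth_nth 0) /=; apply=> P /ree_pointsP [/on_ree_curve_cube_power [_ h] _].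
  by rewrite !rE !evPX h subrr.
apply/eqP; rewrite -subr_eq0; apply/eqP.
have := @evK_eq0 ('X_i0 ^+ q - 'X_i0 - 'X_i3 ^+ n).
rewrite !rE !evKX !(tnth_nth 0) /=; apply=> P /ree_pointsP [_ h].
by rewrite !rE !evPX h subrr.
Qed.

Lemma rmorph_fixing (th th' : {rmorphism K -> K}) : (forall c, th (iota c) = th' (iota c)) ->
  th x = th' x -> th y = th' y -> th z = th' z -> th s = th' s -> th =1 th'.
Proof.
move=> hi hx hy hz hs; apply: (rmorph_ext hK) => // i; rewrite mxE.
by case: i => [[|[|[|[|//]]]] hi']; rewrite (tnth_nth 0).
Qed.

(** By [substitution]; the inverse on points is the translation by the parameters
    - al, al^q0 al - be, - (al^(2 q0) al) - al^q0 be - ga. *)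
Lemma translation (al be ga : k) : al ^+ q = al -> be ^+ q = be -> ga ^+ q = ga ->
  exists th : {rmorphism K -> K}, [/\ forall c, th (iota c) = iota c, th x = x + iota al,
    th y = translate_y phiK (iota al) (iota be) x y,
    th z = translate_z phiK (iota al) (iota ga) x y z & th s = s].
Proof.
move=> ha hb hc.
have rE (S : comNzRingType) (f : {rmorphism {mpoly k[4]} -> S}) :=
  (rmorphXn f, rmorphD f, rmorphN f, rmorphM f).
pose w := fun i => tnth [tuple 'X_i0 + al%:MP; 'X_i1 + (phik al)%:MP * 'X_i0 + be%:MP;
  'X_i2 - (phik al)%:MP * 'X_i1 + (phik al)%:MP ^+ 2 * 'X_i0 + ga%:MP; 'X_i3] i : {mpoly k[4]}.
have hw P : (evP P (w i0) = P i0 0 + al) * (evP P (w i1) = translate_y phik al be (P i0 0) (P i1 0)) *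
   (evP P (w i2) = translate_z phik al ga (P i0 0) (P i1 0) (P i2 0)) * (evP P (w i3) = P i3 0).
  by rewrite /w !(tnth_nth 0) /= !(rE _ (evP P)) !evPX !evPC.
have hwK : (evK (w i0) = x + iota al) * (evK (w i1) = translate_y phiK (iota al) (iota be) x y) *
   (evK (w i2) = translate_z phiK (iota al) (iota ga) x y z) * (evK (w i3) = s).
  by rewrite /w !(tnth_nth 0) /= !(rE _ evK) !evKX !evKC !(tnth_nth 0) /translate_y /translate_z !phiK_iota.
have sig := sigma_cube_power char3 e.
have [P /ree_pointsP [h1 h2]|P /ree_pointsP [h1 h2]|th [hi hth]] := @substitution _ _ _ _ _ _ hK w.
- apply/ree_pointsP; rewrite !mxE !eval_atE !hw; split.
    by apply: on_ree_curve_translate => //; rewrite sig.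
  by rewrite -h2 -!sig sigmaD // !sig ha; ring.
- pose a := P i0 0; pose b := P i1 0; pose c := P i2 0; pose f := phik al.
  pose be' := f * al - be; pose ga' := - (f ^+ 2 * al) - f * be - ga.
  have sf : sigma phik f = f by rewrite /f sigma_phi sig ha.
  have sal : sigma phik (- al) = - al by rewrite sigmaN // sig ha.
  have sbe : sigma phik be' = be'.
    by rewrite /be' sigmaB // sigmaM // sf !sig ha hb.
  have sga : sigma phik ga' = ga'.
    by rewrite /ga' !(sigmaB char3) sigmaN // !sigmaM sf !sig ha hb hc.
  exists (col4 (a - al) (translate_y phik (- al) be' a b) (translate_z phik (- al) ga' a b c) (P i3 0)).
    apply/ree_pointsP; rewrite !mxE !(tnth_nth 0) /=; split.
      exact: on_ree_curve_translate.
    by rewrite -h2 -!sig sigmaB // (sig al) ha -/a; ring.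
  apply/colP => i; rewrite mxE eval_atE.
  case: i => [[|[|[|[|//]]]] hi]; rewrite (bool_irrelevance hi isT) hw !mxE !(tnth_nth 0) /=.
  + by rewrite subrK.
  + by rewrite /translate_y rmorphN /be' -/f -/b; ring.
  + rewrite /translate_z /translate_y rmorphN /ga' /be' -/f -/c.
    by apply: (eq_char3 char3 (s := - (f ^+ 2 * (a - al)))); ring.
  + by [].
- exists th; split=> //.
  + by have := hth i0; rewrite mxE (tnth_nth 0) eval_inE hwK.
  + by have := hth i1; rewrite mxE (tnth_nth 0) eval_inE hwK.
  + by have := hth i2; rewrite mxE (tnth_nth 0) eval_inE hwK.
  + by have := hth i3; rewrite mxE (tnth_nth 0) eval_inE hwK.
Qed.

(** Every endomorphism that fixes s gives another solution of the equations of the curve,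
    to which the computation of degrees applies as well. *)
Lemma rmorph_point (th : {rmorphism K -> K}) : th s = s ->
  on_ree_curve phiK (th x) (th y) (th z) /\ th x ^+ q - th x = s ^+ n.
Proof.
move=> ths; have [hc hs] := ree_equations.
have [h1 h2] := (on_ree_curve_cube_power char3K e x y z).1 hc.
split; last by rewrite -rmorphXn -rmorphB hs rmorphXn ths.
apply/on_ree_curve_cube_power; split.
  by rewrite -!rmorphXn -!rmorphB -rmorphM -h1.
by rewrite -!rmorphXn -!rmorphB -rmorphM -h2.
Qed.

(** For each value c of s there is a point of the curve with s = c, so a polynomial
    relation for s vanishes on k. *)
Lemma s_transcendental (p : {poly k}) : (map_poly iota p).[s] = 0 -> p = 0.
Proof.
move=> ps; apply/eqP; apply: contraT => /closed_nonrootP [c /negP []].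
pose P := 'X^q - 'X - (c ^+ n)%:P : {poly k}.
have sX : (size ('X^q - 'X : {poly k})%R = q.+1)%N.
  by rewrite size_polyDl size_polyXn // size_polyN size_polyX ltnS; have := q_gt2 e; rewrite -/q; lia.
have [|a /rootP ha] := closed_rootP P _.
  rewrite /P size_polyDl sX; first by have := q_gt2 e; rewrite -/q; lia.
  by rewrite size_polyN (leq_ltn_trans (size_polyC_leq1 _)) //; have := q_gt2 e; rewrite -/q; lia.
have artin (b : k) : exists d, d ^+ q - d = b.
  have [|d /rootP hd] := closed_rootP ('X^q - 'X - b%:P) _.
    rewrite size_polyDl sX; first by have := q_gt2 e; rewrite -/q; lia.
    by rewrite size_polyN (leq_ltn_trans (size_polyC_leq1 _)) //; have := q_gt2 e; rewrite -/q; lia.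
  by exists d; apply/eqP; rewrite -subr_eq0 -hd !hornerE.
have [b hb] := artin (a ^+ q0 * (a ^+ q - a)).
have [d hd] := artin (a ^+ (2 * q0) * (a ^+ q - a)).
have Pt : V (col4 a b d c).
  exists a, b, d, c; split => //; apply/eqP; rewrite -subr_eq0 -ha /P.
  by rewrite !hornerE.
pose p3 : {mpoly k[4]} := \sum_(i < size p) (p`_i)%:MP * 'X_i3 ^+ i.
have e3 : evK p3 = (map_poly iota p).[s].
  rewrite /p3 rmorph_sum horner_coef size_map_poly; apply: eq_bigr => i _.
  by rewrite rmorphM rmorphXn evKC evKX (tnth_nth 0) coef_map.
apply/rootP; rewrite -(evP_eq0 (etrans e3 ps) Pt) horner_coef /p3 rmorph_sum.
by apply: eq_bigr => i _; rewrite rmorphM rmorphXn evPC evPX mxE (tnth_nth 0).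
Qed.

(** The ring k[1/s] with the ideal of the polynomials in 1/s without constant term
    is proper since s is transcendental; in a place above it, 1/s vanishes. *)
Lemma place_at_infinity : exists2 O, curve_point iota O & ~ O s.
Proof.
have s0 : s != 0.
  apply/eqP => s0; have := @s_transcendental 'X; rewrite map_polyX hornerX s0 => /(_ erefl) /eqP.
  by rewrite polyX_eq0.
pose B a := exists p : {poly k}, a = (map_poly iota p).[s^-1].
pose J a := exists2 p : {poly k}, p`_0 = 0 & a = (map_poly iota p).[s^-1].
have BJ : ring_with_ideal B J.
  split.
  - by exists 1; rewrite rmorph1 hornerC.
  - by move=> _ _ [p ->] [p' ->]; exists (p - p'); rewrite rmorphB !hornerE.
  - by move=> _ _ [p ->] [p' ->]; exists (p * p'); rewrite rmorphM hornerM.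
  - by exists 0; rewrite ?coef0 // rmorph0 horner0.
  - move=> _ _ [p p0 ->] [p' p0' ->]; exists (p - p'); last by rewrite rmorphB !hornerE.
    by rewrite coefB p0 p0' subr0.
  - by move=> _ [p _ ->]; exists p.
  - move=> _ _ [p ->] [p' p0' ->]; exists (p * p'); last by rewrite rmorphM hornerM.
    by rewrite coefM big_ord1 p0' mulr0.
  - move=> [p p0 e1]; pose N := size p.
    (* A relation 1 = p(1/s), multiplied by s^N. *)
    pose p' := \poly_(i < N.+1) p`_(N - i) - 'X^N.
    have : p' = 0.
      apply: s_transcendental; rewrite rmorphB /= map_polyXn hornerD hornerN hornerXn.
      have -> : (map_poly iota (\poly_(i < N.+1) p`_(N - i))).[s] = s ^+ N * (map_poly iota p).[s^-1].
        rewrite (horner_coef_wide _ (n := N.+1)); last by rewrite size_map_poly size_poly.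
        rewrite (horner_coef_wide s^-1 (n := N.+1)); last by rewrite size_map_poly leqnSn.
        rewrite mulr_sumr (reindex_inj rev_ord_inj) /=; apply: eq_bigr => i _.
        have hi : (i <= N)%N by rewrite -ltnS.
        rewrite !coef_map coef_poly /= subSS ltnS leq_subr subKn // mulrCA; congr (_ * _).
        have -> : s ^+ N = s ^+ (N - i) * s ^+ i by rewrite -exprD subnK.
        by rewrite exprVn mulfK // expf_neq0.
      by rewrite -e1 mulr1 subrr.
    move=> /(congr1 (fun w : {poly k} => w`_N)) /eqP.
    by rewrite coefB coef_poly ltnSn subnn p0 coefXn eqxx coef0 sub0r oppr_eq0 oner_eq0.
have Js : J s^-1 by exists 'X; rewrite ?coefX // map_polyX hornerX.
have [||O [pO BO JO]] := @place_above _ _ iota B J BJ.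
- by move=> c; exists c%:P; rewrite map_polyC hornerC.
- by exists s^-1 => //; rewrite invr_eq0.
exists O => //; have [_] := JO _ Js.
by rewrite invrK => -[/eqP|//]; rewrite invr_eq0 (negPf s0).
Qed.

Definition pedersen_function := ree_w phiK x y z.
Definition model_degree := (q ^ 3 + 1)%N.
Local Notation w := pedersen_function.
Local Notation d := model_degree.

(** The pole orders of x, y, z, w1, w7, w8 at a place over s = infinity, in units of
    1 / q^4 times that of s; the factor q^4 makes them all integers.  Each of the six
    functions f satisfies an equation sigma f - f = g, where g is a product of
    functions of known order; for w7, one factor is a sum with a dominant term. *)
Section Degrees.
Variable O : K -> Prop.
Hypotheses (pO : curve_point iota O) (pole_s : ~ O s).
Let N := (q ^ 4)%N.
Let N_gt0 : (0 < N)%N. Proof. by rewrite expn_gt0; have := q_gt2 e; rewrite -/q; lia. Qed.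
Let pN : [pchar K].-nat N.
Proof. by rewrite /N [q]q_pow3 -expnM; exact: char3_pnat. Qed.
Let q1 : (1 < q)%N. Proof. by apply: ltnW; exact: q_gt2. Qed.
Let hq : (3 * q0 * q0 = q)%N. Proof. by rewrite /q -mulnn mulnA. Qed.
Let degAS a b i : (0 < i)%N -> a ^+ q - a = b -> deg_eq O s N b (q * i) -> deg_eq O s N a i.
Proof. exact: (deg_eq_artin_schreier pO pole_s N_gt0 pN q1). Qed.
Local Notation deg := (deg_eq O s N).

(** It is stated for an arbitrary solution so that it applies to the conjugates of
    x, y, z as well. *)
Lemma ree_degree x1 y1 z1 : on_ree_curve phiK x1 y1 z1 -> x1 ^+ q - x1 = s ^+ n ->
  deg (ree_w phiK x1 y1 z1) (n * q * ((q + 1) * (q + 3 * q0 + 1)))%N.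
Proof.
have n0 := n_gt0; have q00 : (0 < q0)%N := q0_gt0 e.
have sig a : sigma phiK a = a ^+ q := sigma_cube_power char3K e a.
have degphi a i : deg a i -> deg (phiK a) (q0 * i).
  by move=> h; rewrite cube_frobE; exact: (deg_eqX pO).
move=> hc hx; set D := s ^+ n in hx.
have hDs : sigma phiK x1 - x1 = D by rewrite sig.
have hD : deg D (n * N) by apply: (deg_eqX pO); exact: (deg_eq_pole pO).
have dx : deg x1 (n * q ^ 3).
  by apply: (degAS _ hx); [nia|have -> : (q * (n * q ^ 3) = n * N)%N by rewrite /N; ring].
have da := degphi _ _ dx; set a := phiK x1 in da.
have [hy hz] := hc; rewrite !sig hx -/a in hy hz.
have dy : deg y1 (q0 * n * q ^ 2 + n * q ^ 3).
  apply: (degAS _ hy); first by nia.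
  have -> : (q * (q0 * n * q ^ 2 + n * q ^ 3) = q0 * (n * q ^ 3) + n * N)%N by rewrite /N; ring.
  exact: (deg_eqM pO).
have dz : deg z1 (2 * q0 * n * q ^ 2 + n * q ^ 3).
  apply: (degAS _ hz); first by nia.
  have -> : (q * (2 * q0 * n * q ^ 2 + n * q ^ 3) = 2 * (q0 * (n * q ^ 3)) + n * N)%N by rewrite /N; ring.
  by apply: (deg_eqM pO) => //; exact: (deg_eqX pO).
pose A := a ^+ 3; pose B := phiK y1 ^+ 3; pose C := phiK z1 ^+ 3.
have dw1 : deg (w1 x1 A B) (3 * q0 * n * q ^ 2 + n * q ^ 3).
  apply: (degAS (b := A * D)); first by nia.
    by rewrite -sig (sigma_w1 char3K hc) hDs addrC addKr.
  have -> : (q * (3 * q0 * n * q ^ 2 + n * q ^ 3) = 3 * (q0 * (n * q ^ 3)) + n * N)%N by rewrite /N; ring.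
  by apply: (deg_eqM pO) => //; exact: (deg_eqX pO).
have dE : deg (a * z1 + a ^+ 2 * y1 + w1 x1 A B) (2 * q0 * n * q ^ 3 + q0 * n * q ^ 2 + n * q ^ 3).
  apply: (deg_eqD pO pole_s pN _ dw1.1); last by nia.
  rewrite addrC; have dz' := deg_eqM pO da dz.
  apply: (deg_eqD pO pole_s pN _ dz'.1); last by nia.
  have -> : (2 * q0 * n * q ^ 3 + q0 * n * q ^ 2 + n * q ^ 3 =
    2 * (q0 * (n * q ^ 3)) + (q0 * n * q ^ 2 + n * q ^ 3))%N by ring.
  by apply: (deg_eqM pO) => //; exact: (deg_eqX pO).
have dw7 : deg (w7 x1 y1 z1 A B C) (2 * q0 * n * q ^ 2 + q0 * n * q + n * q ^ 2 + n * q ^ 3).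
  apply: (degAS (b := (a * z1 + a ^+ 2 * y1 + w1 x1 A B) * D)); first by nia.
    by rewrite -sig (sigma_w7 char3K hc) hDs addrC addKr.
  have -> : (q * (2 * q0 * n * q ^ 2 + q0 * n * q + n * q ^ 2 + n * q ^ 3) =
    2 * q0 * n * q ^ 3 + q0 * n * q ^ 2 + n * q ^ 3 + n * N)%N by rewrite /N; ring.
  exact: (deg_eqM pO).
rewrite /ree_w -/a -/A -/B -/C.
apply: (degAS (b := phiK (w7 x1 y1 z1 A B C) ^+ 3 * D)); first by nia.
  by rewrite (psi_w7E char3K hc) -sig (sigma_w8 char3K hc) hDs addrC addKr.
have -> : (q * (n * q * ((q + 1) * (q + 3 * q0 + 1))) =
  3 * (q0 * (2 * q0 * n * q ^ 2 + q0 * n * q + n * q ^ 2 + n * q ^ 3)) + n * N)%N.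
  have -> : (3 * (q0 * (2 * q0 * n * q ^ 2 + q0 * n * q + n * q ^ 2 + n * q ^ 3)) =
    2 * n * q ^ 2 * (3 * q0 * q0) + n * q * (3 * q0 * q0) + 3 * q0 * n * q ^ 2 + 3 * q0 * n * q ^ 3)%N.
    by ring.
  by rewrite hq /N; ring.
by apply: (deg_eqM pO) => //; apply: (deg_eqX pO) => //; exact: degphi.
Qed.

Lemma ree_degree_power x1 y1 z1 : on_ree_curve phiK x1 y1 z1 -> x1 ^+ q - x1 = s ^+ n ->
  deg (ree_w phiK x1 y1 z1 ^+ r) (q * d).
Proof.
move=> hc hx; have -> : (q * d = r * (n * q * ((q + 1) * (q + 3 * q0 + 1))))%N.
  rewrite /d -(ree_m_mul e) -/q0 -/q -nr; ring.
by apply: (deg_eqX pO) => //; exact: ree_degree.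
Qed.
End Degrees.

Section Group.
Variables (rs : seq k).
Hypotheses (urs : uniq rs) (srs : size rs = q)
  (ers : 'X^q - 'X = \prod_(c <- rs) ('X - c%:P)).

Lemma mem_rs c : (c \in rs) = (c ^+ q == c).
Proof. by rewrite -root_prod_XsubC -ers /root !hornerE subr_eq0. Qed.

Lemma fixed_power_const a : a ^+ q = a -> exists2 c, c \in rs & a = iota c.
Proof.
move=> ha; have : root (\prod_(c <- map iota rs) ('X - c%:P)) a.
  have <- : map_poly iota ('X^q - 'X) = \prod_(c <- map iota rs) ('X - c%:P).
    rewrite ers rmorph_prod big_map; apply: eq_bigr => c _.
    by rewrite rmorphB /= map_polyX map_polyC.
  by rewrite rmorphB rmorphXn /= map_polyX /root !hornerE ha subrr.
by rewrite root_prod_XsubC => /mapP [c hc ->]; exists c.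
Qed.

(** A triple (al, be, ga) of elements of F_q, in the form of the list [rs] of the
    roots of X^q - X. *)
Definition translations := (seq_sub rs * seq_sub rs * seq_sub rs)%type.
Variable tau : translations -> {rmorphism K -> K}.
Hypothesis tau_iota : forall i c, tau i (iota c) = iota c.
Hypothesis tau_x : forall i, tau i x = x + iota (val i.1.1).
Hypothesis tau_y : forall i, tau i y = translate_y phiK (iota (val i.1.1)) (iota (val i.1.2)) x y.
Hypothesis tau_z : forall i, tau i z = translate_z phiK (iota (val i.1.1)) (iota (val i.2)) x y z.
Hypothesis tau_s : forall i, tau i s = s.

Lemma card_translations : #|{: translations}| = (q ^ 3)%N.
Proof. by rewrite !card_prod card_seq_sub // srs; lia. Qed.

Lemma tau_surjective al be ga : al \in rs -> be \in rs -> ga \in rs ->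
  exists i : translations, [/\ val i.1.1 = al, val i.1.2 = be & val i.2 = ga].
Proof.
move=> ha hb hc.
by exists (SeqSub ha, SeqSub hb, SeqSub hc).
Qed.

Lemma rs0 : 0 \in rs.
Proof. by rewrite mem_rs expr0n; have := q_gt2 e; rewrite -/q; case: q. Qed.

Lemma tau_id : exists i, tau i =1 id.
Proof.
have [i [h1 h2 h3]] := tau_surjective rs0 rs0 rs0; exists i.
apply: (@rmorph_fixing (tau i) idfun) => //=.
- by rewrite tau_x h1 rmorph0 addr0.
- by rewrite tau_y h1 h2 /translate_y !rmorph0 mul0r !addr0.
- by rewrite tau_z h1 h3 /translate_z !rmorph0 expr0n /= !mul0r subr0 !addr0.
Qed.

Lemma tau_comp i j : exists l, tau i \o tau j =1 tau l.
Proof.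
have sig a : sigma phiK a = a ^+ q := sigma_cube_power char3K e a.
have [hc hs] := ree_equations.
pose th : {rmorphism K -> K} := tau i \o tau j.
have ths : th s = s by rewrite /= !tau_s.
have [hth hths] := rmorph_point ths.
have hx : sigma phiK (th x) - th x = sigma phiK x - x.
  by rewrite !sig hs hths.
have [al [be [ga [h1 h2 h3 [ex ey ez]]]]] := ree_curve_fibre char3K hc hth hx.
have [al' ha eal] := fixed_power_const (etrans (esym (sig _)) h1).
have [be' hb ebe] := fixed_power_const (etrans (esym (sig _)) h2).
have [ga' hga ega] := fixed_power_const (etrans (esym (sig _)) h3).
have [l [l1 l2 l3]] := tau_surjective ha hb hga.
exists l; apply: (@rmorph_fixing th (tau l)).
- by move=> c; rewrite /= !tau_iota.
- by rewrite ex tau_x l1 eal.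
- by rewrite ey tau_y l1 l2 eal ebe.
- by rewrite ez tau_z l1 l3 eal ega.
- by rewrite ths tau_s.
Qed.

Definition poly_in_s a := exists p : {poly k}, a = (map_poly iota p).[s].
Definition regular a := exists p, a = evK p.

Lemma poly_in_s_subring : subring poly_in_s.
Proof.
split.
- by exists 1; rewrite rmorph1 hornerC.
- by move=> _ _ [p ->] [p' ->]; exists (p - p'); rewrite rmorphB !hornerE.
- by move=> _ _ [p ->] [p' ->]; exists (p * p'); rewrite rmorphM hornerM.
Qed.

Lemma regular_subring : subring regular.
Proof.
split.
- by exists 1; rewrite rmorph1.
- by move=> _ _ [p ->] [p' ->]; exists (p - p'); rewrite rmorphB.
- by move=> _ _ [p ->] [p' ->]; exists (p * p'); rewrite rmorphM.
Qed.

Let q_gt1 : (1 < q)%N. Proof. by apply: ltnW; exact: q_gt2. Qed.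
Let S1 := bounded_adjoin q poly_in_s x.
Let S2 := bounded_adjoin q S1 y.
Let S3 := bounded_adjoin q S2 z.

Let x_as : poly_in_s (x ^+ q - x).
Proof.
rewrite ree_equations.2; apply: (subringX poly_in_s_subring).
by exists 'X; rewrite map_polyX hornerX.
Qed.
Let S1_subring : subring S1.
Proof. exact (bounded_adjoin_subring q_gt1 poly_in_s_subring x_as). Qed.
Let S1x : S1 x. Proof. exact (bounded_adjoin_gen q_gt1 x poly_in_s_subring). Qed.
Let y_as : S1 (y ^+ q - y).
Proof.
have [/on_ree_curve_cube_power [-> _] _] := ree_equations.
apply: (subringM S1_subring); first exact: (subringX S1_subring).
by apply: (subringB S1_subring) => //; exact: (subringX S1_subring).
Qed.
Let S2_subring : subring S2.
Proof. exact (bounded_adjoin_subring q_gt1 S1_subring y_as). Qed.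
Let S12 a : S1 a -> S2 a. Proof. exact (@bounded_adjoin_const K q q_gt1 _ _ S1_subring a). Qed.
Let z_as : S2 (z ^+ q - z).
Proof.
have [/on_ree_curve_cube_power [_ ->] _] := ree_equations.
apply: S12; apply: (subringM S1_subring); first exact: (subringX S1_subring).
by apply: (subringB S1_subring) => //; exact: (subringX S1_subring).
Qed.
Let S3_subring : subring S3.
Proof. exact (bounded_adjoin_subring q_gt1 S2_subring z_as). Qed.
Let S23 a : S2 a -> S3 a. Proof. exact (@bounded_adjoin_const K q q_gt1 _ _ S2_subring a). Qed.
Let S01 a : poly_in_s a -> S1 a. Proof. exact (@bounded_adjoin_const K q q_gt1 _ _ poly_in_s_subring a). Qed.

(** k[x, y, z, s] is obtained from k[s] by adjoining x, y and z, in this order, as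
    [S1], [S2] and [S3]. *)
Lemma regular_tower a : regular a -> S3 a.
Proof.
move=> [p ->]; rewrite /evK /= /mmap; apply: (subring_sum S3_subring) => m.
apply: (subringM S3_subring).
  by apply/S23/S12/S01; exists (p@_m)%:P; rewrite map_polyC hornerC.
rewrite /mmap1; apply: big_ind => [||i _]; [exact: subring1 S3_subring|exact: subringM S3_subring|].
apply: (subringX S3_subring); rewrite mxE.
case: i => [[|[|[|[|//]]]] hi]; rewrite (tnth_nth 0) /=.
- exact/S23/S12.
- by apply: S23; exact (bounded_adjoin_gen q_gt1 y S1_subring).
- exact (bounded_adjoin_gen q_gt1 z S2_subring).
- by apply/S23/S12/S01; exists 'X; rewrite map_polyX hornerX.
Qed.

(** The translations by (0, 0, ga) fix S2 and move z to z + ga; hence an invariant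
    element of S3 lies in S2.  In the same way, (0, be, 0) leads to S1, and (al, 0, 0)
    to k[s]. *)
Lemma regular_fixed a : regular a -> fixed_by tau a -> poly_in_s a.
Proof.
move=> /regular_tower Ra fa.
have fs i b : poly_in_s b -> tau i b = b.
  move=> [p ->]; rewrite -horner_map tau_s; congr (_.[_]); apply/polyP => j.
  by rewrite !coef_map /= tau_iota.
have uK : uniq (map iota rs) by rewrite map_inj_uniq //; exact: fmorph_inj.
have sK : size (map iota rs) = q by rewrite size_map.
have S2a : S2 a.
  have [P [SP sP] ea] := Ra.
  apply: (@bounded_adjoin_invariant K q q_gt1 S2 z _ a P uK sK SP sP) => _ /mapP [c hc ->].
  have [i [h1 h2 h3]] := tau_surjective rs0 rs0 hc.
  have tx : tau i x = x by rewrite tau_x h1 rmorph0 addr0.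
  have ty : tau i y = y by rewrite tau_y h1 h2 /translate_y !rmorph0 mul0r !addr0.
  have tz : tau i z = z + iota c.
    by rewrite tau_z h1 h3 /translate_z !rmorph0 expr0n /= !mul0r subr0 !addr0.
  have f2 : forall b, S2 b -> tau i b = b.
    by apply: bounded_adjoin_fixed => //; apply: bounded_adjoin_fixed => //; exact: fs.
  rewrite -(fa i) ea -horner_map tz; congr (_.[_]); apply/polyP => j.
  by rewrite coef_map [RHS]f2.
have S1a : S1 a.
  have [P [SP sP] ea] := S2a.
  apply: (@bounded_adjoin_invariant K q q_gt1 S1 y _ a P uK sK SP sP) => _ /mapP [c hc ->].
  have [i [h1 h2 h3]] := tau_surjective rs0 hc rs0.
  have tx : tau i x = x by rewrite tau_x h1 rmorph0 addr0.
  have ty : tau i y = y + iota c by rewrite tau_y h1 h2 /translate_y !rmorph0 mul0r addr0.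
  have f1 : forall b, S1 b -> tau i b = b by apply: bounded_adjoin_fixed => //; exact: fs.
  rewrite -(fa i) ea -horner_map ty; congr (_.[_]); apply/polyP => j.
  by rewrite coef_map [RHS]f1.
have [P [SP sP] ea] := S1a.
apply: (@bounded_adjoin_invariant K q q_gt1 poly_in_s x _ a P uK sK SP sP) => _ /mapP [c hc ->].
have [i [h1 h2 h3]] := tau_surjective hc rs0 rs0.
have tx : tau i x = x + iota c by rewrite tau_x h1.
rewrite -(fa i) ea -horner_map tx; congr (_.[_]); apply/polyP => j.
by rewrite coef_map [RHS]fs.
Qed.

Lemma regular_tau i a : regular a -> regular (tau i a).
Proof.
have reg b : poly_in_s b \/ b = x \/ b = y \/ b = z \/ (exists c, b = iota c) -> regular b.
  move=> [[p ->]|[->|[->|[->|[c ->]]]]].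
  - rewrite horner_coef; apply: (subring_sum regular_subring) => j; rewrite coef_map /=.
    apply: (subringM regular_subring); first by exists (p`_j)%:MP; rewrite evKC.
    by apply: (subringX regular_subring); exists 'X_i3; rewrite evKX (tnth_nth 0).
  - by exists 'X_i0; rewrite evKX (tnth_nth 0).
  - by exists 'X_i1; rewrite evKX (tnth_nth 0).
  - by exists 'X_i2; rewrite evKX (tnth_nth 0).
  - by exists c%:MP; rewrite evKC.
have rc c : regular (iota c) by apply: reg; right; right; right; right; exists c.
have [rx ry rz] : [/\ regular x, regular y & regular z].
  by split; apply: reg; tauto.
have rs' : regular s by apply: reg; left; exists 'X; rewrite map_polyX hornerX.
move=> [p ->]; rewrite /evK /= /mmap rmorph_sum; apply: (subring_sum regular_subring) => m.
rewrite rmorphM tau_iota; apply: (subringM regular_subring); first exact: rc.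
rewrite /mmap1 rmorph_prod.
apply: big_ind => [||l _]; [exact: subring1 regular_subring|exact: subringM regular_subring|].
rewrite rmorphXn; apply: (subringX regular_subring); rewrite mxE.
have RD := subringD regular_subring.
have RM := subringM regular_subring.
case: l => [[|[|[|[|//]]]] hi]; rewrite (tnth_nth 0) /=.
- by rewrite tau_x; exact: RD.
- by rewrite tau_y /translate_y phiK_iota; apply: (RD) => //; apply: (RD) => //; exact: RM.
- rewrite tau_z /translate_z phiK_iota; apply: (RD) => //; apply: (RD) => //.
    by apply: (subringB regular_subring) => //; exact: RM.
  by apply: (RM) => //; apply: (subringX regular_subring).
- by rewrite tau_s.
Qed.

Lemma fixed_rational a : fixed_by tau a <-> rational_in_s iota s a.
Proof.
split=> [fa|[p [p' [_ ->]]] i]; last first.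
  have h g : tau i (map_poly iota g).[s] = (map_poly iota g).[s].
    rewrite -horner_map tau_s; congr (_.[_]); apply/polyP => j.
    by rewrite !coef_map /= tau_iota.
  by rewrite fmorph_div !h.
have [i hi] := tau_id.
have [p [p' [p'0 ea]]] := hK.2 a.
have := @fixed_fraction _ _ tau i hi tau_comp regular _ _ _ (evK p) (evK p') _ _ p'0.
case.
- exact: subring1 regular_subring.
- exact: subringM regular_subring.
- by move=> j b; exact: regular_tau.
- by exists p.
- by exists p'.
- by rewrite -[_ / _]ea.
move=> b [b' [[Rb fb] [Rb' fb'] b'0 e1]].
have [g eg] := regular_fixed Rb fb; have [g' eg'] := regular_fixed Rb' fb'.
by exists g, g'; rewrite -eg -eg'; split => //; rewrite ea e1.
Qed.

Definition model_coordinate := w ^+ r.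
Local Notation u := model_coordinate.

Lemma rmorph_ree_w (th : {rmorphism K -> K}) a b c :
  th (ree_w phiK a b c) = ree_w phiK (th a) (th b) (th c).
Proof. by rewrite /ree_w rmorph_w8 !cube_frobE -!exprM !rmorphXn. Qed.

Lemma conjugate_degree O b : curve_point iota O -> ~ O s -> b \in conjugates tau u ->
  deg_eq O s (q ^ 4) b (q * d).
Proof.
move=> pO hO /conjugatesP [i ->]; rewrite /u rmorphXn rmorph_ree_w.
have [h1 h2] := rmorph_point (tau_s i).
exact: (ree_degree_power pO hO h1 h2).
Qed.

(** The function w as a polynomial in the coordinates, so that relations between
    functions can be tested at the points of the curve. *)
Definition w_poly : {mpoly k[4]} := w8 'X_i0 'X_i1 'X_i2
  (('X_i0 ^+ q0) ^+ 3) (('X_i1 ^+ q0) ^+ 3) (('X_i2 ^+ q0) ^+ 3).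

Lemma evK_w_poly : evK w_poly = w.
Proof.
rewrite /w /ree_w /w_poly (rmorph_w8 evK) !cube_frobE.
have cubeE i : evK (('X_i ^+ q0) ^+ 3) = (tnth [tuple x; y; z; s] i ^+ q0) ^+ 3.
  by rewrite (rmorphXn evK) (rmorphXn evK) evKX.
congr w8; [exact: evKX|exact: evKX|exact: evKX|exact: cubeE|exact: cubeE|exact: cubeE].
Qed.

Lemma evP_w_poly P : evP P w_poly = ree_w phik (P i0 0) (P i1 0) (P i2 0).
Proof.
rewrite /ree_w /w_poly (rmorph_w8 (evP P)) !cube_frobE.
have cubeE i : evP P (('X_i ^+ q0) ^+ 3) = (P i 0 ^+ q0) ^+ 3.
  by rewrite (rmorphXn (evP P)) (rmorphXn (evP P)) evPX.
congr w8; [exact: evPX|exact: evPX|exact: evPX|exact: cubeE|exact: cubeE|exact: cubeE].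
Qed.

Lemma conjugate_regular b : b \in conjugates tau u -> regular b.
Proof.
move=> /conjugatesP [i ->]; apply: regular_tau; apply: (subringX regular_subring).
by exists w_poly; rewrite evK_w_poly.
Qed.

Lemma ev1_inj : injective (ev1 iota s).
Proof.
move=> p p' /eqP; rewrite -subr_eq0 -rmorphB => /eqP h; apply/eqP; rewrite -subr_eq0.
by apply/eqP; exact: s_transcendental.
Qed.

(** The polynomial with the conjugates of u as roots has invariant regular
    coefficients; these are polynomials in s. *)
Lemma orbit_poly_lift : exists2 N : {poly {poly k}},
  map_poly (ev1 iota s) N = orbit_poly tau u & size N = (size (conjugates tau u)).+1.
Proof.
have coefS j : exists p : {poly k}, (orbit_poly tau u)`_j = ev1 iota s p.
  have [p ep] : poly_in_s (orbit_poly tau u)`_j; last by exists p.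
  apply: regular_fixed; last by have [i hi] := tau_id; exact: (orbit_poly_coef_fixed tau_comp).
  by apply: (subring_coef_prod regular_subring) => b; exact: conjugate_regular.
have [p hp] := boolp.choice coefS.
pose N := \poly_(j < (size (conjugates tau u)).+1) p j.
have eN : map_poly (ev1 iota s) N = orbit_poly tau u.
  apply/polyP => j; rewrite coef_map coef_poly; case: ltnP => hj; first exact/esym/hp.
  by rewrite [LHS](rmorph0 (ev1 iota s)) [RHS]nth_default // size_prod_XsubC.
exists N => //; rewrite -(size_map_inj_poly ev1_inj) ?rmorph0 // eN.
exact: size_prod_XsubC.
Qed.

(** Let l be the number of conjugates.  The constant term of N has degree
    l (q^3 + 1) / q^3 in s, an integer; since q^3 is prime to q^3 + 1, and l is at most
    q^3, this gives l = q^3.  The coefficient of u^j has degree at most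
    (q^3 - j) (q^3 + 1) / q^3 in s.  For j > 0, the integral part of this is
    q^3 - j, so the total degree of N is q^3 + 1, reached by s^(q^3 + 1). *)
Lemma full_orbit_lift : exists N : {poly {poly k}},
  [/\ map_poly (ev1 iota s) N = orbit_poly tau u, size (conjugates tau u) = (q ^ 3)%N,
      N \is monic, size N = d & tdeg_le d N /\ (N`_0)`_d != 0].
Proof.
have [N eN sN] := orbit_poly_lift; set l := size (conjugates tau u) in sN.
have [O pO hO] := place_at_infinity.
have q0' : (0 < q)%N by have := q_gt2 e; rewrite -/q; lia.
have N40 : (0 < q ^ 4)%N by rewrite expn_gt0 q0'.
have pN : [pchar K].-nat (q ^ 4)%N by rewrite [q]q_pow3 -expnM; exact: char3_pnat.
have coefN j : (orbit_poly tau u)`_j = (map_poly iota N`_j).[s] by rewrite -eN coef_map.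
have l0 : (0 < l <= q ^ 3)%N.
  by have [i hi] := tau_id; rewrite -card_translations; exact: (size_conjugates hi).
have deg0 : deg_eq O s (q ^ 4) (map_poly iota N`_0).[s] (l * (q * d)).
  by rewrite -coefN; apply: (deg_eq_const_prod pO) => b; exact: conjugate_degree.
have N00 : N`_0 != 0.
  apply: contra_eq_neq (deg_eq_neq0 pO hO N40 deg0) => ->.
  by rewrite map_poly0 horner0 ?eqxx.
have e0 : ((size (N`_0)%R).-1 * q ^ 4 = l * (q * d))%N.
  exact: (deg_eq_uniq pO hO (deg_eq_horner pO hO N40 pN N00) deg0).
have e0' : ((size (N`_0)%R).-1 * q ^ 3 = l * d)%N.
  apply/eqP; rewrite -(eqn_pmul2l q0'); apply/eqP.
  by rewrite mulnCA -expnS e0 mulnCA.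
have ql : (q ^ 3 %| l)%N.
  have : (q ^ 3 %| l * d)%N by rewrite -e0' dvdn_mull.
  by rewrite Gauss_dvdl // /d addn1 coprimenS.
have l3 : l = (q ^ 3)%N.
  by apply/eqP; rewrite eqn_leq (dvdn_leq _ ql) ?andbT; case/andP: l0.
have d0 : (size (N`_0)%R).-1 = d.
  by apply/eqP; rewrite -(eqn_pmul2r (m := q ^ 3)) ?expn_gt0 ?q0' // e0' l3 mulnC.
have Nmonic : N \is monic.
  apply/eqP; apply: ev1_inj; rewrite -lead_coef_map_inj ?rmorph0 //; last exact: ev1_inj.
  by rewrite eN rmorph1; apply/eqP; exact: monic_prod_XsubC.
exists N; split=> //; first by rewrite sN l3 /d addn1.
split; last by rewrite -d0 -lead_coefE lead_coef_eq0.
move=> j i dij; case: (eqVneq N`_j 0) => [->|Nj0]; first by rewrite coef0.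
have jl : (j <= l)%N.
  by rewrite leqNgt; apply: contra Nj0 => lj; rewrite nth_default // sN.
have := deg_eq_le pO hO (deg_eq_horner pO hO N40 pN Nj0)
  (j := ((l - j) * (q * d))%N).
rewrite -coefN => h; apply: nth_default; have {h} : ((size (N`_j)%R).-1 * q ^ 4 <= (l - j) * (q * d))%N.
  apply: h; apply: (deg_le_coef_prod pO N40 pN) => b hb.
  exact: (conjugate_degree pO hO hb).1.
case: j {Nj0} jl dij => [|j] jl dij; first by move: d0 dij; move: (size (N`_0)%R) (d) => a b; clear; lia.
have -> : ((size (N`_j.+1)%R).-1 * q ^ 4 = q * ((size (N`_j.+1)%R).-1 * q ^ 3))%N.
  by rewrite mulnCA -expnS.
have -> : ((l - j.+1) * (q * d) = q * ((l - j.+1) * d))%N by rewrite mulnCA.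
rewrite leq_pmul2l // l3 /d; move: (size (N`_j.+1)%R) => a.
move: jl dij; rewrite l3 /d; move: (q ^ 3)%N => Q; nia.
Qed.

Lemma w_neq0 : w != 0.
Proof.
have [O pO hO] := place_at_infinity.
have N40 : (0 < q ^ 4)%N by rewrite expn_gt0; have := q_gt2 e; rewrite -/q; lia.
have [h1 h2] := ree_equations.
have := deg_eq_neq0 pO hO N40 (ree_degree pO hO h1 h2).
by rewrite -/w.
Qed.

(** Divide G by the monic N over k[s].  The remainder vanishes at u, so that it is
    divisible by the minimal polynomial of u over the fixed field, of larger degree. *)
Lemma ev_kernel N : map_poly (ev1 iota s) N = orbit_poly tau u -> N \is monic ->
  forall G, ev iota u s G = 0 -> exists Q, G = Q * N.
Proof.
move=> eN Nmonic G G0; exists (Pdiv.Ring.rdivp G N).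
have div := Pdiv.RingMonic.rdivp_eq Nmonic G.
rewrite [LHS]div; set R := Pdiv.Ring.rmodp G N.
have sR : (size R < size N)%N by rewrite /R Pdiv.Ring.ltn_rmodpN0 // monic_neq0.
suff -> : R = 0 by rewrite addr0.
have [i hi] := tau_id.
have fixed_coef (H : {poly {poly k}}) j : fixed_by tau (map_poly (ev1 iota s) H)`_j.
  by rewrite coef_map; apply/fixed_rational; exists H`_j, 1; rewrite rmorph1 hornerC oner_eq0 divr1.
have dvd : orbit_poly tau u %| map_poly (ev1 iota s) R.
  have : orbit_poly tau u %| map_poly (ev1 iota s) G.
    by apply: root_conjugates => [j|]; [exact: fixed_coef|apply/rootP; exact: G0].
  by rewrite div rmorphD rmorphM /= eN dvdp_addr // dvdp_mulIr.
apply: contraTeq sR => R0; rewrite -leqNgt.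
rewrite -(size_map_inj_poly ev1_inj (rmorph0 _) N) -(size_map_inj_poly ev1_inj (rmorph0 _) R) eN.
apply: dvdp_leq => //; apply: contra R0 => /eqP h.
by apply/eqP/(map_inj_poly ev1_inj (rmorph0 _)); rewrite h rmorph0.
Qed.

(** By interpolation over the full orbit of u. *)
Lemma ev_fractions : size (conjugates tau u) = (q ^ 3)%N ->
  forall a, exists A B, ev iota u s B != 0 /\ a = ev iota u s A / ev iota u s B.
Proof.
move=> full a; have [i hi] := tau_id.
pose E b := exists A B, ev iota u s B != 0 /\ b = ev iota u s A / ev iota u s B.
have ED b c : E b -> E c -> E (b + c).
  move=> [A [B [B0 ->]]] [A' [B' [B0' ->]]]; exists (A * B' + A' * B), (B * B').
  by rewrite rmorphD !rmorphM mulf_neq0 // addf_div.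
have EM b c : E b -> E c -> E (b * c).
  move=> [A [B [B0 ->]]] [A' [B' [B0' ->]]]; exists (A * A'), (B * B').
  by rewrite !rmorphM mulf_neq0 // mulf_div.
have E0 : E 0 by exists 0, 1; rewrite rmorph0 rmorph1 oner_neq0 mul0r.
have EP (P : {poly K}) : (forall j, fixed_by tau P`_j) -> E P.[u].
  move=> hP; rewrite horner_coef; apply: big_ind => // j _; apply: EM.
    have /fixed_rational [p [p' [p'0 ->]]] := hP j.
    by exists p%:P, p'%:P; rewrite !evC.
  by exists ('X ^+ j), 1; rewrite rmorph1 oner_neq0 divr1 rmorphXn evX.
have full' : size (conjugates tau u) = #|{: translations}| by rewrite card_translations.
have [P [Q [fP fQ] [Q0 ->]]] := lagrange_interpolation hi tau_comp full' a.
have [A [B [B0 eP]]] := EP P fP; have [A' [B' [B0' eQ]]] := EP Q fQ.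
have A0 : ev iota u s A' != 0 by apply: contraNneq Q0 => h; rewrite eQ h mul0r.
by exists (A * B'), (B * A'); rewrite !rmorphM mulf_neq0 // eP eQ invf_div mulf_div.
Qed.

Lemma eval_at_generic (N : {poly {poly k}}) P : eval_in iota (hom d N) (generic_point u s) = 0 -> V P ->
  eval_at (hom d N) (col3 1 (evP P w_poly ^+ r) (P i3 0)) = 0.
Proof.
move=> h VP; pose c := fun i => tnth [tuple 1; w_poly ^+ r; 'X_i3] i : {mpoly k[4]}.
pose F := mmap (@mpolyC 4 k) c (hom d N).
have eK : evK F = eval_in iota (hom d N) (generic_point u s).
  rewrite /eval_in; apply: (rmorph_mmap (th := evK)) => [b|i] /=; first exact: evKC.
  rewrite mxE; case: i => [[|[|[|//]]] hi]; rewrite /c !(tnth_nth 0) /=.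
  - exact: rmorph1.
  - by rewrite -[mmap _ _ _]/(evK (w_poly ^+ r)) rmorphXn evK_w_poly.
  - by rewrite -[mmap _ _ _]/(evK 'X_i3) evKX (tnth_nth 0).
have := evP_eq0 (etrans eK h) VP; rewrite /F => <-.
rewrite /eval_at /meval; symmetry.
apply: (rmorph_mmap (th := evP P) (f' := idfun)) => [b|i] /=; first exact: evPC.
rewrite mxE; case: i => [[|[|[|//]]] hi]; rewrite /c !(tnth_nth 0) /=.
- exact: rmorph1.
- exact: rmorphXn.
- exact: evPX.
Qed.

(** It is enough that F(w^r, 1, s) vanishes at the points of the curve where w is not
    zero.  There, apply the vanishing of F(1, w^r, s) at the image of the point under
    the involution, and multiply by a power of w^r. *)
Lemma swap_vanishes (N : {poly {poly k}}) : tdeg_le d N ->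
  eval_in iota (hom d N) (generic_point u s) = 0 -> eval_in iota (hom d N) (swapped_point u s) = 0.
Proof.
move=> hN h; pose c := fun i => tnth [tuple w_poly ^+ r; 1; 'X_i3] i : {mpoly k[4]}.
pose F := mmap (@mpolyC 4 k) c (hom d N).
have eK : evK F = eval_in iota (hom d N) (swapped_point u s).
  rewrite /eval_in; apply: (rmorph_mmap (th := evK)) => [b|i] /=; first exact: evKC.
  rewrite mxE; case: i => [[|[|[|//]]] hi]; rewrite /c !(tnth_nth 0) /=.
  - by rewrite -[mmap _ _ _]/(evK (w_poly ^+ r)) rmorphXn evK_w_poly.
  - exact: rmorph1.
  - by rewrite -[mmap _ _ _]/(evK 'X_i3) evKX (tnth_nth 0).
(* The factor w takes care of the points with w = 0, where the involution is not
   defined. *)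
have : evK (w_poly * F) = 0; last first.
  by rewrite rmorphM evK_w_poly => /eqP; rewrite mulf_eq0 (negPf w_neq0) /= eK => /eqP.
apply: evK_eq0 => P VP; rewrite rmorphM; apply/eqP; rewrite mulf_eq0 -implyNb; apply/implyP => w0; apply/eqP.
have [h1 h2] := (ree_pointsP P).1 VP.
set a := P i0 0 in h1 h2; set b := P i1 0 in h1; set g := P i2 0 in h1; set t := P i3 0 in h2.
set W := evP P w_poly in w0; have eW : W = ree_w phik a b g by exact: evP_w_poly.
have w0' : ree_w phik a b g != 0 by rewrite -eW.
have [a' [b' [g' [c' ea' ew']]]] := ree_involution char3 h1 w0'.
have sig l : sigma phik l = l ^+ q := sigma_cube_power char3 e l.
have V' : V (col4 a' b' g' (t / W ^+ r)).
  apply/ree_pointsP; rewrite !mxE !(tnth_nth 0) /=; split=> //.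
  have e1 : (W ^+ r) ^+ n = W ^+ ree_m q0 q by rewrite -exprM mulnC nr.
  have e2 : phik W ^+ 3 = W ^+ (3 * q0) by rewrite cube_frobE -exprM mulnC.
  (* The increment of x is multiplied by W^(3 q0) / (W W^q) = W^(-m), so s^n by
     the n-th power of W^(-r). *)
  have e3 : W * W ^+ q = W ^+ (3 * q0) * W ^+ ree_m q0 q.
    rewrite -exprS -exprD; congr (_ ^+ _); rewrite /ree_m.
    by have : (3 * q0 <= q)%N; [rewrite /q; have := q0_gt0 e; rewrite -/q0; nia|lia].
  rewrite -(sig a') ea' -eW !sig h2 expr_div_n e1 e2 e3; field.
  by rewrite !expf_neq0.
have := eval_at_generic h V'; rewrite evP_w_poly !mxE !(tnth_nth 0) /= ew' -eW.
have W0 : W ^+ r != 0 by rewrite expf_neq0.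
have hH : hom d N \is d.-homog by exact: hom_homog.
move=> e0; have : (W ^+ r) ^+ d * eval_at (hom d N) (col3 1 (W^-1 ^+ r) (t / W ^+ r)) = 0.
  by rewrite e0 mulr0.
rewrite /eval_at /meval -(mmap_homog idfun _ _ hH) => <-.
apply: (rmorph_mmap (th := evP P) (f' := idfun)) => [l|i] /=; first exact: evPC.
rewrite mxE; case: i => [[|[|[|//]]] hi]; rewrite /c !(tnth_nth 0) /=.
- by rewrite mulr1; exact: rmorphXn.
- by rewrite exprVn mulfV //; exact: rmorph1.
- by rewrite mulrCA mulfV // mulr1; exact: evPX.
Qed.

Lemma translations_two_inner_galois_points : has_plane_model_with_two_inner_galois_points iota d.
Proof.
have [N [eN full Nmonic sN [hN Ntop]]] := full_orbit_lift.
have [i hi] := tau_id.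
have evN : ev iota u s N = 0.
  rewrite /ev /= eN; apply/rootP; rewrite /orbit_poly root_prod_XsubC.
  exact: (mem_conjugates hi).
have d_gt2 : (2 < d)%N.
  have h : (2 < q)%N := q_gt2 e.
  have h3 : (q <= q ^ 3)%N by rewrite -[X in (X <= _)%N]expn1 leq_pexp2l //; lia.
  by rewrite /d addn1 ltnS; apply: leq_trans h3; exact: ltnW.
apply: (two_inner_galois_points d_gt2 hN Nmonic sN Ntop).
- exact: ev_kernel eN Nmonic.
- exact: evN.
- exact: ev_fractions full.
- by apply: swap_vanishes => //; rewrite eval_dehom dehom_hom.
- have -> : rational_in_s iota s = fixed_by tau.
    apply: boolp.funext => a; apply: boolp.propext; split; first by move/fixed_rational.
    by move=> h; apply/fixed_rational.
  exact: (artin_galois hi tau_comp).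
Qed.
End Group.

Theorem ree_quotient_two_inner_galois_points :
  has_plane_model_with_two_inner_galois_points iota (q ^ 3 + 1)%N.
Proof.
have q1 : (1 < q)%N by apply: ltnW; exact: q_gt2.
have q0k : q%:R = 0 :> k.
  by rewrite [q]q_pow3 natrX (pcharf0 char3) expr0n.
have [rs [urs srs ers]] := artin_schreier_roots q1 q0k.
have mem c : c \in rs -> c ^+ q = c by rewrite (mem_rs ers) => /eqP.
have htau (i : translations rs) : exists th : {rmorphism K -> K},
  [/\ forall c, th (iota c) = iota c, th x = x + iota (val i.1.1),
    th y = translate_y phiK (iota (val i.1.1)) (iota (val i.1.2)) x y,
    th z = translate_z phiK (iota (val i.1.1)) (iota (val i.2)) x y z & th s = s].
  by apply: translation; apply: mem; exact: valP.
have {htau} [tau htau] := boolp.choice htau.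
apply: (@translations_two_inner_galois_points rs urs srs ers tau) => i; by have [] := htau i.
Qed.
End ReeFunctionField.

(** * Quotients by groups of roots of unity *)
Section RootsOfUnity.
Variables (k : closedFieldType) (m : nat).
Hypothesis m0 : m%:R != 0 :> k.

Lemma prim_root_exists : exists xi : k, m.-primitive_root xi.
Proof.
have m_gt0 : (0 < m)%N by move: m0; case: m => //; rewrite eqxx.
pose p : {poly k} := 'X^m - 1.
have sp : size p = m.+1 by rewrite /p -polyC1 size_XnsubC.
have lp : lead_coef p = 1 by apply/eqP; rewrite /p -polyC1; exact: monicXnsubC.
have [rs] := closed_field_poly_normal p; rewrite lp scale1r => ep.
have srs : size rs = m by have := sp; rewrite ep size_prod_XsubC => -[].
have mem c : c \in rs -> c ^+ m = 1.
  rewrite -root_prod_XsubC -ep /p rootE !hornerE => /eqP/eqP.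
  by rewrite subr_eq0 => /eqP.
have : has m.-primitive_root rs.
  apply: cyclic.has_prim_root; rewrite ?srs //.
    by apply/allP => c /mem h; apply/unity_rootP.
  rewrite -separable_prod_XsubC -ep /p -polyC1 unlock derivB derivXn derivC subr0.
  rewrite -scaler_nat coprimepZr // coprimep_expr //.
  rewrite -[X in coprimep _ X]subr0 -polyC0 coprimep_XsubC rootE !hornerE expr0n.
  by rewrite gtn_eqF //= sub0r oppr_eq0 oner_eq0.
by move=> /hasP [c _ h]; exists c.
Qed.

(** A multiplicatively closed set of m-th roots of unity is generated by xi^n, where xi
    is a primitive root and n the least positive exponent that occurs: the Euclidean
    division of any exponent by n leaves the remainder 0. *)
Lemma unity_subgroup (Z : k -> Prop) : Z 1 -> (forall a b, Z a -> Z b -> Z (a * b)) ->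
  (forall a, Z a -> a ^+ m = 1) ->
  exists n r zeta, [/\ (n * r = m)%N, r.-primitive_root zeta, Z zeta & forall a, Z a -> a ^+ r = 1].
Proof.
move=> Z1 ZM Zm; have [xi prim] := prim_root_exists.
have m_gt0 := prim_order_gt0 prim.
have ZX a i : Z a -> Z (a ^+ i).
  by move=> Za; elim: i => [|i IH] //; rewrite exprS; exact: ZM.
pose I i := boolp.asbool (Z (xi ^+ i)).
have IP i : reflect (Z (xi ^+ i)) (I i) := boolp.asboolP _.
have exI : exists i, (0 < i)%N && I i.
  by exists m; rewrite m_gt0; apply/IP; rewrite (prim_expr_order prim).
case: (ex_minnP exI) => n /andP [n0 /IP In] min.
have dvd i : I i -> (n %| i)%N.
  move=> /IP Zi; rewrite /dvdn; apply/negPn/negP; rewrite -lt0n => i0.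
  suff h : I (i %% n)%N by have := min _ (introT andP (conj i0 h)); rewrite leqNgt ltn_mod n0.
  apply/IP; have -> : xi ^+ (i %% n) = xi ^+ i * (xi ^+ n) ^+ (i %/ n * m.-1).
    rewrite -exprM -exprD {2}(divn_eq i n) addnAC.
    have -> : (i %/ n * n + n * (i %/ n * m.-1) = m * (n * (i %/ n)))%N.
      by rewrite -{2}(prednK m_gt0) mulSn; lia.
    by rewrite exprD exprM (prim_expr_order prim) expr1n mul1r.
  by apply: ZM => //; exact: ZX.
have nm : (n %| m)%N by apply: dvd; apply/IP; rewrite (prim_expr_order prim).
exists n, (m %/ n)%N, (xi ^+ n); split=> //; first by rewrite mulnC divnK.
  by have := exp_prim_root prim n; rewrite (gcdn_idPl nm).
move=> a Za; have [[i hi] /= ea] := prim_rootP prim (Zm _ Za); rewrite ea in Za *.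
have /dvdnP [l ->] : (n %| i)%N.
  by apply: dvd; apply/IP.
by rewrite -exprM -mulnA [(n * _)%N]mulnC divnK // mulnC exprM (prim_expr_order prim) expr1n.
Qed.
End RootsOfUnity.

Lemma sum_prim_root (F : fieldType) r (zeta : F) d : r.-primitive_root zeta ->
  \sum_(i < r) zeta ^+ (i * d) = if (r %| d)%N then r%:R else 0.
Proof.
move=> prim; have r0 := prim_order_gt0 prim.
under eq_bigr => i _ do rewrite mulnC exprM.
case: ifP => [/dvdnP [l ->]|rd].
  under eq_bigr => i _ do rewrite mulnC exprM (prim_expr_order prim) expr1n expr1n.
  by rewrite sumr_const card_ord.
have z1 : zeta ^+ d - 1 != 0.
  rewrite subr_eq0 -(expr0 zeta) (eq_prim_root_expr prim) /=.
  by rewrite mod0n; apply: contraFN rd => /eqP; rewrite /dvdn => ->.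
apply: (mulfI z1); rewrite mulr0 -subrX1 -exprM mulnC exprM (prim_expr_order prim).
by rewrite expr1n subrr.
Qed.

Lemma curve_aut_rmorphism (k : closedFieldType) (K : fieldType) (iota : {rmorphism k -> K})
  (s : K -> K) : curve_aut iota s -> exists th : {rmorphism K -> K}, th =1 s.
Proof.
move=> [_ sD sM sC]; apply: rmorphism_of => //; first by rewrite -(rmorph1 iota) sC.
have sN a : s (- a) = - s a.
  by rewrite -mulN1r -(rmorph1 iota) -rmorphN sM sC rmorphN rmorph1 mulN1r.
by move=> a b; rewrite sD sN.
Qed.

Section CyclicCover.
Variables (k : closedFieldType) (K : fieldType) (iota : {rmorphism k -> K}).
Variables (V : 'cV[k]_4 -> Prop) (r : nat) (x y z t : K) (zeta : k).
Hypothesis hK : affine_function_field iota V (col4 x y z t).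
Hypothesis prim : r.-primitive_root zeta.
Hypothesis r0 : r%:R != 0 :> k.
Local Notation i3 := (@Ordinal 4 3 isT).
Local Notation i0 := (@Ordinal 4 0 isT).
Local Notation i1 := (@Ordinal 4 1 isT).
Local Notation i2 := (@Ordinal 4 2 isT).

Let r_gt0 : (0 < r)%N. Proof. exact: prim_order_gt0 prim. Qed.

Lemma eval_in_col4 p a b c d : eval_in iota p (col4 a b c d) =
  \sum_(m <- msupp p) iota p@_m * (a ^+ m i0 * b ^+ m i1 * c ^+ m i2 * d ^+ m i3).
Proof.
rewrite /eval_in /mmap; apply: eq_bigr => m _; congr (_ * _).
rewrite /mmap1 !big_ord_recr big_ord0 /= mul1r !mxE !(tnth_nth 0) /=.
by do !congr (_ * _); congr (_ ^+ _); congr (m _); exact: val_inj.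
Qed.

(** The sum over t, zeta t, zeta^2 t, .. keeps the monomials in which the exponent of t
    is a multiple of r, multiplied by r, and kills the others. *)
Lemma average_root_of_unity p : exists p', \sum_(i < r) eval_in iota p (col4 x y z (iota zeta ^+ i * t)) =
  eval_in iota p' (col4 x y z (t ^+ r)).
Proof.
pose ev' : {rmorphism {mpoly k[4]} -> K} := mmap iota (fun i => (col4 x y z (t ^+ r)) i 0).
have evC c : ev' c%:MP = iota c by rewrite /ev' /= mmapC.
have evX i : ev' 'X_i = tnth [tuple x; y; z; t ^+ r] i by rewrite /ev' /= mmapX mmap1U mxE.
suff [p' ->] : exists p', \sum_(i < r) eval_in iota p (col4 x y z (iota zeta ^+ i * t)) = ev' p' by exists p'.
under eq_bigr => i _ do rewrite eval_in_col4.
rewrite exchange_big; apply: (big_ind (fun a => exists p', a = ev' p')) => [|a b [pa ->] [pb ->]|m _].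
- by exists 0; rewrite rmorph0.
- by exists (pa + pb); rewrite rmorphD.
have -> : \sum_(i < r) iota p@_m * (x ^+ m i0 * y ^+ m i1 * z ^+ m i2 * (iota zeta ^+ i * t) ^+ m i3) =
  iota p@_m * (x ^+ m i0 * y ^+ m i1 * z ^+ m i2 * t ^+ m i3) * iota (\sum_(i < r) zeta ^+ (i * m i3)).
  rewrite rmorph_sum mulr_sumr; apply: eq_bigr => i _; rewrite exprMn -exprM rmorphXn; ring.
rewrite sum_prim_root //; case: ifP => [/dvdnP [l ->]|_]; last by exists 0; rewrite !rmorph0 mulr0.
exists ((p@_m)%:MP * ('X_i0 ^+ m i0 * 'X_i1 ^+ m i1 * 'X_i2 ^+ m i2 * 'X_i3 ^+ l) * r%:R%:MP).
by rewrite !(rmorphM ev') !(rmorphXn ev') !evC !evX !(tnth_nth 0) /= mulnC exprM.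
Qed.

(** Write a = P / R.  Then a is also the quotient of the sums over the conjugates of
    t^l P and t^l R, provided that the latter is not zero.  This holds for some l < r,
    since the sum over l of t^(-l) times these denominators is r R. *)
Lemma fixed_rational_power a (s : {rmorphism K -> K}) : (forall c, s (iota c) = iota c) ->
  s x = x -> s y = y -> s z = z -> s t = iota zeta * t -> s a = a ->
  exists p p', eval_in iota p' (col4 x y z (t ^+ r)) != 0 /\
    a = eval_in iota p (col4 x y z (t ^+ r)) / eval_in iota p' (col4 x y z (t ^+ r)).
Proof.
move=> sC sx sy sz st sa; have [P [R [R0 ea]]] := hK.2 a.
pose conj i p := eval_in iota p (col4 x y z (iota zeta ^+ i * t)).
have conj0 p : conj 0 p = eval_in iota p (col4 x y z t) by rewrite /conj expr0 mul1r.
have conjS i p : s (conj i p) = conj i.+1 p.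
  rewrite /conj /eval_in; apply: (rmorph_mmap (th := s)) => [c|j] /=.
    exact: sC.
  rewrite !mxE; case: j => [[|[|[|[|//]]]] hj]; rewrite !(tnth_nth 0) //=.
  by rewrite rmorphM rmorphXn sC st exprSr mulrA.
have conjX i l : conj i ('X_i3 ^+ l) = (iota zeta ^+ i * t) ^+ l.
  by rewrite /conj /eval_in rmorphXn /= mmapX mmap1U mxE (tnth_nth 0).
have conjM i p p' : conj i (p * p') = conj i p * conj i p' by rewrite /conj /eval_in rmorphM.
have eq_conj i : conj i P = a * conj i R.
  by elim: i => [|i IH]; rewrite -?conjS ?IH ?rmorphM ?sa // !conj0 ea divfK.
(* If t = 0, then t^r = t. *)
have [t0|t0] := eqVneq t 0.
  by have -> : t ^+ r = t; [rewrite t0 expr0n gtn_eqF|exists P, R].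
have [l hl] : exists l : 'I_r, \sum_(i < r) conj i ('X_i3 ^+ l * R) != 0.
  apply/existsP; rewrite -negb_forall; apply/negP => /forallP h.
  have : \sum_(l < r) t ^- l * \sum_(i < r) conj i ('X_i3 ^+ l * R) = 0.
    by apply: big1 => l _; have /eqP -> := h l; rewrite mulr0.
  under eq_bigr => l _ do rewrite mulr_sumr.
  rewrite exchange_big /=.
  have -> : \sum_(i < r) \sum_(l < r) t ^- l * conj i ('X_i3 ^+ l * R) =
      \sum_(i < r) iota (\sum_(l < r) zeta ^+ (l * i)) * conj i R.
    apply: eq_bigr => i _; rewrite rmorph_sum mulr_suml; apply: eq_bigr => l _.
    rewrite conjM conjX exprMn mulrA mulrCA mulVf ?expf_neq0 // mulr1.
    by rewrite -exprM rmorphXn mulnC.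
  under eq_bigr => i _ do rewrite sum_prim_root //.
  rewrite (bigD1 (Ordinal r_gt0)) //= big1 ?addr0 => [|i i0'].
    rewrite dvdn0 conj0 => /eqP; rewrite mulf_eq0 (negPf R0) orbF fmorph_eq0.
    exact/negP.
  rewrite gtnNdvd ?rmorph0 ?mul0r // lt0n; apply: contraNneq i0' => h0; exact/eqP/val_inj.
have [p ep] := average_root_of_unity ('X_i3 ^+ l * P).
have [p' ep'] := average_root_of_unity ('X_i3 ^+ l * R).
exists p, p'; rewrite -ep -ep'; split=> //; apply: (mulIf hl); rewrite divfK //.
rewrite mulr_sumr; apply: eq_bigr => i _; rewrite -!/(conj _ _) !conjM eq_conj; ring.
Qed.

End CyclicCover.

(** The map (x, y, z, t) |-> (x, y, z, t^r) from the curve with exponent n r to that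
    with exponent n is surjective on points. *)
Lemma eval_in_power_eq0 (k : closedFieldType) (K : fieldType) (iota : {rmorphism k -> K})
    q0 q n r (x y z t : K) p : (0 < r)%N ->
  affine_function_field iota (@ree_points k q0 q (n * r)) (col4 x y z t) ->
  eval_in iota p (col4 x y z (t ^+ r)) = 0 <-> forall P, ree_points q0 q n P -> eval_at p P = 0.
Proof.
move=> r_gt0 hK; pose c (S : comNzRingType) (a b g s : S) (i : 'I_4) := tnth [tuple a; b; g; s ^+ r] i.
pose X i (hi : (i < 4)%N) : {mpoly k[4]} := 'X_(Ordinal hi).
pose F := mmap (@mpolyC 4 k) (c _ (X 0%N isT) (X 1%N isT) (X 2%N isT) (X 3%N isT)) p.
have FE (S : fieldType) (f : {rmorphism k -> S}) (a b g s : S) :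
    eval_in f F (col4 a b g s) = eval_in f p (col4 a b g (s ^+ r)).
  pose ev : {rmorphism {mpoly k[4]} -> S} := mmap f (fun i => col4 a b g s i 0).
  have evX i hi : ev (@X i hi) = tnth [tuple a; b; g; s] (Ordinal hi).
    by rewrite /ev /= mmapX mmap1U mxE.
  rewrite /eval_in; apply: (rmorph_mmap (th := ev)) => [l|i] /=; first by rewrite mmapC.
  rewrite mxE; case: i => [[|[|[|[|//]]]] hi]; rewrite /c !(tnth_nth 0) //=.
  - by rewrite -[LHS]/(ev (X 0%N isT)) evX.
  - by rewrite -[LHS]/(ev (X 1%N isT)) evX.
  - by rewrite -[LHS]/(ev (X 2%N isT)) evX.
  - by rewrite -[LHS]/(ev (X 3%N isT ^+ r)) rmorphXn evX.
have FEk (a b g s : k) : eval_at F (col4 a b g s) = eval_at p (col4 a b g (s ^+ r)).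
  exact: (FE k idfun).
rewrite -FE; split=> [/hK.1 h P [a [b [g [s [-> h1 h2 h3]]]]] | h].
  have [u eu] : exists u : k, u ^+ r = s.
    have [u] := @solve_monicpoly k r (fun i => if i is 0%N then s else 0) r_gt0.
    rewrite (bigD1 (Ordinal r_gt0)) //= mulr1 big1 ?addr0 => [|[[|i] hi] //= _]; first by exists u.
    by rewrite mul0r.
  rewrite -eu -FEk; apply: h; exists a, b, g, u; split=> //.
  by rewrite h3 -eu -exprM mulnC.
apply/hK.1 => P [a [b [g [s [-> h1 h2 h3]]]]]; rewrite FEk; apply: h.
by exists a, b, g, (s ^+ r); split=> //; rewrite h3 -exprM mulnC.
Qed.

Section Quotient.
Variables (k : closedFieldType) (char3 : 3 \in [pchar k]) (e : nat).
Let q0 := (3 ^ e)%N.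
Let q := (3 * q0 ^ 2)%N.
Let m := ree_m q0 q.
Variables (K : fieldType) (iota : {rmorphism k -> K}) (x y z t : K).
Hypothesis hK : affine_function_field iota (@ree_cover k q0 q) (col4 x y z t).
Variables (H : (K -> K) -> Prop) (hH : aut_subgroup iota H).
Hypothesis hHC : forall s, H s -> ree_cyclic_group iota q0 q x y z t s.

(** m = 3 q0 (q0 - 1) + 1 is congruent to 1 modulo 3. *)
Lemma ree_m_unit : m%:R != 0 :> k.
Proof.
suff -> : m = (3 * (q0 * (q0 - 1)) + 1)%N.
  by rewrite natrD natrM (pcharf0 char3) mul0r add0r oner_neq0.
rewrite /m /ree_m; congr (_ + 1)%N; rewrite /q; have := q0_gt0 e; rewrite -/q0; nia.
Qed.

(** The constants c with s t = c t, for s in H, form a group of m-th roots of unity,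
    to which [unity_subgroup] applies. *)
Lemma quotient_generator : exists n r zeta, [/\ (n * r = m)%N, r.-primitive_root zeta,
  exists2 s, H s & s t = iota zeta * t &
  forall s, H s -> [/\ s x = x, s y = y, s z = z & s (t ^+ r) = t ^+ r]].
Proof.
case: hH => hA h1 hM _.
pose Z (c : k) := c ^+ m = 1 /\ exists2 s, H s & s t = iota c * t.
have [|a b [am [s Hs st]] [bm [s' Hs' st']]|a []|n [r [zeta [nr prim [_ Zz] Zr]]]] := @unity_subgroup k m ree_m_unit Z => //.
- by split; [rewrite expr1n|exists id; rewrite ?rmorph1 ?mul1r].
- split; first by rewrite exprMn am bm mulr1.
  exists (s' \o s); first exact: hM.
  by case: (hA _ Hs') => _ _ sM sC; rewrite /= st sM sC st' rmorphM mulrA.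
exists n, r, zeta; split=> // s Hs; have [_ [c cm [sx sy sz st]]] := hHC Hs.
have [th eth] := curve_aut_rmorphism (hA _ Hs).
split=> //; rewrite -eth rmorphXn eth st exprMn -rmorphXn (Zr c) ?rmorph1 ?mul1r //.
by split=> //; exists s.
Qed.

Lemma quotient_plane_model (L : fieldType) (iotaL : {rmorphism k -> L}) (j : {rmorphism L -> K}) :
  quotient_function_field iota H iotaL j ->
  has_plane_model_with_two_inner_galois_points iotaL (q ^ 3 + 1)%N.
Proof.
move=> [jC jH]; have [n [r [zeta [nr prim [s Hs st] fix_H]]]] := quotient_generator.
have lift a : (forall s, H s -> s a = a) -> exists b, j b = a by move/jH.
have [xL ex] : exists b, j b = x by apply: lift => s' /fix_H [].
have [yL ey] : exists b, j b = y by apply: lift => s' /fix_H [].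
have [zL ez] : exists b, j b = z by apply: lift => s' /fix_H [].
have [sL es] : exists b, j b = t ^+ r by apply: lift => s' /fix_H [].
have r_gt0 := prim_order_gt0 prim.
have r0 : r%:R != 0 :> k.
  by apply: contraNneq ree_m_unit => h; rewrite -nr natrM h mulr0.
have jE p : j (eval_in iotaL p (col4 xL yL zL sL)) = eval_in iota p (col4 x y z (t ^+ r)).
  rewrite /eval_in; apply: rmorph_mmap => [c|i] /=; first exact: jC.
  by rewrite !mxE; case: i => [[|[|[|[|//]]]] hi]; rewrite !(tnth_nth 0).
have hKr : affine_function_field iota (@ree_points k q0 q (n * r)) (col4 x y z t) by rewrite nr.
apply: (ree_quotient_two_inner_galois_points char3 nr (x := xL) (y := yL) (z := zL) (s := sL)); split=> [p|a].
  rewrite -(eval_in_power_eq0 _ r_gt0 hKr) -jE; split=> [->|/eqP]; first exact: rmorph0.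
  by rewrite fmorph_eq0 => /eqP.
have [hA _ _ _] := hH; have [th eth] := curve_aut_rmorphism (hA _ Hs).
have [_ _ _ sC] := hA _ Hs; have [sx sy sz _] := fix_H _ Hs.
have sa : s (j a) = j a by apply: (jH (j a)).1 => //; exists a.
have [||||||p [p' [p0 ea]]] := @fixed_rational_power _ _ iota _ r x y z t zeta hK prim r0 (j a) th.
all: try by move=> *; rewrite eth.
exists p, p'; rewrite -(fmorph_eq0 j) jE; split=> //.
by apply: (fmorph_inj j); rewrite ea fmorph_div !jE.
Qed.
End Quotient.

Theorem theorem5 (k : closedFieldType) (hk : 3%N \in [pchar k])
    (q0 q : nat) (hq0 : exists e : nat, q0 = (3 ^ e)%N) (hq : q = (3 * q0 ^ 2)%N)
    (K : fieldType) (iota : {rmorphism k -> K}) (x y z t : K)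
    (hK : affine_function_field iota (@ree_cover k q0 q) (col4 x y z t))
    (H : (K -> K) -> Prop) (hH : aut_subgroup iota H)
    (hHC : forall s, H s -> ree_cyclic_group iota q0 q x y z t s) :
  has_plane_model_with_two_inner_galois_points iota (q ^ 3 + 1)%N /\
  (forall (L : fieldType) (iotaL : {rmorphism k -> L}) (j : {rmorphism L -> K}),
     quotient_function_field iota H iotaL j ->
     has_plane_model_with_two_inner_galois_points iotaL (q ^ 3 + 1)%N).
Proof.
case: hq0 => e eq0; subst q0 q; split=> [|L iotaL j].
  exact: (ree_quotient_two_inner_galois_points hk (muln1 _) hK).
exact: (quotient_plane_model hk hK hH hHC).
Qed.
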